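(* Let $n\ge 1$ and $a\in\mathbb{R}$ with $P_n(a)=\mathbb{P}(V_n(X_n)\ge a)>0$. In the Feynman–Kac particle setting described in the context, the estimator $P_n^N(a)$ is unbiased, i.e. $\mathbb{E}[P_n^N(a)]=P_n(a)$ for every $N\ge1$, and, as $N\to\infty$, the following convergence in distribution holds: $$\sqrt{N}\,[P_n^N(a)-P_n(a)]\longrightarrow \mathcal{N}(0,\sigma_n^\gamma(a)^2),$$ with asymptotic variance $$\sigma_n^\gamma(a)^2=\sum_{p=1}^n\Big[\gamma_p(1)\,\gamma_p^-(1)\,\eta_p^-\big(P_{p,n}(a)^2\big)-P_n(a)^2\Big],$$ where $P_{p,n}(a):E_p\to[0,1]$ is defined by $P_{p,n}(a)(x_p)=\mathbb{E}[\mathbf{1}_{V_n(X_n)\ge a}\mid X_p=x_p]$ (viewed as a function on $F_p$ through the last coordinate). In addition, for any bounded measurable $\varphi_n:F_n\to\mathbb{R}$, the estimator $P_n^N(a,\varphi_n)$ satisfies, as $N\to\infty$, in distribution, $$\sqrt{N}\,[P_n^N(a,\varphi_n)-P_n(a,\varphi_n)]\longrightarrow\mathcal{N}(0,\sigma_n(a,\varphi_n)^2),$$ with asymptotic variance $$\sigma_n(a,\varphi_n)^2=P_n(a)^{-2}\sum_{p=1}^n\gamma_p(1)\,\gamma_p^-(1)\,\eta_p^-\big(P_{p,n}(a,\varphi_n)^2\big),$$ where $P_{p,n}(a,\varphi_n):F_p\to\mathbb{R}$ is the bounded measurable function $$P_{p,n}(a,\varphi_n)(x_0,\dots,x_p)=\mathbb{E}\big[(\varphi_n(X_0,\dots,X_n)-P_n(a,\varphi_n))\mathbf{1}_{V_n(X_n)\ge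 a}\,\big|\,(X_0,\dots,X_p)=(x_0,\dots,x_p)\big].$$
   Context: Markov chain. $(X_n)_{n\ge0}$ is a (nonhomogeneous) Markov chain with $X_n$ taking values in a measurable space $(E_n,\mathcal{E}_n)$, Markov transition kernels $K_n(x_{n-1},dx_n)$ from $E_{n-1}$ to $E_n$, and deterministic initial value $X_0=x_0$. $F_n=E_0\times\cdots\times E_n$ and $Y_n=(X_0,\dots,X_n)\in F_n$ is the historical process, with Markov transitions $M_n(y_{n-1},dy_n)$ (keep the path $y_{n-1}$ and append a point drawn from $K_n$ started at its last coordinate). $\mathcal{B}_b(F_n)$ is the space of bounded measurable real functions on $F_n$. $V_n:E_n\to\mathbb{R}$ is a measurable function. Conditional expectations given $X_p=x_p$ or $(X_0,\dots,X_p)=(x_0,\dots,x_p)$ are those given by the transition kernels. Potentials. $G_n:F_n\to(0,\infty)$, $n\ge1$, are measurable with $\sup_{(y,y')\in F_n^2}G_n(y)/G_n(y')<\infty$ for each $n$. Write $G_n^-=1/G_n$. Feynman–Kac measures. For $f_n\in\mathcal{B}_b(F_n)$, $n\ge1$: $\gamma_n(f_n)=\mathbb{E}[f_n(Y_n)\prod_{1\le k<n}G_k(Y_k)]$ and $\eta_n(f_n)=\gamma_n(f_n)/\gamma_n(1)$. The measures $\gamma_n^-,\eta_n^-$ are defined in the same way with each $G_k$ replaced by $G_k^-$. (Empty products equal $1$.) For $n\ge2$ and a probability measure $\mu$ on $F_{n-1}$, $\Phi_n(\mu)(dy_n)=\int_{F_{n-1}}\mu(dy_{n-1})G_{n-1}(y_{n-1})M_n(y_{n-1},dy_n)/\mu(G_{n-1})$;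 one has $\eta_1=M_1(x_0,\cdot)$ and $\eta_n=\Phi_n(\eta_{n-1})$. Particle system. For each $N\ge1$, $\xi_n=(\xi_n^i)_{1\le i\le N}$, $n\ge1$, is a Markov chain with $\xi_n\in F_n^N$: $\xi_1^1,\dots,\xi_1^N$ are i.i.d. with law $\eta_1$, and for $n\ge2$, conditionally on $\xi_1,\dots,\xi_{n-1}$, the $\xi_n^1,\dots,\xi_n^N$ are i.i.d. with law $\Phi_n(\eta_{n-1}^N)$, where $\eta_n^N=\frac1N\sum_{i=1}^N\delta_{\xi_n^i}$. Set $\gamma_n^N(f_n)=\eta_n^N(f_n)\prod_{1\le p<n}\eta_p^N(G_p)$. Rare event quantities and estimators. For $\varphi_n\in\mathcal{B}_b(F_n)$, $T_n^{(a)}(\varphi_n)(x_0,\dots,x_n)=\varphi_n(x_0,\dots,x_n)\mathbf{1}_{V_n(x_n)\ge a}\prod_{1\le p<n}G_p^-(x_0,\dots,x_p)$. $P_n(a)=\mathbb{P}(V_n(X_n)\ge a)$ and $P_n(a,\varphi_n)=\mathbb{E}[\varphi_n(X_0,\dots,X_n)\mid V_n(X_n)\ge a]$. $P_n^N(a)=\gamma_n^N(T_n^{(a)}(1))=\eta_n^N(T_n^{(a)}(1))\prod_{1\le p<n}\eta_p^N(G_p)$. $P_n^N(a,\varphi_n)=\eta_n^N(T_n^{(a)}(\varphi_n))/\eta_n^N(T_n^{(a)}(1))$, with the convention $P_n^N(a,\varphi_n)=0$ when $\eta_n^N(T_n^{(a)}(1))=0$. $\mathcal{N}(0,\sigma^2)$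 is the centered Gaussian law with variance $\sigma^2$ (the Dirac mass at $0$ if $\sigma=0$). *)

(* Defs.v *)
From HB Require Import structures.
From mathcomp Require Import all_boot all_order all_algebra.
From mathcomp Require Import all_classical all_reals all_analysis.
From mathcomp Require Import measurable_realfun.

Set Implicit Arguments.
Unset Strict Implicit.
Unset Printing Implicit Defensive.

Import Order.TTheory GRing.Theory Num.Theory.
Import numFieldNormedType.Exports.

Local Open Scope classical_set_scope.
Local Open Scope ring_scope.

Section path_space.
Context (d : nat -> measure_display) (E : forall n, measurableType (d n)).

Fixpoint path_display n : measure_display :=
  if n is n'.+1 then measure_prod_display (path_display n', d n'.+1) else d 0%N.

(* F_n = E_0 x ... x E_n with the product sigma-algebra, nested to the left:
   F_0 = E_0 and F_(n+1) = F_n x E_(n+1). *)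
Fixpoint path_space n : measurableType (path_display n) :=
  match n return measurableType (path_display n) with
  | 0 => E 0%N
  | n'.+1 => (path_space n' * E n'.+1)%type
  end.

Definition last_pt n : path_space n -> E n :=
  match n return path_space n -> E n with
  | 0 => fun y => y
  | n'.+1 => fun y => y.2
  end.

Lemma measurable_last_pt n : measurable_fun setT (@last_pt n).
Proof. by case: n => [|n] /=; [exact: measurable_id|exact: measurable_snd]. Qed.

Fixpoint history (Omega : Type) (X : forall n, Omega -> E n) n (w : Omega) :
    path_space n :=
  match n return path_space n with
  | 0 => X 0%N w
  | n'.+1 => (history X n' w, X n'.+1 w)
  end.

(* [along h y p] is h_p(y_0,...,y_p) when y = (y_0,...,y_n) and p <= n,
   and 0 when p > n; see [along_history]. *)
Fixpoint along (A : nmodType) (h : forall p, path_space p -> A) n :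
    path_space n -> nat -> A :=
  match n return path_space n -> nat -> A with
  | 0 => fun y p => if p == 0%N then h 0%N y else 0
  | n'.+1 => fun y p => if p == n'.+1 then h n'.+1 y else along h y.1 p
  end.

Lemma along_history (A : nmodType) (h : forall p, path_space p -> A)
    (Omega : Type) (X : forall n, Omega -> E n) n p w :
  (p <= n)%N -> along h (history X n w) p = h p (history X p w).
Proof.
elim: n => [|n IH]; first by rewrite leqn0 => /eqP ->.
rewrite leq_eqVlt => /orP[/eqP->|]; first by rewrite /= eqxx.
by rewrite ltnS => pn /=; rewrite ltn_eqF ?ltnS// IH.
Qed.

End path_space.

Section conditional_expectation.
Context (d : nat -> measure_display) (S : forall n, measurableType (d n)).
Context (R : realType) (L : forall n, R.-pker (S n) ~> (S n.+1)).

(* the family of functions equal to f at time n and to 0 at the other times *)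
Definition at_time n (f : S n -> R) (p : nat) : S p -> R :=
  match n =P p with
  | ReflectT e => fun x => f (eq_rect_r (fun k => S k : Type) x e)
  | ReflectF _ => fun=> 0
  end.

Definition transition_op (h : forall p, S p -> R) (p : nat) (x : S p) : R :=
  \int[L p x]_z h p.+1 z.

(* E[f(Z_n) | Z_p = x], for p <= n and a chain Z whose transition from S_k to
   S_(k+1) is L_k: the composition of the kernels L_p, ..., L_(n-1) applied
   to f; see [cond_expE] and [cond_exp_step]. *)
Definition cond_exp (p n : nat) (f : S n -> R) : S p -> R :=
  iter (n - p) transition_op (at_time f) p.
Arguments cond_exp : clear implicits.

Lemma cond_expE n (f : S n -> R) : cond_exp n n f = f.
Proof.
rewrite /cond_exp subnn /= /at_time; case: eqP => // e.
by rewrite (eq_irrelevance e erefl).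
Qed.

Lemma cond_exp_step p n (f : S n -> R) x : (p < n)%N ->
  cond_exp p n f x = \int[L p x]_z cond_exp p.+1 n f z.
Proof. by move=> pn; rewrite /cond_exp subnS -[in LHS](prednK (n := n - p)) ?subn_gt0. Qed.

End conditional_expectation.
Arguments cond_exp {d S R} L p n f _.

Section historical_kernel.
Context (d : nat -> measure_display) (E : forall n, measurableType (d n)).
Context (R : realType) (K : forall n, R.-pker (E n) ~> (E n.+1)).
Local Notation F := (path_space E).

Definition last_kernel n (y : F n) : {measure set (E n.+1) -> \bar R} :=
  K n (last_pt y).

Let measurable_last_kernel n U : measurable U ->
  measurable_fun [set: F n] ((@last_kernel n) ^~ U).
Proof.
move=> mU; rewrite (_ : (fun y => _) = (K n ^~ U) \o @last_pt _ E n)//.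
apply: measurableT_comp; [exact: measurable_kernel|exact: measurable_last_pt].
Qed.

HB.instance Definition _ n := isKernel.Build _ _ _ _ R (@last_kernel n)
  (@measurable_last_kernel n).

Let last_kernelT n y : @last_kernel n y setT = 1%E.
Proof. exact: prob_kernel. Qed.

HB.instance Definition _ n := Kernel_isProbability.Build _ _ _ _ R
  (@last_kernel n) (@last_kernelT n).

(* M_(n+1)(y, .), the law of (y, x) for x drawn from K_(n+1)(last_pt y, .);
   kernels are indexed by the time they start from. *)
Definition hist_law n (y : F n) : set (F n.+1) -> \bar R :=
  pushforward (K n (last_pt y)) (pair y : E n.+1 -> F n.+1).

Let hist_law0 n (y : F n) : hist_law y set0 = 0%E.
Proof. by rewrite /hist_law /pushforward preimage_set0 measure0. Qed.

Let hist_law_ge0 n (y : F n) A : (0 <= hist_law y A)%E.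
Proof. exact: measure_ge0. Qed.

Let hist_law_sigma_additive n (y : F n) : semi_sigma_additive (hist_law y).
Proof.
have mpre (A : set (F n.+1)) : measurable A ->
    measurable ((pair y : E n.+1 -> F n.+1) @^-1` A).
  by move=> mA; rewrite -[X in measurable X]setTI; exact: pair1_measurable.
move=> A mA tA mUA; rewrite /hist_law /pushforward preimage_bigcup.
apply: measure_semi_sigma_additive => [k||].
- exact: mpre.
- apply/trivIsetP => i k _ _ ik; rewrite -preimage_setI.
  by move/trivIsetP : tA => /(_ _ _ _ _ ik) ->//; rewrite preimage_set0.
- by rewrite -preimage_bigcup; exact: mpre.
Qed.

HB.instance Definition _ n (y : F n) := isMeasure.Build _ _ _ (hist_law y)
  (hist_law0 y) (hist_law_ge0 y) (@hist_law_sigma_additive n y).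

Definition hist_kernel n (y : F n) : {measure set (F n.+1) -> \bar R} :=
  hist_law y.

Let measurable_hist_kernel n U : measurable U ->
  measurable_fun [set: F n] ((@hist_kernel n) ^~ U).
Proof.
move=> mU.
rewrite (_ : (fun y => _) = (fun y => @last_kernel n y (xsection U y))); last first.
  by apply/funext => y; rewrite xsectionE.
by apply: measurable_fun_xsection_finite_kernel; rewrite inE.
Qed.

HB.instance Definition _ n := isKernel.Build _ _ _ _ R (@hist_kernel n)
  (@measurable_hist_kernel n).

Let hist_kernelT n y : @hist_kernel n y setT = 1%E.
Proof. exact: prob_kernel. Qed.

HB.instance Definition _ n := Kernel_isProbability.Build _ _ _ _ R
  (@hist_kernel n) (@hist_kernelT n).

Definition hist_pker n : R.-pker (F n) ~> (F n.+1) := @hist_kernel n.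

End historical_kernel.

Section markov_chain.
Context (d : nat -> measure_display) (E : forall n, measurableType (d n)).
Context (R : realType) (K : forall n, R.-pker (E n) ~> (E n.+1)) (x0 : E 0%N).
Context (dO : measure_display) (Omega : measurableType dO).
Context (P : probability Omega R) (X : forall n, Omega -> E n).
Local Notation F := (path_space E).

(* The last clause says that K_(n+1)(X_n, .) is a regular version of the
   conditional law of X_(n+1) given (X_0,...,X_n). *)
Definition markov_chain : Prop :=
  [/\ forall n, measurable_fun setT (X n),
      forall w, X 0%N w = x0 &
      forall n (B : set (F n)) (A : set (E n.+1)), measurable B -> measurable A ->
        P (history X n @^-1` B `&` X n.+1 @^-1` A) =
        (\int[P]_(w in history X n @^-1` B) K n (X n w) A)%E].

End markov_chain.

Section feynman_kac.
Context (d : nat -> measure_display) (E : forall n, measurableType (d n)).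
Context (R : realType).
Local Notation F := (path_space E).

(* Only the G_n with n >= 1 are constrained, G_0 is never used. *)
Definition potentials (G : forall n, F n -> R) : Prop :=
  forall n, (1 <= n)%N ->
    [/\ measurable_fun setT (G n), forall y, 0 < G n y &
        has_ubound [set r | exists y y', r = G n y / G n y']].

Definition inv_pot (G : forall n, F n -> R) : forall n, F n -> R :=
  fun n y => (G n y)^-1.

Context (dO : measure_display) (Omega : measurableType dO).
Context (P : probability Omega R) (X : forall n, Omega -> E n).

Definition gamma (G : forall n, F n -> R) n (f : F n -> R) : R :=
  \int[P]_w (f (history X n w) * \prod_(1 <= k < n) G k (history X k w)).

Definition eta (G : forall n, F n -> R) n (f : F n -> R) : R :=
  gamma G f / gamma G (cst 1 : F n -> R).

End feynman_kac.

Section empirical_measure.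
Context (dT : measure_display) (T : measurableType dT) (R : realType).
Context (N : nat) (x : 'I_N -> T).

Definition empirical (A : set T) : \bar R :=
  ((N%:R^-1)%:E * \sum_(i < N) \d_(x i) A)%E.

Let empirical0 : empirical set0 = 0%E.
Proof. by rewrite /empirical big1 ?mule0// => i _; rewrite measure0. Qed.

Let empirical_ge0 A : (0 <= empirical A)%E.
Proof. by rewrite mule_ge0 ?lee_fin ?invr_ge0// sume_ge0. Qed.

Let empirical_sigma_additive : semi_sigma_additive empirical.
Proof.
pose m k : {measure set T -> \bar R} :=
  if insub k is Some i then \d_(x i) else mzero.
have empE : empirical = mscale (N%:R^-1)%:nng (msum m N).
  apply/funext => A; rewrite /empirical /mscale/= /msum.
  by congr (_ * _)%E; apply: eq_bigr => i _; rewrite /m valK.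
by rewrite empE; exact: measure_semi_sigma_additive.
Qed.

HB.instance Definition _ := isMeasure.Build _ _ _ empirical
  empirical0 empirical_ge0 empirical_sigma_additive.

End empirical_measure.
Arguments empirical {dT T} R {N} x A.

Section particles.
Context (d : nat -> measure_display) (E : forall n, measurableType (d n)).
Context (R : realType) (K : forall n, R.-pker (E n) ~> (E n.+1)).
Local Notation F := (path_space E).
Context (G : forall n, F n -> R).

(* Phi_(n+1)(mu)(A), for mu a probability measure on F_n *)
Definition Phi n (mu : {measure set (F n) -> \bar R}) (A : set (F n.+1)) : R :=
  (\int[mu]_y (G y * fine (hist_kernel K y A))) / \int[mu]_y G y.

(* Omega, P, X carry the chain which defines eta_1; the particles live on a
   probability space of their own. *)
Context (dO : measure_display) (Omega : measurableType dO).
Context (P : probability Omega R) (X : forall n, Omega -> E n).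
Context (dS : measure_display) (S : measurableType dS) (Q : probability S R).
Context (N : nat) (xi : forall n, 'I_N -> S -> F n).

(* the sigma-algebra generated by xi_1, ..., xi_n *)
Definition particle_sigma n : set (set S) :=
  <<s [set C | exists p i (A : set (F p)),
         [/\ (1 <= p <= n)%N, measurable A & C = xi p i @^-1` A]] >>.

(* The product formulas over measurable rectangles say that the xi_1^i are
   i.i.d. with law eta_1 and that, conditionally on xi_1, ..., xi_n, the
   xi_(n+1)^i are i.i.d. with law Phi_(n+1)(eta_n^N). *)
Definition particle_system : Prop :=
  [/\ forall n i, (1 <= n)%N -> measurable_fun setT (xi n i),
      forall A : 'I_N -> set (F 1%N), (forall i, measurable (A i)) ->
        Q (\bigcap_(i in setT) xi 1%N i @^-1` A i) =
        (\prod_(i < N) eta P X G (\1_(A i)))%:E &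
      forall n, (1 <= n)%N -> forall B, particle_sigma n B ->
      forall A : 'I_N -> set (F n.+1), (forall i, measurable (A i)) ->
        Q (B `&` \bigcap_(i in setT) xi n.+1 i @^-1` A i) =
        (\int[Q]_(w in B)
           (\prod_(i < N) Phi (empirical R (xi n ^~ w)) (A i))%:E)%E].

Definition etaN n (f : F n -> R) (w : S) : R :=
  \int[empirical R (xi n ^~ w)]_y f y.

Definition gammaN n (f : F n -> R) (w : S) : R :=
  etaN f w * \prod_(1 <= p < n) etaN (@G p) w.

End particles.

Section rare_event.
Context (d : nat -> measure_display) (E : forall n, measurableType (d n)).
Context (R : realType) (K : forall n, R.-pker (E n) ~> (E n.+1)).
Local Notation F := (path_space E).
Context (G : forall n, F n -> R) (V : forall n, E n -> R).

Definition T_fun n (a : R) (phi : F n -> R) (y : F n) : R :=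
  phi y * \1_[set x | a <= @V n x] (last_pt y) *
  \prod_(1 <= p < n) along (inv_pot G) y p.

Context (dO : measure_display) (Omega : measurableType dO).
Context (P : probability Omega R) (X : forall n, Omega -> E n).

Definition rare_prob n (a : R) : R := fine (P [set w | a <= @V n (X n w)]).

(* E[phi(X_0,...,X_n) | V_n(X_n) >= a], conditioning on an event *)
Definition rare_mean n (a : R) (phi : F n -> R) : R :=
  (\int[P]_w (phi (history X n w) * \1_[set w | a <= @V n (X n w)] w))
  / rare_prob n a.

(* E[1_(V_n(X_n) >= a) | X_p = x_p] *)
Definition cond_prob p n (a : R) : E p -> R :=
  cond_exp K p n (\1_[set x | a <= @V n x]).

(* the conditional expectation given (X_0,...,X_p) = (x_0,...,x_p) *)
Definition cond_mean p n (a : R) (phi : F n -> R) : F p -> R :=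
  cond_exp (hist_pker K) p n (fun y =>
    (phi y - rare_mean a phi) * \1_[set x | a <= @V n x] (last_pt y)).

Definition var_prob n (a : R) : R :=
  \sum_(1 <= p < n.+1)
    (gamma P X G (cst 1 : F p -> R) * gamma P X (inv_pot G) (cst 1 : F p -> R) *
     eta P X (inv_pot G) (fun y : F p => cond_prob n a (last_pt y) ^+ 2)
     - rare_prob n a ^+ 2).

Definition var_mean n (a : R) (phi : F n -> R) : R :=
  rare_prob n a ^- 2 *
  \sum_(1 <= p < n.+1)
    gamma P X G (cst 1 : F p -> R) * gamma P X (inv_pot G) (cst 1 : F p -> R) *
    eta P X (inv_pot G) (fun y : F p => cond_mean a phi y ^+ 2).

Context (dS : measure_display) (S : measurableType dS).
Context (N : nat) (xi : forall n, 'I_N -> S -> F n).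

Definition rare_prob_est n (a : R) (w : S) : R :=
  gammaN G xi (T_fun a (cst 1 : F n -> R)) w.

(* This is 0 when the denominator is, since x / 0 = 0. *)
Definition rare_mean_est n (a : R) (phi : F n -> R) (w : S) : R :=
  etaN xi (T_fun a phi) w / etaN xi (T_fun a (cst 1 : F n -> R)) w.

End rare_event.

Section convergence_in_law.
Context (R : realType).

(* N(0, v), for a variance v >= 0; [normal_prob] takes the standard deviation
   and is not the Dirac mass when that is 0. *)
Definition centered_gaussian (v : R) : {measure set (measurableTypeR R) -> \bar R} :=
  if v == 0 then \d_(0 : measurableTypeR R) : {measure set (measurableTypeR R) -> \bar R}
  else normal_prob 0 (Num.sqrt v) : {measure set (measurableTypeR R) -> \bar R}.

(* The Z_N may live on different probability spaces. *)
Definition cvg_in_law (dS : nat -> measure_display)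
    (S : forall N, measurableType (dS N)) (Q : forall N, probability (S N) R)
    (Z : forall N, S N -> R) (mu : {measure set (measurableTypeR R) -> \bar R}) : Prop :=
  forall f : R -> R, continuous f -> bounded_fun f ->
    (fun N => \int[Q N]_w f (Z N w)) @ \oo --> \int[mu]_x f x.

End convergence_in_law.

(* Main.v *)
(* Write [Q_n f (y) = G_n(y) M_(n+1) f (y)], so that [gamma_(n+1) f = gamma_n (Q_n f)]. The
   particle approximation satisfies
     [gamma_(n+1)^N f - gamma_n^N (Q_n f) = w_(n+1) (eta_(n+1)^N f - Phi_(n+1)(eta_n^N) f)]
   with [w_(n+1)] the product of the [eta_p^N (G_p)], [1 <= p <= n], which is known when the
   [xi_(n+1)^i] are drawn. Taking expectations gives unbiasedness. Conditionally on the
   past, [sqrt N] times the bracket is close to a centered Gaussian with the variance of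
   [f] under [Phi_(n+1)(eta_n^N)], and [w_(n+1)] and this variance converge in L2 to
   [gamma_(n+1)(1)] and to the variance under [eta_(n+1)]; hence
     [E cos(s + t sqrt N (gamma_n^N f - gamma_n f))]
   converges at rate [N^(-1/2)], by induction on [n], and the asymptotic variance is the
   sum of the [gamma_p(1)^2 Var_(eta_p)(Q_p ... Q_(n-1) f)]. For [f = T_n^(a)(phi)] the
   weights [1/G_p] cancel against those of [Q_p], so that [Q_p ... Q_(n-1) f] is a
   conditional expectation times the product of the [1/G_k], [k < p], and each term
   becomes the one of the statement. The second estimator is a ratio whose numerator,
   after centering [phi], has mean [0]. *)

Require Import Defs.
From HB Require Import structures.
From mathcomp Require Import all_boot all_order all_algebra.
From mathcomp Require Import all_classical all_reals all_analysis.
From mathcomp Require Import measurable_realfun.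
From mathcomp Require Import ring lra.

Set Implicit Arguments.
Unset Strict Implicit.
Unset Printing Implicit Defensive.

Import Order.TTheory GRing.Theory Num.Theory.
Import numFieldNormedType.Exports.

Local Open Scope classical_set_scope.
Local Open Scope ring_scope.

(** * Bounded measurable functions *)

(** The random laws [Phi] of the empirical measures are handled as functionals on bounded measurable
    functions: identities known on sets extend to such functions by linearity and sup-norm bounds.
    The obstacle in the induction is that the weight and the conditional variance are random,
    whereas the conditional expansion of the cosine takes a fixed frequency and leaves a random
    Gaussian factor. The weight is first replaced by its limit: its error multiplies a fluctuation
    of the same size, so the product is O(1/N) in L1 and still O(N^(-1/2)) after scaling by
    [sqrt N]. Then the Gaussian factor is replaced by its limit, by a Lipschitz bound. The phase of
    the cosine receives the part of the error known from the past, which is how one generation hands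
    over to the next. Explicit rates also take the place of Slutsky's lemma for the ratio. Passing
    from cosines to convergence in law combines trigonometric polynomials with tightness, which
    comes from second moments; the Gaussian characteristic function comes from a differential
    equation in [t]. *)

Section bounded_measurable.
Context d (T : measurableType d) (R : realType).
Implicit Types f g : T -> R.

Definition bmeas f := measurable_fun setT f /\ exists M : R, forall x, `|f x| <= M.

Lemma bmeas_cst c : bmeas (fun=> c).
Proof. by split; [exact: measurable_cst|exists `|c|]. Qed.

Lemma bmeas_indic (A : set T) : measurable A -> bmeas (\1_A).
Proof.
move=> mA; split; first exact: measurable_indic.
by exists 1 => x; rewrite indicE normr_nat lern1 leq_b1.
Qed.

Lemma bmeasD f g : bmeas f -> bmeas g -> bmeas (fun x => f x + g x).
Proof.
move=> [mf [M fM]] [mg [M' gM']]; split; first exact: measurable_funD.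
by exists (M + M') => x; rewrite (le_trans (ler_normD _ _))// lerD.
Qed.

Lemma bmeasM f g : bmeas f -> bmeas g -> bmeas (fun x => f x * g x).
Proof.
move=> [mf [M fM]] [mg [M' gM']]; split; first exact: measurable_funM.
by exists (M * M') => x; rewrite normrM ler_pM.
Qed.

Lemma bmeasZ c f : bmeas f -> bmeas (fun x => c * f x).
Proof. by move=> hf; exact: bmeasM (bmeas_cst c) hf. Qed.

Lemma bmeasN f : bmeas f -> bmeas (fun x => - f x).
Proof.
move=> /(bmeasZ (-1)); congr bmeas; apply/funext => x; exact: mulN1r.
Qed.

Lemma bmeasB f g : bmeas f -> bmeas g -> bmeas (fun x => f x - g x).
Proof. by move=> hf /bmeasN; exact: bmeasD. Qed.

Lemma bmeasX n f : bmeas f -> bmeas (fun x => f x ^+ n).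
Proof.
move=> hf; elim: n => [|n IH]; first exact: bmeas_cst.
rewrite (_ : (fun _ => _) = fun x => f x * f x ^+ n); first exact: bmeasM.
by apply/funext => x; rewrite exprS.
Qed.

Lemma bmeas_norm f : bmeas f -> bmeas (fun x => `|f x|).
Proof.
move=> [mf [M fM]]; split; first exact: measurableT_comp.
by exists M => x; rewrite normr_id.
Qed.

Lemma bmeas_sum I (s : seq I) (P : pred I) (h : I -> T -> R) :
  (forall i, bmeas (h i)) -> bmeas (fun x => \sum_(i <- s | P i) h i x).
Proof.
move=> hh; elim: s => [|i s IH].
  by under eq_fun do rewrite big_nil; exact: bmeas_cst.
under eq_fun do rewrite big_cons; case: (P i) => //; exact: bmeasD.
Qed.

Lemma bmeas_prod I (s : seq I) (P : pred I) (h : I -> T -> R) :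
  (forall i, P i -> bmeas (h i)) -> bmeas (fun x => \prod_(i <- s | P i) h i x).
Proof.
move=> hh; elim: s => [|i s IH].
  by under eq_fun do rewrite big_nil; exact: bmeas_cst.
under eq_fun do rewrite big_cons; case Pi : (P i) => //; apply: bmeasM => //; exact: hh.
Qed.

Lemma bmeas_prod_nat m n (h : nat -> T -> R) :
  (forall i, (m <= i)%N -> bmeas (h i)) ->
  bmeas (fun x => \prod_(m <= i < n) h i x).
Proof.
move=> hh; elim: n => [|n IH].
  by under eq_fun do rewrite big_geq//; exact: bmeas_cst.
have [mn|nm] := leqP m n; last by under eq_fun do rewrite big_geq//; exact: bmeas_cst.
by under eq_fun do rewrite big_nat_recr//=; apply: bmeasM => //; exact: hh.
Qed.

Lemma bmeas_cos f : measurable_fun setT f -> bmeas (fun x => cos (f x)).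
Proof.
move=> mf; split.
  apply: measurableT_comp mf; apply: continuous_measurable_fun; exact: continuous_cos.
by exists 1 => x; rewrite cos_max.
Qed.

Lemma bmeas_sin f : measurable_fun setT f -> bmeas (fun x => sin (f x)).
Proof.
move=> mf; split.
  apply: measurableT_comp mf; apply: continuous_measurable_fun; exact: continuous_sin.
by exists 1 => x; rewrite sin_max.
Qed.

Lemma bmeas_expRN f : measurable_fun setT f -> (forall x, 0 <= f x) ->
  bmeas (fun x => expR (- f x)).
Proof.
move=> mf f0; split.
  by apply: measurableT_comp => //; exact: measurable_funN.
by exists 1 => x; rewrite ger0_norm ?expR_ge0// -expR0 ler_expR oppr_le0.
Qed.

(** On nonnegative reals inversion is the real power of exponent -1, at 0 as well, where both take
    the value 0. Vanishing denominators of the ratio estimator are thereby covered. *)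
Lemma measurable_funV f : (forall x, 0 <= f x) -> measurable_fun setT f ->
  measurable_fun setT (fun x => (f x)^-1).
Proof.
move=> f0 mf; rewrite (_ : (fun _ => _) = fun x => f x `^ (-1)).
  exact: measurableT_comp (measurable_powR _) mf.
by apply/funext => x; rewrite powR_inv1.
Qed.

Lemma bmeasV (c : R) f : 0 < c -> (forall x, c <= f x) -> measurable_fun setT f ->
  bmeas (fun x => (f x)^-1).
Proof.
move=> c0 cf mf.
have f0 x : 0 < f x by exact: lt_le_trans (cf x).
split; last first.
  exists c^-1 => x; rewrite ger0_norm ?invr_ge0 ?(ltW (f0 x))//.
  by rewrite lef_pV2 ?posrE.
by apply: measurable_funV => // x; exact: ltW.
Qed.

End bounded_measurable.

Lemma bmeas_comp d d' (T : measurableType d) (T' : measurableType d')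
    (R : realType) (h : T -> T') (f : T' -> R) :
  measurable_fun setT h -> bmeas f -> bmeas (fun x => f (h x)).
Proof.
by move=> mh [mf [M fM]]; split; [exact: measurableT_comp|exists M => x].
Qed.

(** * Functionals determined by their values on indicators *)

Section bounded_linear.
Context d (T : measurableType d) (R : realType).
Implicit Types f g : T -> R.

(** The class contains integrals against finite measures, weighted integrals of functionals, and
    differences of such maps, so that an equality of two of them becomes a vanishing statement. *)
Definition blinear (L : (T -> R) -> R) :=
  [/\ forall f g, bmeas f -> bmeas g -> L (fun x => f x + g x) = L f + L g,
      forall c f, bmeas f -> L (fun x => c * f x) = c * L f &
      exists C : R, forall f (M : R), bmeas f -> (forall x, `|f x| <= M) -> `|L f| <= C * M].

Lemma blinearB L L' : blinear L -> blinear L' -> blinear (fun f => L f - L' f).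
Proof.
move=> [LD LZ [C LC]] [LD' LZ' [C' LC']]; split.
- by move=> f g hf hg; rewrite LD// LD'//; ring.
- by move=> c f hf; rewrite LZ// LZ'//; ring.
- exists (C + C') => f M hf fM; rewrite (le_trans (ler_normB _ _))// mulrDl.
  by rewrite lerD ?LC ?LC'.
Qed.

(* Subtracting [M / 2] on [{f >= M / 2}] halves the sup norm of [0 <= f <= M]
   without changing [L f]. *)
Lemma blinear_eq0 L : blinear L -> (forall A, measurable A -> L (\1_A) = 0) ->
  forall f, bmeas f -> L f = 0.
Proof.
move=> [LD LZ [C LC]] L1.
have C0 : 0 <= C.
  have := LC (fun=> 1) 1 (bmeas_cst _ 1); rewrite normr1 mulr1.
  by move=> /(_ (fun=> lexx _)); exact: le_trans.
have half k f M : bmeas f -> (forall x, 0 <= f x <= M) -> `|L f| <= C * (M / 2 ^+ k).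
  elim: k f M => [|k IH] f M hf fM.
    by rewrite expr0 divr1 LC// => x; have /andP[f0 fM'] := fM x; rewrite ger0_norm.
  pose A := [set x | M / 2 <= f x].
  have mA : measurable A.
    rewrite (_ : A = setT `&` f @^-1` `[M / 2, +oo[).
      by apply: (hf.1) => //; exact: measurable_itv.
    by rewrite setTI; apply/seteqP; split => x /=; rewrite in_itv/= andbT.
  have hA := bmeas_indic R mA.
  have hfA : bmeas (fun x => f x + - (M / 2) * \1_A x).
    by apply: bmeasD => //; exact: bmeasZ.
  have -> : L f = L (fun x => f x + - (M / 2) * \1_A x).
    by rewrite LD ?LZ ?L1 ?mulr0 ?addr0//; exact: bmeasZ.
  have -> : M / 2 ^+ k.+1 = M / 2 / 2 ^+ k by rewrite exprS invfM mulrA.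
  apply: IH => // x.
  rewrite indicE; have /andP[f0 fM'] := fM x.
  have [/set_mem|/negP] := boolP (x \in A); rewrite /A/= => Ax.
    by apply/andP; split; rewrite mulr1; lra.
  have {}Ax : f x < M / 2 by rewrite ltNge; apply/negP => Mf; apply: Ax; rewrite inE.
  by rewrite mulr0 addr0 f0/= ltW.
have nneg f M : bmeas f -> (forall x, 0 <= f x <= M) -> L f = 0.
  move=> hf fM; apply/normr0_eq0/eqP; rewrite eq_le normr_ge0 andbT.
  have cv : C * M * (2^-1 ^+ k) @[k --> \oo] --> C * M * 0.
    by apply: cvgM; [exact: cvg_cst|apply: cvg_expr; rewrite ger0_norm//; lra].
  rewrite mulr0 in cv; rewrite -(cvg_lim _ cv)//.
  apply: limr_ge; first by apply/cvg_ex; exists 0.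
  by apply: nearW => k; rewrite -mulrA exprVn; exact: half.
move=> f hf; have [_ [M fM]] := hf.
(* A function of arbitrary sign is shifted into [0, 2M]; the shift is a multiple of an indicator, so
   [L] does not see it. *)
have : L (fun x => f x + M * \1_setT x) = 0.
  apply: (@nneg _ (M + M)); first by apply: bmeasD => //; apply/bmeasZ/bmeas_indic.
  move=> x; rewrite indicT mulr1; have := fM x; rewrite ler_norml => /andP[? ?].
  by apply/andP; split; lra.
have hT : bmeas (\1_(@setT T) : T -> R) by exact: bmeas_indic.
by rewrite LD ?LZ ?L1 ?mulr0 ?addr0//; exact: bmeasZ.
Qed.

(** This is the substitute for a monotone class argument each time a property of sets is carried
    over to bounded functions. *)
Lemma blinear_ext L L' : blinear L -> blinear L' ->
  (forall A, measurable A -> L (\1_A) = L' (\1_A)) ->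
  forall f, bmeas f -> L f = L' f.
Proof.
move=> hL hL' LL' f hf; apply/eqP; rewrite -subr_eq0; apply/eqP.
apply: (blinear_eq0 (blinearB hL hL')) => // A mA; by rewrite LL' ?subrr.
Qed.

End bounded_linear.

Section integral_bmeas.
Context d (T : measurableType d) (R : realType) (mu : {measure set T -> \bar R}).
Hypothesis mufin : (mu setT < +oo)%E.
Implicit Types f g : T -> R.

Lemma bmeas_integrable f : bmeas f -> mu.-integrable setT (EFin \o f).
Proof.
move=> [mf [M fM]]; apply: measurable_bounded_integrable => //.
exists M; split; first exact: num_real.
by move=> x Mx y _; exact: le_trans (fM y) (ltW Mx).
Qed.

Lemma Rintegral_indic A : measurable A -> \int[mu]_x \1_A x = fine (mu A).
Proof. by move=> mA; rewrite /Rintegral integral_indic// setIT. Qed.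

Lemma RintegralD_bmeas f g : bmeas f -> bmeas g ->
  \int[mu]_x (f x + g x) = \int[mu]_x f x + \int[mu]_x g x.
Proof. by move=> hf hg; rewrite RintegralD//; exact: bmeas_integrable. Qed.

Lemma RintegralB_bmeas f g : bmeas f -> bmeas g ->
  \int[mu]_x (f x - g x) = \int[mu]_x f x - \int[mu]_x g x.
Proof. by move=> hf hg; rewrite RintegralB//; exact: bmeas_integrable. Qed.

Lemma RintegralZ_bmeas c f : bmeas f -> \int[mu]_x (c * f x) = c * \int[mu]_x f x.
Proof. by move=> hf; rewrite RintegralZl//; exact: bmeas_integrable. Qed.

Lemma Rintegral_sum_bmeas I (s : seq I) (P : pred I) (h : I -> T -> R) :
  (forall i, bmeas (h i)) ->
  \int[mu]_x (\sum_(i <- s | P i) h i x) = \sum_(i <- s | P i) \int[mu]_x h i x.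
Proof.
move=> hh; elim: s => [|i s IH].
  rewrite big_nil; under eq_Rintegral do rewrite big_nil.
  by rewrite Rintegral_cst// mul0r.
rewrite big_cons; under eq_Rintegral do rewrite big_cons.
by case: (P i) => //; rewrite RintegralD_bmeas ?IH//; exact: bmeas_sum.
Qed.

Lemma le_Rintegral_bmeas f g : bmeas f -> bmeas g -> (forall x, f x <= g x) ->
  \int[mu]_x f x <= \int[mu]_x g x.
Proof. by move=> hf hg fg; apply: le_Rintegral => //; exact: bmeas_integrable. Qed.

Lemma blinear_Rintegral : blinear (fun f => \int[mu]_x f x).
Proof.
split.
- exact: RintegralD_bmeas.
- exact: RintegralZ_bmeas.
- exists (fine (mu setT)) => f M hf fM.
  apply: (le_trans (le_normr_Rintegral _ _)) => //; first exact: bmeas_integrable.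
  rewrite mulrC -Rintegral_cst//; apply: le_Rintegral_bmeas => //.
    exact: bmeas_norm.
  exact: bmeas_cst.
Qed.

End integral_bmeas.

Section expectation_bmeas.
Context d (T : measurableType d) (R : realType) (P : probability T R).
Implicit Types f g : T -> R.

Lemma prob_lty : (P setT < +oo)%E.
Proof. by rewrite probability_setT ltry. Qed.

Lemma Rintegral_cst_prob c : \int[P]_x c = c.
Proof.
transitivity (c * fine (P setT)); first exact: Rintegral_cst.
by rewrite probability_setT mulr1.
Qed.

Lemma le_norm_Rintegral_prob f M : bmeas f -> (forall x, `|f x| <= M) ->
  `|\int[P]_x f x| <= M.
Proof.
move=> hf fM.
apply: (le_trans (le_normr_Rintegral _ _)) => //; first exact: bmeas_integrable prob_lty _ hf.
rewrite -(Rintegral_cst_prob M); apply: (le_Rintegral_bmeas prob_lty) => //.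
  exact: bmeas_norm.
exact: bmeas_cst.
Qed.

Lemma le_dist_Rintegral_prob f g h : bmeas f -> bmeas g -> bmeas h ->
  (forall x, `|f x - g x| <= h x) ->
  `|\int[P]_x f x - \int[P]_x g x| <= \int[P]_x h x.
Proof.
move=> hf hg hh fgh; rewrite -(RintegralB_bmeas prob_lty)//.
apply: (le_trans (le_normr_Rintegral _ _)) => //.
  by apply: (bmeas_integrable prob_lty); exact: bmeasB.
apply: (le_Rintegral_bmeas prob_lty) => //; apply/bmeas_norm/bmeasB => //.
Qed.

End expectation_bmeas.

(** * Taylor bounds, and powers of complex numbers in real form *)

Section real_estimates.
Context (R : realType).
Implicit Types x y z : R.

(** The derivative is controlled only between [x] and [y], so a bound growing with the distance to 0
    may be used; iterating this yields the Taylor estimates below. *)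
Lemma mvt_bound (f df : R -> R) K x y : (forall z, is_derive z 1 f (df z)) ->
  (forall z, Num.min x y <= z <= Num.max x y -> `|df z| <= K) -> `|f x - f y| <= K * `|x - y|.
Proof.
move=> fdf; wlog xy : x y / x < y => [hw dfK|].
  have [xy|yx|->] := ltgtP x y; last by rewrite !subrr normr0 mulr0.
    exact: hw.
  by rewrite distrC (distrC x) hw// => z; rewrite minC maxC; exact: dfK.
rewrite (min_idPl (ltW xy)) (max_idPr (ltW xy)) => dfK.
have [|c cxy fxy] := @MVT R f df x y xy (fun z _ => fdf z).
  apply: continuous_subspaceT => z; apply: differentiable_continuous.
  by apply/derivable1_diffP; exact: (@ex_derive _ _ _ _ _ _ _ (fdf z)).
rewrite distrC fxy (distrC x) normrM ler_wpM2r// dfK//.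
by move: cxy; rewrite in_itv/= => /andP[/ltW -> /ltW ->].
Qed.

Lemma cos_lip x y : `|cos x - cos y| <= `|x - y|.
Proof.
rewrite -[leRHS]mul1r; apply: (@mvt_bound cos (fun z => - sin z)) => z _.
by rewrite normrN sin_max.
Qed.

Lemma norm_sin_le x : `|sin x| <= `|x|.
Proof.
rewrite -[leRHS]mul1r -[sin x]subr0 -[X in _ * `|X|]subr0 -{1}(sin0 R).
by apply: (@mvt_bound sin cos) => z _; rewrite cos_max.
Qed.

Let min_max0 x z : Num.min x 0 <= z <= Num.max x 0 -> `|z| <= `|x|.
Proof.
have [x0|x0] := leP x 0.
  by move=> /andP[xz z0]; rewrite !ler0_norm// lerN2.
by move=> /andP[z0 zx]; rewrite !ger0_norm// ltW.
Qed.

(** Half-angle formula: [1 - cos x] is twice the square of [sin (x / 2)]. *)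
Lemma cos_bound2 x : 0 <= 1 - cos x <= x ^+ 2 / 2.
Proof.
have -> : 1 - cos x = 2 * sin (x / 2) ^+ 2.
  have -> : cos x = cos (x / 2 + x / 2) by congr cos; field.
  by rewrite cosD; have := cos2Dsin2 (x / 2); rewrite !expr2; lra.
rewrite mulr_ge0 ?sqr_ge0//=.
have -> : x ^+ 2 / 2 = 2 * (x / 2) ^+ 2 by field.
rewrite ler_pM2l// -real_normK ?num_real// -[leRHS]real_normK ?num_real//.
by rewrite lerXn2r ?nnegrE// norm_sin_le.
Qed.

(** The mean value theorem on [0, x] raises the order of the cosine bound by one, and once more in
    [cos_bound4]; the factors 1/6 and 1/24 of Taylor's formula are given up. *)
Lemma sin_bound3 x : `|sin x - x| <= `|x| ^+ 3.
Proof.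
have -> : sin x - x = (sin x - x) - (sin 0 - 0) by rewrite sin0 !subr0.
rewrite exprSr -[X in _ * `|X|]subr0.
apply: (@mvt_bound (fun z => sin z - z) (fun z => cos z - 1)) => z.
move=> /min_max0 zx; rewrite distrC.
have /andP[c0 c2] := cos_bound2 z; rewrite ger0_norm// (le_trans c2)//.
have : z ^+ 2 <= `|x| ^+ 2 by rewrite -(@real_normK _ z) ?num_real// lerXn2r ?nnegrE.
have : 0 <= z ^+ 2 by exact: sqr_ge0.
lra.
Qed.

Lemma cos_bound4 x : `|cos x - 1 + x ^+ 2 / 2| <= `|x| ^+ 4.
Proof.
pose f z := cos z - 1 + z ^+ 2 / 2.
have -> : cos x - 1 + x ^+ 2 / 2 = f x - f 0.
  by rewrite /f cos0 expr0n/=; ring.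
rewrite exprSr -[X in _ * `|X|]subr0.
apply: (@mvt_bound f (fun z => - sin z + z)) => z.
  rewrite /f; apply: is_derive_eq; rewrite /= !scaler1 !subr0.
  by rewrite /GRing.scale/= ; field.
move=> /min_max0 zx; rewrite addrC distrC (le_trans (sin_bound3 _))//.
by rewrite lerXn2r ?nnegrE.
Qed.

Lemma is_derive_expRN z : is_derive z 1 (fun z => expR (- z)) (- expR (- z)).
Proof.
have := @is_derive1_comp R expR -%R z _ _ (is_derive_expR (- z)) (is_deriveN (is_derive_id z 1)).
by rewrite mulrN1.
Qed.

Lemma expRN_lip x y : 0 <= x -> 0 <= y -> `|expR (- x) - expR (- y)| <= `|x - y|.
Proof.
move=> x0 y0; rewrite -[leRHS]mul1r.
apply: (@mvt_bound (fun z => expR (- z)) (fun z => - expR (- z))) => z.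
  exact: is_derive_expRN.
move=> /andP[xyz _]; rewrite normrN ger0_norm ?expR_ge0// -expR0 ler_expR oppr_le0.
by rewrite (le_trans _ xyz)// le_min x0.
Qed.

Lemma expRN_bound2 x : 0 <= x -> `|1 - x - expR (- x)| <= x ^+ 2.
Proof.
move=> x0; pose f z := 1 - z - expR (- z).
have -> : 1 - x - expR (- x) = f x - f 0 by rewrite /f oppr0 expR0; ring.
have := @mvt_bound f (fun z => - 1 + expR (- z)) x x 0.
rewrite subr0 [in X in _ * X](ger0_norm x0) -expr2; apply => z.
  have := is_deriveB (is_deriveB (is_derive_cst (1 : R) z 1) (is_derive_id z 1)) (is_derive_expRN z).
  by rewrite sub0r opprK.
rewrite (min_idPr x0) (max_idPl x0) => /andP[z0 zx].
rewrite addrC distrC ger0_norm; last first.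
  by rewrite subr_ge0 -expR0 ler_expR oppr_le0.
by have := expR_ge1Dx (- z); lra.
Qed.

(* [cosrot a b n s] is the real part of [e^(is) (a + ib)^n]. *)
Fixpoint cosrot (a b : R) n s :=
  if n is n'.+1 then a * cosrot a b n' s - b * cosrot a b n' (s - pi / 2)
  else cos s.

(** Lowering the phase by [pi / 2] multiplies by -i, hence turns the real part into the imaginary
    part; doing it twice gives the sign. *)
Lemma cosrotBpi a b n s : cosrot a b n (s - pi / 2 - pi / 2) = - cosrot a b n s.
Proof.
elim: n s => [|n IH] s /=; last by rewrite !IH; ring.
by rewrite cosBpihalf sinBpihalf.
Qed.

Lemma cosrot_le1 a b n s : a ^+ 2 + b ^+ 2 <= 1 -> `|cosrot a b n s| <= 1.
Proof.
move=> ab1.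
(* The sum of squares is the squared modulus of [e^(is) (a + ib)^n], which, unlike the real part
   alone, is multiplicative in [n]. *)
suff h : cosrot a b n s ^+ 2 + cosrot a b n (s - pi / 2) ^+ 2 <= 1.
  rewrite -(@expr_le1 _ 2)// real_normK ?num_real// (le_trans _ h)//.
  by rewrite lerDl sqr_ge0.
elim: n => [|n IH] /=; first by rewrite cosBpihalf cos2Dsin2.
rewrite cosrotBpi; set u := cosrot _ _ _ _ in IH *; set v := cosrot _ _ _ _ in IH *.
have -> : (a * u - b * v) ^+ 2 + (a * v - b * - u) ^+ 2 =
  (a ^+ 2 + b ^+ 2) * (u ^+ 2 + v ^+ 2) by ring.
by rewrite mulr_ile1// addr_ge0 ?sqr_ge0.
Qed.

(** Real form of [|z^n - r^n| <= n |z - r|] for [z = a + ib] and [r] in the unit disc, by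
    telescoping. *)
Lemma cosrot_near a b r n s : a ^+ 2 + b ^+ 2 <= 1 -> 0 <= r <= 1 ->
  `|cosrot a b n s - r ^+ n * cos s| <= n%:R * (`|a - r| + `|b|).
Proof.
move=> ab1 /andP[r0 r1]; elim: n => [|n IH].
  by rewrite /= expr0 mul1r subrr normr0 mul0r.
rewrite /=; set u := cosrot _ _ _ _ in IH *.
set v := cosrot _ _ _ (s - _).
have -> : a * u - b * v - r ^+ n.+1 * cos s =
  r * (u - r ^+ n * cos s) + ((a - r) * u - b * v) by rewrite exprS; ring.
rewrite (le_trans (ler_normD _ _))//.
have -> : n.+1%:R * (`|a - r| + `|b|) =
  n%:R * (`|a - r| + `|b|) + (`|a - r| + `|b|) by rewrite -natr1 mulrDl mul1r.
rewrite lerD//.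
  by rewrite normrM ger0_norm// (le_trans _ IH)// ler_piMl.
rewrite (le_trans (ler_normB _ _))// lerD// normrM ler_piMr// cosrot_le1//.
Qed.

Lemma cosrotB a b n s m : cosrot a b n (s - m) =
  cos m * cosrot a b n s + sin m * cosrot a b n (s - pi / 2).
Proof.
elim: n s => [|n IH] s /=; first by rewrite cosB cosBpihalf; ring.
have -> : s - m - pi / 2 = (s - pi / 2) - m by ring.
by rewrite !IH; ring.
Qed.

(** Real form of [e^(-inm) z^n = (z e^(-im))^n]: a shift of the total phase is distributed over the
    [n] factors. It serves to centre each summand at its mean. *)
Lemma cosrot_shift a b n s m : cosrot a b n (s - n%:R * m) =
  cosrot (a * cos m + b * sin m) (b * cos m - a * sin m) n s.
Proof.
elim: n s => [|n IH] s; first by rewrite mul0r subr0.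
rewrite [LHS]/=.
have -> : s - n.+1%:R * m = (s - m) - n%:R * m by rewrite -natr1; ring.
have -> : s - m - n%:R * m - pi / 2 = (s - pi / 2 - m) - n%:R * m by ring.
rewrite !IH (cosrotB _ _ _ s m) (cosrotB _ _ _ (s - pi / 2) m) cosrotBpi [RHS]/=.
set u := cosrot _ _ n s; set v := cosrot _ _ n (s - pi / 2).
by move: u v (cos m) (sin m) => u v c e; ring.
Qed.

End real_estimates.

(** * Sums of conditionally i.i.d. variables *)

Section mean_functional.
Context d (T : measurableType d) (R : realType).
Implicit Types (L : (T -> R) -> R) (f g : T -> R).

(** Linearity, positivity and mass one suffice for the moment and characteristic function bounds.
    Kernels, [eta] and the quotient of sample means [next_mean] are all instances, without being
    turned into measures. *)
Definition mean_fun L :=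
  [/\ forall f g, bmeas f -> bmeas g -> L (fun x => f x + g x) = L f + L g,
      forall c f, bmeas f -> L (fun x => c * f x) = c * L f,
      forall f, bmeas f -> (forall x, 0 <= f x) -> 0 <= L f &
      L (fun=> 1) = 1].

Context L (hL : mean_fun L).

Lemma mean_funD f g : bmeas f -> bmeas g -> L (fun x => f x + g x) = L f + L g.
Proof. by case: hL => + _ _ _; apply. Qed.

Lemma mean_funZ c f : bmeas f -> L (fun x => c * f x) = c * L f.
Proof. by case: hL => _ + _ _; apply. Qed.

Lemma mean_fun_ge0 f : bmeas f -> (forall x, 0 <= f x) -> 0 <= L f.
Proof. by case: hL => _ _ + _; apply. Qed.

Lemma mean_funN f : bmeas f -> L (fun x => - f x) = - L f.
Proof.
move=> hf; rewrite -mulN1r -mean_funZ//; congr L.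
by apply/funext => x; rewrite mulN1r.
Qed.

Lemma mean_funB f g : bmeas f -> bmeas g -> L (fun x => f x - g x) = L f - L g.
Proof. by move=> hf hg; rewrite mean_funD ?mean_funN//; exact: bmeasN. Qed.

Lemma mean_fun_cst c : L (fun=> c) = c.
Proof.
case: (hL) => _ _ _ L1; rewrite -[RHS]mulr1 -[in RHS]L1 -mean_funZ; last exact: bmeas_cst.
by congr L; apply/funext => x; rewrite mulr1.
Qed.

Lemma mean_fun_le f g : bmeas f -> bmeas g -> (forall x, f x <= g x) -> L f <= L g.
Proof.
move=> hf hg fg; rewrite -subr_ge0 -mean_funB//; apply: mean_fun_ge0.
  exact: bmeasB.
by move=> x; rewrite subr_ge0.
Qed.

Lemma mean_fun_norm f M : bmeas f -> (forall x, `|f x| <= M) -> `|L f| <= M.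
Proof.
move=> hf fM; rewrite ler_norml -(mean_fun_cst M) -mean_funN; last exact: bmeas_cst.
by rewrite !mean_fun_le//; (try exact: bmeas_cst) => x;
  have := fM x; rewrite ler_norml => /andP[].
Qed.

Lemma blinear_mean_fun : blinear L.
Proof.
split; [exact: mean_funD|exact: mean_funZ|exists 1 => f M hf fM].
by rewrite mul1r; exact: mean_fun_norm.
Qed.

Lemma mean_fun_varE f : bmeas f ->
  L (fun x => (f x - L f) ^+ 2) = L (fun x => f x ^+ 2) - L f ^+ 2.
Proof.
move=> hf; have hf2 := bmeasX 2 hf; set m := L f.
have -> : (fun x => (f x - m) ^+ 2) = (fun x => f x ^+ 2 + ((- (m *+ 2)) * f x + m ^+ 2)).
  by apply/funext => x; ring.
rewrite mean_funD//; last by apply: bmeasD; [exact: bmeasZ|exact: bmeas_cst].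
rewrite (@mean_funD (fun x => - (m *+ 2) * f x) (fun=> m ^+ 2)); [|exact: bmeasZ|exact: bmeas_cst].
rewrite mean_funZ// mean_fun_cst.
by rewrite -/m; ring.
Qed.

Lemma mean_fun_sqr_le f : bmeas f -> L f ^+ 2 <= L (fun x => f x ^+ 2).
Proof.
move=> hf; rewrite -subr_ge0 -mean_fun_varE//; apply: mean_fun_ge0.
  by apply: bmeasX; apply: bmeasB => //; exact: bmeas_cst.
by move=> x; exact: sqr_ge0.
Qed.

(** A characteristic function has modulus at most 1, by Jensen's inequality for the square; this is
    the hypothesis on [a] and [b] in [cosrot_near]. *)
Lemma mean_fun_cos_sin f : measurable_fun setT f ->
  L (fun x => cos (f x)) ^+ 2 + L (fun x => sin (f x)) ^+ 2 <= 1.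
Proof.
move=> mf; have hc := bmeas_cos mf; have hs := bmeas_sin mf.
rewrite (le_trans (lerD (mean_fun_sqr_le hc) (mean_fun_sqr_le hs)))//.
rewrite -mean_funD; [|exact: bmeasX|exact: bmeasX].
by under [X in L X]eq_fun do rewrite cos2Dsin2; rewrite mean_fun_cst.
Qed.

(* The characteristic function of a bounded centered variable is
   [exp(- variance / 2)] up to third order. *)
Lemma mean_fun_char f c : bmeas f -> (forall x, `|f x| <= c) -> L f = 0 ->
  `|L (fun x => cos (f x)) - expR (- (L (fun x => f x ^+ 2) / 2))| +
  `|L (fun x => sin (f x))| <= c ^+ 3 + c ^+ 4 *+ 2.
Proof.
move=> hf fc Lf0; set v := L (fun x => f x ^+ 2).
have hf2 := bmeasX 2 hf.
have hc := bmeas_cos hf.1; have hs := bmeas_sin hf.1.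
have v0 : 0 <= v by apply: mean_fun_ge0 => // x; exact: sqr_ge0.
have vc : v <= c ^+ 2.
  rewrite /v -[leRHS]mean_fun_cst; apply: mean_fun_le => //; first exact: bmeas_cst.
  by move=> x; rewrite -real_normK ?num_real// lerXn2r ?nnegrE// (le_trans _ (fc x)).
(* Centering allows [f] to be subtracted under [L], so only the cubic remainder of the sine is
   left. *)
have h1 : `|L (fun x => sin (f x))| <= c ^+ 3.
  have -> : L (fun x => sin (f x)) = L (fun x => sin (f x) - f x).
    by rewrite mean_funB// Lf0 subr0.
  apply: mean_fun_norm; first exact: bmeasB.
  move=> x; rewrite (le_trans (sin_bound3 _))// lerXn2r ?nnegrE//.
  by rewrite (le_trans _ (fc x)).
have h2 : `|L (fun x => cos (f x)) - 1 + v / 2| <= c ^+ 4.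
  have -> : L (fun x => cos (f x)) - 1 + v / 2 =
      L (fun x => cos (f x) - 1 + f x ^+ 2 / 2).
    rewrite mean_funD ?mean_funB ?mean_fun_cst//; last 3 first.
    - exact: bmeas_cst.
    - by apply: bmeasB => //; exact: bmeas_cst.
    - by apply: bmeasM => //; exact: bmeas_cst.
    congr (_ + _); rewrite /v mulrC -mean_funZ//.
    by congr L; apply/funext => x; rewrite mulrC.
  apply: mean_fun_norm.
    apply: bmeasD; [apply: bmeasB => //; exact: bmeas_cst|].
    by apply: bmeasM => //; exact: bmeas_cst.
  move=> x; rewrite (le_trans (cos_bound4 _))// lerXn2r ?nnegrE//.
  by rewrite (le_trans _ (fc x)).
have h3 : `|1 - v / 2 - expR (- (v / 2))| <= c ^+ 4.
  rewrite (le_trans (expRN_bound2 _))//; first by rewrite divr_ge0.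
  rewrite (_ : c ^+ 4 = (c ^+ 2) ^+ 2); last by rewrite -exprM.
  by rewrite lerXn2r ?nnegrE ?divr_ge0 ?sqr_ge0//; lra.
set r := expR _ in h3 *; set C := L (fun x => cos (f x)) in h2 *.
have -> : C - r = (C - 1 + v / 2) + (1 - v / 2 - r) by ring.
rewrite addrC mulr2n lerD// (le_trans (ler_normD _ _))// lerD//.
Qed.

End mean_functional.

Section conditionally_iid.
Context (R : realType) dS (S : measurableType dS) (Q : probability S R).
Context dA (A : measurableType dA) (obs : S -> A).
Context dT (T : measurableType dT) (N : nat) (xi : 'I_N -> S -> T).
Context (Lam : A -> (T -> R) -> R).
Hypothesis mobs : measurable_fun setT obs.
Hypothesis mxi : forall i, measurable_fun setT (xi i).
Hypothesis meanLam : forall a, mean_fun (Lam a).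
Hypothesis mLam : forall f, bmeas f -> measurable_fun setT (Lam ^~ f).

Let bLam f : bmeas f -> bmeas (Lam ^~ f).
Proof.
move=> hf; split; first exact: mLam.
by have [_ [M fM]] := hf; exists M => a; exact: mean_fun_norm.
Qed.

Let bLam_obs f : bmeas f -> bmeas (fun w => Lam (obs w) f).
Proof. by move=> /bLam; exact: bmeas_comp. Qed.

Let Qfin := prob_lty Q.

Lemma blinear_weight d' (T' : measurableType d') (phi : S -> T') (h : S -> R) :
  measurable_fun setT phi -> bmeas h ->
  blinear (fun f : T' -> R => \int[Q]_w (f (phi w) * h w)).
Proof.
move=> mphi hh; split.
- move=> f g hf hg; rewrite -RintegralD_bmeas//; try by apply: bmeasM => //; exact: bmeas_comp.
  by apply: eq_Rintegral => w _; rewrite mulrDl.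
- move=> c f hf; rewrite -RintegralZ_bmeas//; last by apply: bmeasM => //; exact: bmeas_comp.
  by apply: eq_Rintegral => w _; rewrite mulrA.
- have [_ [H hH]] := hh; exists H => f M hf fM.
  apply: le_norm_Rintegral_prob; first by apply: bmeasM => //; exact: bmeas_comp.
  by move=> w; rewrite normrM mulrC ler_pM.
Qed.

Lemma blinear_weight_mean (h : S -> R) : bmeas h ->
  blinear (fun f : T -> R => \int[Q]_w (Lam (obs w) f * h w)).
Proof.
move=> hh; split.
- move=> f g hf hg; rewrite -RintegralD_bmeas//; try by apply: bmeasM => //; exact: bLam_obs.
  by apply: eq_Rintegral => w _; rewrite mean_funD// mulrDl.
- move=> c f hf; rewrite -RintegralZ_bmeas//; last by apply: bmeasM => //; exact: bLam_obs.
  by apply: eq_Rintegral => w _; rewrite mean_funZ// mulrA.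
- have [_ [H hH]] := hh; exists H => f M hf fM.
  apply: le_norm_Rintegral_prob; first by apply: bmeasM => //; exact: bLam_obs.
  by move=> w; rewrite normrM mulrC ler_pM// mean_fun_norm.
Qed.

(* Given [obs], the [xi i] are i.i.d. and [Lam (obs w)] is the expectation under
   their common conditional law. *)
Hypothesis iid_xi : forall (B : set A) (C : 'I_N -> set T),
  measurable B -> (forall i, measurable (C i)) ->
  \int[Q]_w (\1_B (obs w) * \prod_(i < N) \1_(C i) (xi i w)) =
  \int[Q]_w (\1_B (obs w) * \prod_(i < N) Lam (obs w) (\1_(C i))).

(** Both sides are linear in [Z] and in each [g i] separately, so the identity for indicators is
    extended one argument at a time. *)
Lemma cond_iid_prod (Z : A -> R) (g : 'I_N -> T -> R) :
  bmeas Z -> (forall i, bmeas (g i)) ->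
  \int[Q]_w (Z (obs w) * \prod_(i < N) g i (xi i w)) =
  \int[Q]_w (Z (obs w) * \prod_(i < N) Lam (obs w) (g i)).
Proof.
move=> hZ.
(* The functions of index at least [k] are still indicators, those below [k] are arbitrary; raising
   [k] by one frees the argument [o]. *)
suff h k : forall g : 'I_N -> T -> R, (forall i, bmeas (g i)) ->
    (forall i : 'I_N, (k <= i)%N -> exists2 C, measurable C & g i = \1_C) ->
  \int[Q]_w (Z (obs w) * \prod_(i < N) g i (xi i w)) =
  \int[Q]_w (Z (obs w) * \prod_(i < N) Lam (obs w) (g i)).
  by move=> hg; apply: (h N) => // i; rewrite leqNgt ltn_ord.
elim: k {g} => [|k IH] g hg ghigh.
  have /choice[C hC] : forall i, exists C, measurable C /\ g i = \1_C.
    by move=> i; have [C mC ->] := ghigh i (leq0n _); exists C.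
  have gC i : g i = \1_(C i) by case: (hC i).
  apply: (@blinear_ext _ _ _ (fun Z => \int[Q]_w (Z (obs w) * \prod_(i < N) g i (xi i w)))
    (fun Z => \int[Q]_w (Z (obs w) * \prod_(i < N) Lam (obs w) (g i)))) => //.
  - by apply: blinear_weight => //; apply: bmeas_prod => i _; exact: bmeas_comp.
  - by apply: blinear_weight => //; apply: bmeas_prod => i _; exact: bLam_obs.
  - move=> B mB; rewrite (_ : g = fun i => \1_(C i)); last exact/funext.
    by apply: iid_xi => // i; case: (hC i).
have [Nk|kN] := leqP N k.
  by apply: IH => // i /(leq_trans Nk); rewrite leqNgt ltn_ord.
pose o := Ordinal kN; pose upd (f : T -> R) i := if i == o then f else g i.
have updo : upd (g o) = g by apply/funext => i; rewrite /upd; case: eqP => [->|].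
have hupd f : bmeas f -> forall i, bmeas (upd f i).
  by move=> hf i; rewrite /upd; case: ifP.
have prodE f w : \prod_(i < N) upd f i (xi i w) =
    f (xi o w) * \prod_(i < N | i != o) g i (xi i w).
  rewrite (bigD1 o)//= /upd eqxx; congr (_ * _).
  by apply: eq_bigr => i /negbTE ->.
have prodLE f w : \prod_(i < N) Lam (obs w) (upd f i) =
    Lam (obs w) f * \prod_(i < N | i != o) Lam (obs w) (g i).
  rewrite (bigD1 o)//= /upd eqxx; congr (_ * _).
  by apply: eq_bigr => i /negbTE ->.
have hZo : bmeas (fun w => Z (obs w)) by exact: bmeas_comp.
rewrite -updo.
apply: (@blinear_ext _ _ _
  (fun f => \int[Q]_w (Z (obs w) * \prod_(i < N) upd f i (xi i w)))
  (fun f => \int[Q]_w (Z (obs w) * \prod_(i < N) Lam (obs w) (upd f i)))) => //.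
- under eq_fun do under eq_Rintegral do rewrite prodE mulrCA.
  apply: blinear_weight => //; apply: bmeasM => //.
  by apply: bmeas_prod => i _; exact: bmeas_comp.
- under eq_fun do under eq_Rintegral do rewrite prodLE mulrCA.
  apply: blinear_weight_mean => //; apply: bmeasM => //.
  by apply: bmeas_prod => i _; exact: bLam_obs.
- move=> C mC; apply: IH; first exact/hupd/bmeas_indic.
  move=> i; rewrite leq_eqVlt => /orP[/eqP ki|ki].
    by exists C => //; rewrite /upd (_ : i = o) ?eqxx//; exact/val_inj.
  have [C' mC' gC'] := ghigh i ki; exists C' => //.
  by rewrite /upd ifF//; apply/eqP => io; rewrite io ltnn in ki.
Qed.

Lemma cond_iid_one (Z : A -> R) (g : T -> R) i : bmeas Z -> bmeas g ->
  \int[Q]_w (Z (obs w) * g (xi i w)) = \int[Q]_w (Z (obs w) * Lam (obs w) g).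
Proof.
move=> hZ hg; pose G j := if j == i then g else fun=> 1.
have hG j : bmeas (G j) by rewrite /G; case: ifP => // _; exact: bmeas_cst.
have := @cond_iid_prod Z G hZ hG.
under eq_Rintegral do rewrite (bigD1 i)//= /G eqxx big1 => [|j /negbTE ->//].
under eq_Rintegral do rewrite mulr1.
move=> ->; apply: eq_Rintegral => w _; rewrite (bigD1 i)//= /G eqxx big1 ?mulr1//.
by move=> j /negbTE ->; exact: mean_fun_cst.
Qed.

Lemma cond_iid_two (Z : A -> R) (g h : T -> R) i j : i != j ->
  bmeas Z -> bmeas g -> bmeas h ->
  \int[Q]_w (Z (obs w) * (g (xi i w) * h (xi j w))) =
  \int[Q]_w (Z (obs w) * (Lam (obs w) g * Lam (obs w) h)).
Proof.
move=> ij hZ hg hh; pose G k := if k == i then g else if k == j then h else fun=> 1.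
have hG k : bmeas (G k).
  by rewrite /G; case: ifP => // _; case: ifP => // _; exact: bmeas_cst.
have Gi : G i = g by rewrite /G eqxx.
have Gj : G j = h by rewrite /G eqxx eq_sym (negbTE ij).
have GE k : (k != i) && (k != j) -> G k = fun=> 1.
  by rewrite /G => /andP[/negbTE -> /negbTE ->].
have := @cond_iid_prod Z G hZ hG.
under eq_Rintegral => w _.
  rewrite (bigD1 i)//= (bigD1 j)/= 1?eq_sym// Gi Gj big1 ?mulr1; last by move=> k /GE ->.
  over.
under [in RHS]eq_Rintegral => w _.
  rewrite (bigD1 i)//= (bigD1 j)/= 1?eq_sym// Gi Gj big1 ?mulr1; last first.
    by move=> k /GE ->; exact: mean_fun_cst.
  over.
by [].
Qed.

Lemma bmeas_cosrot d' (T' : measurableType d') (a b U : T' -> R) n :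
  bmeas a -> bmeas b -> measurable_fun setT U ->
  bmeas (fun w => cosrot (a w) (b w) n (U w)).
Proof.
move=> ha hb; elim: n U => [|n IH] U mU /=; first exact: bmeas_cos.
apply: bmeasB; first by apply: bmeasM => //; exact: IH.
apply: bmeasM => //; apply: (IH (fun w => U w - pi / 2)).
by apply: measurable_funB => //; exact: measurable_cst.
Qed.

(** Real form of the fact that the conditional expectation of [e^(i(U + sum f(xi_j)))] is [e^(iU)]
    times the [N]-th power of the characteristic function of [f] under the conditional law. *)
Lemma cond_iid_cosrot (U : A -> R) (f : T -> R) : measurable_fun setT U -> bmeas f ->
  \int[Q]_w cos (U (obs w) + \sum_(i < N) f (xi i w)) =
  \int[Q]_w cosrot (Lam (obs w) (cos \o f)) (Lam (obs w) (sin \o f)) N (U (obs w)).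
Proof.
move=> mU hf.
have hc : bmeas (cos \o f) by exact: bmeas_cos hf.1.
have hs : bmeas (sin \o f) by exact: bmeas_sin hf.1.
have msum (P : pred 'I_N) : measurable_fun setT (fun w => \sum_(i < N | P i) f (xi i w)).
  by apply: (bmeas_sum _ _ _).1 => i; exact: bmeas_comp.
(* Only [k] summands remain inside the cosine. The others have been split off by the addition
   formula and live on as factors [g i], which must be general since they may be the cosine or the
   sine of [f]. *)
suff h k : (k <= N)%N -> forall (U : A -> R) (g : 'I_N -> T -> R), measurable_fun setT U ->
   (forall i, bmeas (g i)) ->
  \int[Q]_w (cos (U (obs w) + \sum_(i < N | (i < k)%N) f (xi i w)) *
             \prod_(i < N | (k <= i)%N) g i (xi i w)) =
  \int[Q]_w (cosrot (Lam (obs w) (cos \o f)) (Lam (obs w) (sin \o f)) k (U (obs w)) *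
             \prod_(i < N | (k <= i)%N) Lam (obs w) (g i)).
  have := h N (leqnn N) U (fun _ _ => 1) mU (fun=> bmeas_cst _ 1).
  under eq_Rintegral => w _.
    rewrite [X in _ * X]big_pred0 => [|i]; last by rewrite leqNgt ltn_ord.
    rewrite mulr1 (eq_bigl xpredT) => [|i]; last by rewrite ltn_ord.
    over.
  under [in RHS]eq_Rintegral => w _.
    rewrite big_pred0 => [|i]; last by rewrite leqNgt ltn_ord.
    rewrite mulr1; over.
  by [].
elim: k {U mU} => [|k IH] kN U g mU hg.
  under eq_Rintegral => w _ do rewrite big_pred0// addr0.
  under eq_Rintegral => w _.
    rewrite (eq_bigl xpredT)//; over.
  under [in RHS]eq_Rintegral => w _.
    rewrite (eq_bigl xpredT)//=; over.
  by apply: (@cond_iid_prod (cos \o U)) => //; exact: bmeas_cos.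
pose o := Ordinal kN.
pose gc i := if i == o then cos \o f else g i.
pose gs i := if i == o then sin \o f else g i.
have hgc i : bmeas (gc i) by rewrite /gc; case: ifP.
have hgs i : bmeas (gs i) by rewrite /gs; case: ifP.
have pE (F : 'I_N -> R) :
    \prod_(i < N | (k <= i)%N) F i = F o * \prod_(i < N | (k < i)%N) F i.
  rewrite (bigD1 o)//=; congr (_ * _); apply: eq_bigl => i.
  by rewrite [RHS]ltn_neqAle andbC eq_sym -val_eqE.
have sE (F : 'I_N -> R) :
    \sum_(i < N | (i < k.+1)%N) F i = \sum_(i < N | (i < k)%N) F i + F o.
  rewrite (bigD1 o)//= addrC; congr (_ + _); apply: eq_bigl => i.
  by rewrite ltnS [RHS]ltn_neqAle andbC -val_eqE.
have gcE (i : 'I_N) : (k < i)%N -> gc i = g i.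
  by rewrite /gc; case: eqP => // ->; rewrite ltnn.
have gsE (i : 'I_N) : (k < i)%N -> gs i = g i.
  by rewrite /gs; case: eqP => // ->; rewrite ltnn.
have mUpi : measurable_fun setT (fun a => U a - pi / 2).
  by apply: measurable_funB => //; exact: measurable_cst.
have IHc := IH (ltnW kN) U gc mU hgc.
have IHs := IH (ltnW kN) (fun a => U a - pi / 2) gs mUpi hgs.
have bprod g' : (forall i, bmeas (g' i)) ->
  bmeas (fun w => \prod_(i < N | (k <= i)%N) g' i (xi i w)).
  by move=> hg'; apply: bmeas_prod => i _; exact: bmeas_comp.
have bprodL g' : (forall i, bmeas (g' i)) ->
  bmeas (fun w => \prod_(i < N | (k <= i)%N) Lam (obs w) (g' i)).
  by move=> hg'; apply: bmeas_prod => i _; exact: bLam_obs.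
have mUo (V : A -> R) : measurable_fun setT V -> measurable_fun setT (V \o obs).
  by move=> mV; exact: measurableT_comp.
(* Addition formula for the summand of index [k], with the sine of the remaining angle written as a
   cosine of phase lowered by [pi / 2]. *)
transitivity (\int[Q]_w (cos (U (obs w) + \sum_(i < N | (i < k)%N) f (xi i w)) *
               \prod_(i < N | (k <= i)%N) gc i (xi i w)) -
   \int[Q]_w (cos (U (obs w) - pi / 2 + \sum_(i < N | (i < k)%N) f (xi i w)) *
               \prod_(i < N | (k <= i)%N) gs i (xi i w))).
  rewrite -RintegralB_bmeas//; last 2 first.
  - apply: bmeasM; last exact: bprod.
    by apply: bmeas_cos; apply: measurable_funD => //; exact: mUo.
  - apply: bmeasM; last exact: bprod.
    by apply: bmeas_cos; apply: measurable_funD => //; exact: (mUo (fun a => U a - pi / 2)).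
  apply: eq_Rintegral => w _; rewrite sE !pE /gc /gs eqxx /=.
  set s := \sum_(i < N | _) _.
  have -> : U (obs w) - pi / 2 + s = (U (obs w) + s) - pi / 2 by ring.
  have -> : \prod_(i < N | (k < i)%N) (if i == o then cos \o f else g i) (xi i w) =
    \prod_(i < N | (k < i)%N) g i (xi i w).
    by apply: eq_bigr => i ki; have := gcE _ ki; rewrite /gc; case: eqP => // _ ->.
  have -> : \prod_(i < N | (k < i)%N) (if i == o then sin \o f else g i) (xi i w) =
    \prod_(i < N | (k < i)%N) g i (xi i w).
    by apply: eq_bigr => i ki; have := gsE _ ki; rewrite /gs; case: eqP => // _ ->.
  by rewrite cosBpihalf addrA (cosD (U (obs w) + s) (f (xi o w))); ring.
rewrite IHc IHs -RintegralB_bmeas//; last 2 first.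
- apply: bmeasM; last exact: bprodL.
  by apply: bmeas_cosrot; [exact: bLam_obs|exact: bLam_obs|exact: mUo].
- apply: bmeasM; last exact: bprodL.
  by apply: bmeas_cosrot; [exact: bLam_obs|exact: bLam_obs|exact: (mUo (fun a => U a - pi / 2))].
apply: eq_Rintegral => w _ /=; rewrite !pE /gc /gs eqxx /=.
have -> : \prod_(i < N | (k < i)%N) Lam (obs w) (if i == o then cos \o f else g i) =
  \prod_(i < N | (k < i)%N) Lam (obs w) (g i).
  by apply: eq_bigr => i ki; have := gcE _ ki; rewrite /gc; case: eqP => // _ ->.
have -> : \prod_(i < N | (k < i)%N) Lam (obs w) (if i == o then sin \o f else g i) =
  \prod_(i < N | (k < i)%N) Lam (obs w) (g i).
  by apply: eq_bigr => i ki; have := gsE _ ki; rewrite /gs; case: eqP => // _ ->.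
by rewrite mulrBl; congr (_ - _); rewrite mulrA; congr (_ * _); rewrite mulrC.
Qed.

Hypothesis N0 : (0 < N)%N.

Definition sample_mean (f : T -> R) w := N%:R^-1 * \sum_(i < N) f (xi i w).

Lemma mean_const (c : R) : N%:R^-1 * \sum_(i < N) c = c.
Proof.
by rewrite sumr_const card_ord -[c *+ N]mulr_natl mulKf// pnatr_eq0 -lt0n.
Qed.

Lemma bmeas_sample_mean f : bmeas f -> bmeas (sample_mean f).
Proof. by move=> hf; apply/bmeasZ/bmeas_sum => i; exact: bmeas_comp. Qed.

Lemma sample_mean_norm f M w : (forall x, `|f x| <= M) -> `|sample_mean f w| <= M.
Proof.
move=> fM; rewrite /sample_mean normrM ger0_norm ?invr_ge0// mulrC ler_pdivrMr ?ltr0n//.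
rewrite (le_trans (ler_norm_sum _ _ _))//.
rewrite (le_trans (ler_sum _ (fun i _ => fM (xi i w))))//.
by rewrite sumr_const card_ord mulr_natr.
Qed.

Lemma cond_iid_unbiased (Z : A -> R) f : bmeas Z -> bmeas f ->
  \int[Q]_w (Z (obs w) * sample_mean f w) = \int[Q]_w (Z (obs w) * Lam (obs w) f).
Proof.
move=> hZ hf; under eq_Rintegral do rewrite mulrCA mulr_sumr.
have hZo : bmeas (fun w => Z (obs w)) by exact: bmeas_comp.
have hZf i : bmeas (fun w => Z (obs w) * f (xi i w)) by apply: bmeasM => //; exact: bmeas_comp.
rewrite RintegralZ_bmeas//; last exact: bmeas_sum.
rewrite Rintegral_sum_bmeas//.
under eq_bigr do rewrite cond_iid_one//.
exact: mean_const.
Qed.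

(** A conditional central limit theorem with a rate. The number [c] bounds a summand [t f / sqrt N]
    minus its conditional mean, whence the factor 2; each of the [N] factors contributes an error of
    third order in [c], for a total of order [N^(-1/2)]. *)
Lemma cond_iid_clt (U : A -> R) f (M t c : R) : measurable_fun setT U -> bmeas f ->
  (forall x, `|f x| <= M) -> c = 2 * (`|t| * M / Num.sqrt N%:R) ->
  `| \int[Q]_w cos (U (obs w) + t * (Num.sqrt N%:R * (sample_mean f w - Lam (obs w) f))) -
     \int[Q]_w (cos (U (obs w)) *
       expR (- (t ^+ 2 * (Lam (obs w) (fun x => f x ^+ 2) - Lam (obs w) f ^+ 2) / 2))) |
  <= N%:R * (c ^+ 3 + c ^+ 4 *+ 2).
Proof.
move=> mU hf fM cE.
set sN := Num.sqrt N%:R; have sN0 : 0 < sN by rewrite sqrtr_gt0 ltr0n.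
have sN2 : sN ^+ 2 = N%:R by rewrite sqr_sqrtr.
pose F x := t / sN * f x; have hF : bmeas F by exact: bmeasZ.
pose m w := Lam (obs w) F.
have mE w : m w = t / sN * Lam (obs w) f by rewrite /m mean_funZ.
have MU : measurable_fun setT (fun a => U a - N%:R * Lam a F).
  by apply: measurable_funB => //; apply: measurable_funM => //; exact: mLam.
(* The centering term is a function of the past, so it can join [U] in the phase and the lemma for
   uncentered sums applies. *)
have -> : \int[Q]_w cos (U (obs w) + t * (sN * (sample_mean f w - Lam (obs w) f))) =
  \int[Q]_w cos (U (obs w) - N%:R * Lam (obs w) F + \sum_(i < N) F (xi i w)).
  apply: eq_Rintegral => w _; congr cos.
  rewrite -/(m w) mE /F -mulr_sumr /sample_mean -sN2; field.
  exact: lt0r_neq0.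
rewrite (cond_iid_cosrot MU hF).
pose a w := Lam (obs w) (fun x => cos (F x - m w)).
pose b w := Lam (obs w) (fun x => sin (F x - m w)).
have hFm w : bmeas (fun x => F x - m w) by apply: bmeasB => //; exact: bmeas_cst.
have hcF : bmeas (cos \o F) by exact: bmeas_cos hF.1.
have hsF : bmeas (sin \o F) by exact: bmeas_sin hF.1.
(* The centering returns from the phase to the individual factors, which become the cosine and sine
   moments of a centered variable. *)
have shiftE w : cosrot (Lam (obs w) (cos \o F)) (Lam (obs w) (sin \o F)) N
   (U (obs w) - N%:R * Lam (obs w) F) = cosrot (a w) (b w) N (U (obs w)).
  rewrite cosrot_shift -/(m w); congr cosrot.
    rewrite /a (_ : (fun x => cos (F x - m w)) =
      (fun x => cos (m w) * (cos \o F) x + sin (m w) * (sin \o F) x)); last first.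
      by apply/funext => x /=; rewrite cosB; ring.
    rewrite (mean_funD (meanLam _) (bmeasZ _ hcF) (bmeasZ _ hsF)).
    by rewrite !(mean_funZ (meanLam _))//; ring.
  rewrite /b (_ : (fun x => sin (F x - m w)) =
    (fun x => cos (m w) * (sin \o F) x - sin (m w) * (cos \o F) x)); last first.
    by apply/funext => x /=; rewrite sinB; ring.
  rewrite (mean_funB (meanLam _) (bmeasZ _ hsF) (bmeasZ _ hcF)).
  by rewrite !(mean_funZ (meanLam _))//; ring.
under eq_Rintegral do rewrite shiftE.
have bcr : bmeas (fun w => cosrot (a w) (b w) N (U (obs w))).
  under eq_fun do rewrite -shiftE.
  by apply: bmeas_cosrot; [exact: bLam_obs|exact: bLam_obs|exact: measurableT_comp MU mobs].
have hvar w : Lam (obs w) (fun x => f x ^+ 2) - Lam (obs w) f ^+ 2 =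
  Lam (obs w) (fun x => (f x - Lam (obs w) f) ^+ 2) by rewrite mean_fun_varE.
have hvar0 w : 0 <= Lam (obs w) (fun x => f x ^+ 2) - Lam (obs w) f ^+ 2.
  by rewrite subr_ge0 mean_fun_sqr_le.
rewrite -(Rintegral_cst_prob Q (N%:R * (c ^+ 3 + c ^+ 4 *+ 2))).
apply: le_dist_Rintegral_prob => //; last 2 first.
- exact: bmeas_cst.
- move=> w.
  pose v := Lam (obs w) (fun x => (F x - m w) ^+ 2).
  have vE : v = (t / sN) ^+ 2 * (Lam (obs w) (fun x => f x ^+ 2) - Lam (obs w) f ^+ 2).
    rewrite hvar -(mean_funZ (meanLam _)); last by apply: bmeasX; apply: bmeasB => //; exact: bmeas_cst.
    by congr (Lam _); apply/funext => x; rewrite mE /F; ring.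
  have v0 : 0 <= v by rewrite vE mulr_ge0// sqr_ge0.
  (* Here [v] is the conditional variance of one summand, so the Gaussian factor is an [N]-th power
     and can be compared factor by factor. *)
  have rN : expR (- (t ^+ 2 * (Lam (obs w) (fun x => f x ^+ 2) - Lam (obs w) f ^+ 2) / 2)) =
      expR (- (v / 2)) ^+ N.
    rewrite -expRM_natl; congr expR; rewrite vE -sN2; field; exact: lt0r_neq0.
  rewrite rN mulrC.
  have ab1 : a w ^+ 2 + b w ^+ 2 <= 1 by exact: mean_fun_cos_sin (hFm w).1.
  have r01 : 0 <= expR (- (v / 2)) <= 1.
    by rewrite expR_ge0 -[X in _ <= X]expR0 ler_expR oppr_le0 divr_ge0.
  rewrite [X in _ - X]mulrC (mulrC (cos _)) (le_trans (cosrot_near N _ ab1 r01))//.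
  rewrite ler_wpM2l// (mean_fun_char (meanLam _) (hFm w))//; last first.
    by rewrite mean_funB ?mean_fun_cst ?subrr//; exact: bmeas_cst.
  have FM x : `|F x| <= `|t| * M / sN.
    rewrite /F normrM normf_div (gtr0_norm sN0) mulrAC -mulrA -mulrA ler_wpM2l//.
    by rewrite ler_wpM2r// invr_ge0 ltW.
  move=> x; rewrite cE mulrDl mul1r (le_trans (ler_normB _ _))// lerD//.
  exact: mean_fun_norm.
- apply: bmeasM.
    by apply: bmeas_cos; exact: measurableT_comp.
  apply: (@bmeas_expRN _ _ _ (fun w => t ^+ 2 * (Lam (obs w) (fun x => f x ^+ 2) - Lam (obs w) f ^+ 2) / 2)).
    apply: (bmeasM (bmeasZ _ _) (bmeas_cst _ _)).1.
    by apply: bmeasB; [exact/bLam_obs/bmeasX|exact/bmeasX/bLam_obs].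
  by move=> w; rewrite divr_ge0// mulr_ge0// sqr_ge0.
Qed.

(** Conditionally independent centered terms are orthogonal, so only the [N] diagonal terms, each at
    most [M ^+ 2], survive the division by [N ^+ 2]. *)
Lemma cond_iid_L2 f (M : R) : bmeas f -> (forall x, `|f x| <= M) ->
  \int[Q]_w ((sample_mean f w - Lam (obs w) f) ^+ 2) <= M ^+ 2 / N%:R.
Proof.
move=> hf fM; pose D i w := f (xi i w) - Lam (obs w) f.
have hfi i : bmeas (fun w => f (xi i w)) by exact: bmeas_comp.
have hL := bLam_obs hf.
have hD i : bmeas (D i) by exact: bmeasB.
have DE w : (sample_mean f w - Lam (obs w) f) ^+ 2 =
    N%:R^-1 ^+ 2 * \sum_(i < N) \sum_(j < N) (D i w * D j w).
  rewrite -big_distrlr/= -expr2 -exprMn; congr (_ ^+ 2).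
  by rewrite /D sumrB mulrBr mean_const.
under eq_Rintegral do rewrite DE.
rewrite RintegralZ_bmeas//; last by do 2 apply: bmeas_sum => ?; exact: bmeasM.
rewrite Rintegral_sum_bmeas//; last by move=> i; apply: bmeas_sum => j; exact: bmeasM.
have crossE i j : \int[Q]_w (D i w * D j w) <= if i == j then M ^+ 2 else 0.
  (* As [Lam (obs w) f] depends on the past only, both mixed products have the same integral as its
     square. *)
  have -> : \int[Q]_w (D i w * D j w) = \int[Q]_w (f (xi i w) * f (xi j w)) -
     \int[Q]_w (Lam (obs w) f * Lam (obs w) f).
    have h1 k : \int[Q]_w (Lam (obs w) f * f (xi k w)) = \int[Q]_w (Lam (obs w) f * Lam (obs w) f).
      by apply: (@cond_iid_one (Lam ^~ f)) => //; exact: bLam.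
    transitivity (\int[Q]_w (f (xi i w) * f (xi j w)) - \int[Q]_w (Lam (obs w) f * f (xi i w))
      - (\int[Q]_w (Lam (obs w) f * f (xi j w)) - \int[Q]_w (Lam (obs w) f * Lam (obs w) f))).
      rewrite -!RintegralB_bmeas//; try by (exact: bmeasM || (apply: bmeasB; exact: bmeasM)).
      by apply: eq_Rintegral => w _; rewrite /D; ring.
    by rewrite !h1; ring.
  case: eqVneq => [<-|ij].
    rewrite lerBlDr (le_trans _ (_ : M ^+ 2 + 0 <= _))//; last first.
      by rewrite lerD2l; apply: Rintegral_ge0 => w _; rewrite -expr2 sqr_ge0.
    rewrite addr0 -(Rintegral_cst_prob Q (M ^+ 2)); apply: le_Rintegral_bmeas => //.
    - exact: bmeasM.
    - exact: bmeas_cst.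
    - move=> w; rewrite -expr2 -real_normK ?num_real// lerXn2r ?nnegrE//.
      by rewrite (le_trans _ (fM (xi i w))).
  have := @cond_iid_two (fun=> 1) f f i j ij (bmeas_cst _ 1) hf hf.
  under eq_Rintegral do rewrite mul1r.
  under [in RHS]eq_Rintegral do rewrite mul1r.
  by move=> ->; rewrite subrr.
have : \sum_(i < N) \int[Q]_w \sum_(j < N) (D i w * D j w) <= N%:R * M ^+ 2.
  rewrite -[N in N%:R]card_ord mulr_natl -sumr_const; apply: ler_sum => i _.
  rewrite Rintegral_sum_bmeas//; last by move=> j; exact: bmeasM.
  rewrite (le_trans (ler_sum _ (fun j _ => crossE i j)))//.
  by rewrite -big_mkcond/= (big_pred1 i)// => j; rewrite eq_sym.
have N1 : (N%:R : R) != 0 by rewrite pnatr_eq0 -lt0n.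
move=> h; rewrite (le_trans (ler_wpM2l (sqr_ge0 _) h))//.
by rewrite le_eqVlt; apply/orP; left; apply/eqP; field.
Qed.

End conditionally_iid.

(** * Convergence in law from characteristic functions *)

Section weierstrass.
Context (R : realType).
Implicit Types (x : R) (g : nat -> R).

(* The Bernstein polynomial [\sum_k g k 'C(n, k) X^k (1 - X)^(n - k)], presented by
   conditioning a binomial variable on its first Bernoulli trial. *)
Fixpoint bernstein n g : {poly R} :=
  if n is n'.+1 then 'X * bernstein n' (fun k => g k.+1) + (1 - 'X) * bernstein n' g
  else (g 0%N)%:P.

Lemma bernsteinS n g x : (bernstein n.+1 g).[x] =
  x * (bernstein n (fun k => g k.+1)).[x] + (1 - x) * (bernstein n g).[x].
Proof. by rewrite /= !hornerE. Qed.

Lemma bernstein_cst n c x : (bernstein n (fun=> c)).[x] = c.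
Proof. by elim: n => [|n IH]; rewrite ?bernsteinS ?IH /= ?hornerE//; ring. Qed.

Lemma bernsteinD n g g' x :
  (bernstein n (fun k => g k + g' k)).[x] = (bernstein n g).[x] + (bernstein n g').[x].
Proof.
elim: n g g' => [|n IH] g g'; first by rewrite /= !hornerE.
by rewrite !bernsteinS (IH (fun k => g k.+1) (fun k => g' k.+1)) IH; ring.
Qed.

Lemma bernsteinZ n c g x :
  (bernstein n (fun k => c * g k)).[x] = c * (bernstein n g).[x].
Proof.
elim: n g => [|n IH] g; first by rewrite /= !hornerE.
by rewrite !bernsteinS (IH (fun k => g k.+1)) IH; ring.
Qed.

Lemma bernstein_le n g g' x : 0 <= x <= 1 -> (forall k, g k <= g' k) ->
  (bernstein n g).[x] <= (bernstein n g').[x].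
Proof.
move=> /andP[x0 x1]; elim: n g g' => [|n IH] g g' gg'; first by rewrite /= !hornerE.
by rewrite !bernsteinS lerD// ler_wpM2l ?subr_ge0// IH.
Qed.

(** Variance of a binomial variable. The offset [c] makes the induction work: the first trial
    changes it by [1 - x] on success and by [- x] on failure. *)
Lemma bernstein_var n c x : (bernstein n (fun k => (k%:R - n%:R * x + c) ^+ 2)).[x] =
  n%:R * (x * (1 - x)) + c ^+ 2.
Proof.
elim: n c => [|n IH] c; first by rewrite /= hornerE; ring.
rewrite bernsteinS.
have -> : (fun k => (k.+1%:R - n.+1%:R * x + c) ^+ 2) =
    (fun k => (k%:R - n%:R * x + (1 - x + c)) ^+ 2).
  by apply/funext => k; rewrite -!natr1; congr (_ ^+ 2); ring.
have -> : (fun k => (k%:R - n.+1%:R * x + c) ^+ 2) =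
    (fun k => (k%:R - n%:R * x + (c - x)) ^+ 2).
  by apply/funext => k; rewrite -!natr1; congr (_ ^+ 2); ring.
by rewrite !IH -natr1; ring.
Qed.

(** Only [x] is confined to the unit interval: [bernstein_le] compares values at all [k], hence at
    points [k / n] beyond 1 as well. *)
Lemma uniform_continuity01 (h : R -> R) e : continuous h -> 0 < e ->
  exists2 del, 0 < del & forall x y, 0 <= x <= 1 -> `|x - y| < del -> `|h x - h y| <= e.
Proof.
move=> ch e0.
have /compact_near_coveringP := @segment_compact R 0 1.
move=> /(_ R (0^'+) (fun del x => forall y, `|x - y| < del -> `|h x - h y| <= e)).
have e2 : 0 < e / 2 by lra.
move=> [].
  move=> x _.
  have /cvgrPdist_le /(_ _ e2) := ch x.
  move=> /nbhs_ballP[r /= r0 hr].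
  exists (ball x (r / 2), [set del | 0 < del < r / 2]) => /=.
    split; first by apply: nbhsx_ballx; lra.
    near=> del => /=; apply/andP; split; near: del; first exact: nbhs_right_gt.
    by apply: nbhs_right_lt; lra.
  move=> [z del] /= [xz /andP[del0 delr]] y zy.
  have hz : `|h x - h z| <= e / 2 by apply: hr; rewrite /ball/= in xz *; lra.
  have hy : `|h x - h y| <= e / 2.
    apply: hr; rewrite /ball/= in xz *.
    have -> : x - y = (x - z) + (z - y) by ring.
    by rewrite (le_lt_trans (ler_normD _ _))//; lra.
  have -> : h z - h y = (h x - h y) - (h x - h z) by ring.
  by rewrite (le_trans (ler_normB _ _))//; lra.
move=> del [/= del0 hdel].
exists (del / 2); first by rewrite divr_gt0.
move=> x y x01; apply: (hdel (del / 2)) => /=.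
- by rewrite sub0r normrN gtr0_norm ?divr_gt0//; lra.
- by rewrite divr_gt0.
- by rewrite in_itv.
Unshelve. all: by end_near. Qed.

(** Bernstein's argument: near [x] the oscillation of [h] is at most [e / 2], and far from [x] the
    bound [2 * M] is dominated by a multiple of the squared distance, whose binomial mean is
    known. *)
Lemma weierstrass01 (h : R -> R) M e : continuous h -> (forall x, `|h x| <= M) -> 0 < e ->
  exists p : {poly R}, forall x, 0 <= x <= 1 -> `|p.[x] - h x| <= e.
Proof.
move=> ch hM e0; have e2 : 0 < e / 2 by lra.
have [del del0 hdel] := uniform_continuity01 ch e2.
have M0 : 0 <= M by rewrite (le_trans _ (hM 0)).
(* At distance at least [del] one has [2 M <= C (x - y)^2]. With [n] such that [C / n <= e], the
   quadratic part contributes at most [e / 4], as [x (1 - x) <= 1 / 4]. *)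
pose C := 2 * M / del ^+ 2.
have C0 : 0 <= C by rewrite divr_ge0// ?sqr_ge0// mulr_ge0.
pose n := (Num.truncn (C / e)).+1.
have n0 : (0 : R) < n%:R by rewrite ltr0n.
have Cn : C / n%:R <= e.
  rewrite ler_pdivrMr// mulrC -ler_pdivrMr//.
  by rewrite ltW//; exact: truncnS_gt.
exists (bernstein n (fun k => h (k%:R / n%:R))) => x x01.
have bnd k : `|h (k%:R / n%:R) - h x| <= e / 2 + C / n%:R ^+ 2 * (k%:R - n%:R * x + 0) ^+ 2.
  have -> : C / n%:R ^+ 2 * (k%:R - n%:R * x + 0) ^+ 2 = C * (x - k%:R / n%:R) ^+ 2.
    by field; rewrite gt_eqF.
  set y := k%:R / n%:R; rewrite distrC.
  have [lt|ge] := ltP `|x - y| del.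
    by rewrite (le_trans (hdel _ _ x01 lt))// lerDl mulr_ge0// sqr_ge0.
  have : del ^+ 2 <= (x - y) ^+ 2.
    by rewrite -[leRHS]real_normK ?num_real// lerXn2r ?nnegrE// ltW.
  move=> /(ler_wpM2l C0); rewrite {1}/C mulfVK ?sqrf_eq0 ?gt_eqF// => h1.
  by rewrite (le_trans (ler_normB _ _))//; have := hM x; have := hM y; lra.
have -> : (bernstein n (fun k => h (k%:R / n%:R))).[x] - h x =
    (bernstein n (fun k => h (k%:R / n%:R) - h x)).[x].
  by rewrite bernsteinD bernstein_cst.
pose B k : R := e / 2 + C / n%:R ^+ 2 * (k%:R - n%:R * x + 0) ^+ 2.
have BE : (bernstein n B).[x] <= e.
  rewrite /B bernsteinD bernstein_cst bernsteinZ bernstein_var expr0n/= addr0.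
  have -> : C / n%:R ^+ 2 * (n%:R * (x * (1 - x))) = C / n%:R * (x * (1 - x)).
    by field; rewrite gt_eqF.
  have x4 : x * (1 - x) <= 1 / 4 by have := sqr_ge0 (x - 1 / 2); rewrite expr2; lra.
  have : C / n%:R * (x * (1 - x)) <= C / n%:R * (1 / 4).
    by apply: ler_wpM2l => //; rewrite divr_ge0// ltW.
  lra.
rewrite ler_norml; apply/andP; split; rewrite ?(le_trans _ BE) -1?(le_trans _ BE)//.
  rewrite -[X in _ <= X]opprK lerN2 -mulN1r -bernsteinZ (le_trans _ BE)//.
  apply: bernstein_le => // k; rewrite mulN1r (le_trans _ (bnd k))//.
  by rewrite -normrN ler_norm.
by apply: bernstein_le => // k; rewrite (le_trans _ (bnd k))// ler_norm.
Qed.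

End weierstrass.

(** * Approximation by trigonometric polynomials *)

Section trigonometric_test_functions.
Context (R : realType).

(** Arbitrary phases bring in the sines, and arbitrary frequencies allow the period to grow with the
    interval of approximation. *)
Inductive trigpoly : (R -> R) -> Prop :=
| trigpoly_cos s t : trigpoly (fun x => cos (s + t * x))
| trigpoly_add f g : trigpoly f -> trigpoly g -> trigpoly (fun x => f x + g x)
| trigpoly_scale c f : trigpoly f -> trigpoly (fun x => c * f x).

Lemma trigpoly_ext f g : f =1 g -> trigpoly f -> trigpoly g.
Proof. by move=> /funext ->. Qed.

Lemma measurable_affine (s t : R) : measurable_fun setT (fun x : R => s + t * x).
Proof.
apply: measurable_funD; first exact: measurable_cst.
apply: measurable_funM; [exact: measurable_cst|exact: measurable_id].
Qed.

Lemma bmeas_trigpoly f : trigpoly f -> bmeas f.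
Proof.
elim=> [s t|g h _ hg _ hh|c g _ hg]; [|exact: bmeasD|exact: bmeasZ].
by apply: bmeas_cos; exact: measurable_affine.
Qed.

Lemma trigpoly_cst c : trigpoly (fun=> c).
Proof.
apply: trigpoly_ext (trigpoly_scale c (trigpoly_cos 0 0)) => x.
by rewrite mul0r addr0 cos0 mulr1.
Qed.

Lemma trigpoly_mul l f : trigpoly f -> trigpoly (fun x => (1 + sin (l * x)) / 2 * f x).
Proof.
elim=> [s t|g h _ hg _ hh|c g _ hg].
(* Product to sum: [cos u (1 + sin v) / 2 = cos u / 2 + (sin (u + v) - sin (u - v)) / 4], each sine
   being a cosine with phase lowered by [pi / 2]. *)
- pose a := trigpoly_scale 2^-1 (trigpoly_cos s t).
  pose b := trigpoly_scale 4^-1 (trigpoly_cos (s - pi / 2) (t + l)).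
  pose c := trigpoly_scale (- 4^-1) (trigpoly_cos (s - pi / 2) (t - l)).
  apply: trigpoly_ext (trigpoly_add a (trigpoly_add b c)) => x.
  have -> : s - pi / 2 + (t + l) * x = ((s + t * x) + l * x) - pi / 2 by ring.
  have -> : s - pi / 2 + (t - l) * x = ((s + t * x) - l * x) - pi / 2 by ring.
  by rewrite !cosBpihalf sinD sinB; field.
- by apply: trigpoly_ext (trigpoly_add hg hh) => x; ring.
- by apply: trigpoly_ext (trigpoly_scale c hg) => x; ring.
Qed.

Lemma trigpoly_horner l (p : {poly R}) : trigpoly (fun x => p.[(1 + sin (l * x)) / 2]).
Proof.
elim/poly_ind: p => [|p c IH].
  by apply: trigpoly_ext (trigpoly_cst 0) => x; rewrite horner0.
apply: trigpoly_ext (trigpoly_add (trigpoly_mul l IH) (trigpoly_cst c)) => x.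
by rewrite hornerMXaddC mulrC.
Qed.

(* A continuous bounded [f] agrees on [-A, A] with [h ((1 + sin (x / A)) / 2)], [h]
   continuous, so Weierstrass approximation of [h] gives a trigonometric polynomial
   that is close to [f] on [-A, A] and bounded everywhere. *)
Lemma trigpoly_approx f M A e : continuous f -> (forall x, `|f x| <= M) -> 0 < A -> 0 < e ->
  exists g, [/\ trigpoly g, forall x, `|g x| <= M + e &
    forall x, `|x| <= A -> `|g x - f x| <= e].
Proof.
move=> cf fM A0 e0.
pose s1 : R := sin 2^-1.
have pi2 : 1 <= pi / 2 :> R by exact: pihalf_ge1.
(* For [|x| <= A] the angle [x / (2A)] lies in [-1/2, 1/2], where the sine is invertible. Clamping
   at [sin (1/2)] keeps the argument of [asin] away from -1 and 1, so [h] is continuous on the whole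
   line and recovers [f x] on the interval. *)
pose clamp (y : R) : R := Num.max (- s1) (Num.min s1 y).
pose h (y : R) := f (2 * A * asin (clamp (2 * y - 1))).
have s1lt1 : s1 < 1.
  by rewrite /s1 -[X in _ < X](sin_pihalf R) ltr_sin ?in_itv/=; [lra|apply/andP; split; lra|apply/andP; split; lra].
have s10 : 0 < s1 by rewrite /s1 sin_gt0_pihalf//; apply/andP; split; lra.
have clampP y : - s1 <= clamp y <= s1.
  by rewrite /clamp le_max lexx/= ge_max ge_min lexx /= andbT; lra.
have cclamp : continuous clamp.
  move=> y; have c1 : {for y, continuous (fun _ : R => s1 : R^o)} by exact: cst_continuous.
  have c2 : {for y, continuous (fun _ : R => - s1 : R^o)} by exact: cst_continuous.
  have c3 : {for y, continuous (fun y : R => y : R^o)} by exact: cvg_id.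
  exact: (continuous_max c2 (continuous_min c1 c3)).
have ch : continuous h.
  move=> y; rewrite /h; apply: continuous_comp; last exact: cf.
  apply: continuousM; first exact: cst_continuous.
  apply: continuous_comp; last first.
    by apply: continuous_asin; have /andP[? ?] := clampP (2 * y - 1); lra.
  apply: continuous_comp; last exact: cclamp.
  apply: continuousB; last exact: cst_continuous.
  by apply: continuousM; [exact: cst_continuous|exact: cvg_id].
have [p hp] := weierstrass01 ch (fun y => fM _) e0.
exists (fun x => p.[(1 + sin ((2 * A)^-1 * x)) / 2]); split.
- exact: trigpoly_horner.
- move=> x; set y := (1 + _) / 2.
  have y01 : 0 <= y <= 1.
    have := sin_geN1 ((2 * A)^-1 * x); have := sin_le1 ((2 * A)^-1 * x); rewrite /y => ? ?.
    by apply/andP; split; lra.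
  have -> : p.[y] = h y + (p.[y] - h y) by ring.
  by apply: (le_trans (ler_normD _ _)); apply: lerD; [exact: fM|exact: hp].
- move=> x xA; set y := (1 + _) / 2.
  have y01 : 0 <= y <= 1.
    have := sin_geN1 ((2 * A)^-1 * x); have := sin_le1 ((2 * A)^-1 * x); rewrite /y => ? ?.
    by apply/andP; split; lra.
  suff -> : f x = h y by exact: hp.
  have xA1 : `|(2 * A)^-1 * x| <= 2^-1.
    rewrite normrM gtr0_norm ?invr_gt0 ?mulr_gt0// ler_pdivrMl ?mulr_gt0//.
    by rewrite mulrAC divff ?mul1r// gt_eqF.
  have /andP[x1 x2] : - 2^-1 <= (2 * A)^-1 * x <= 2^-1 by rewrite -ler_norml.
  have I1 (z : R) : - 2^-1 <= z <= 2^-1 -> z \in `[(- (pi / 2)), (pi / 2)].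
    by move=> /andP[? ?]; rewrite in_itv/=; apply/andP; split; lra.
  have Ix : (2 * A)^-1 * x \in `[(- (pi / 2)), (pi / 2)] by apply: I1; rewrite x1 x2.
  have Ih : (2^-1 : R) \in `[(- (pi / 2)), (pi / 2)] by apply: I1; apply/andP; split; lra.
  have INh : (- 2^-1 : R) \in `[(- (pi / 2)), (pi / 2)] by apply: I1; apply/andP; split; lra.
  rewrite /h /y (_ : 2 * _ - 1 = sin ((2 * A)^-1 * x)); last by field.
  have -> : clamp (sin ((2 * A)^-1 * x)) = sin ((2 * A)^-1 * x).
    rewrite /clamp (min_idPr _) ?(max_idPr _)//.
      by rewrite /s1 -sinN leNgt ltr_sin// -leNgt.
    by rewrite /s1 leNgt ltr_sin// -leNgt.
  by rewrite sinK// mulVKf// gt_eqF// mulr_gt0.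
Qed.

End trigonometric_test_functions.

Lemma measurable_tail (R : realType) (A : R) : measurable [set x : R | A < `|x|].
Proof.
rewrite (_ : [set x : R | _] = setT `&` (fun x : R => `|x|) @^-1` `]A, +oo[).
  by apply: normr_measurable => //; exact: measurable_itv.
by rewrite setTI; apply/seteqP; split => x /=; rewrite in_itv/= andbT.
Qed.

Section convergence_criterion.
Context (R : realType) (dS : nat -> measure_display) (S : forall N, measurableType (dS N)).
Context (Q : forall N, probability (S N) R) (Z : forall N, S N -> R).
Context (mu : probability (measurableTypeR R) R).
Hypothesis mZ : forall N, measurable_fun setT (@Z N).
Hypothesis cosZ : forall s t, (fun N => \int[Q N]_w cos (s + t * Z w)) @ \oo -->
  \int[mu]_x cos (s + t * x).

Let bmeasZN N (g : R -> R) : bmeas g -> bmeas (fun w => g (@Z N w)).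
Proof. by apply: bmeas_comp. Qed.

Lemma cvg_trigpoly g : trigpoly g ->
  (fun N => \int[Q N]_w g (@Z N w)) @ \oo --> \int[mu]_x g x.
Proof.
elim=> [s t|f h tf hf th hh|c f tf hf]; first exact: cosZ.
- have hf' := bmeas_trigpoly tf; have hh' := bmeas_trigpoly th.
  rewrite (RintegralD_bmeas (prob_lty mu))//.
  rewrite (_ : (fun N => _) = (fun N => \int[Q N]_w f (@Z N w) + \int[Q N]_w h (@Z N w))).
    exact: cvgD.
  by apply/funext => N; rewrite (RintegralD_bmeas (prob_lty _)) ?bmeasZN//; exact: bmeasZN.
- have hf' := bmeas_trigpoly tf.
  rewrite (RintegralZ_bmeas (prob_lty mu))//.
  rewrite (_ : (fun N => _) = (fun N => c * \int[Q N]_w f (@Z N w))).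
    by apply: cvgM => //; exact: cvg_cst.
  by apply/funext => N; rewrite (RintegralZ_bmeas (prob_lty _))//; exact: bmeasZN.
Qed.

Hypothesis tightZ : forall e : R, 0 < e -> exists2 A : R, 0 < A &
  \forall N \near \oo, \int[Q N]_w (\1_[set x : R | A < `|x|] (@Z N w)) <= e.
Hypothesis tight_mu : forall e : R, 0 < e -> exists2 A : R, 0 < A &
  \int[mu]_x (\1_[set x : R | A < `|x|] x) <= e.

Let approx_integral d (T : measurableType d) (nu : probability T R) (Y : T -> R)
   (f g : R -> R) M e A : measurable_fun setT Y -> bmeas f -> bmeas g ->
   0 <= M -> (forall x, `|f x| <= M) -> (forall x, `|g x| <= M) ->
   (forall x, `|x| <= A -> `|g x - f x| <= e) -> 0 <= e ->
  `|\int[nu]_x f (Y x) - \int[nu]_x g (Y x)| <=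
  e + 2 * M * \int[nu]_x (\1_[set x : R | A < `|x|] (Y x)).
Proof.
move=> mY hf hg M0 fM gM fg e0.
have hI := bmeas_comp mY (bmeas_indic R (measurable_tail A)).
rewrite -(RintegralZ_bmeas (prob_lty nu))//.
rewrite -{1}(Rintegral_cst_prob nu e) -(RintegralD_bmeas (prob_lty nu)); last 2 first.
- exact: bmeas_cst.
- exact: bmeasZ.
apply: le_dist_Rintegral_prob.
- exact: bmeas_comp hf.
- exact: bmeas_comp hg.
- by apply: bmeasD; [exact: bmeas_cst|exact: bmeasZ].
- move=> x; rewrite indicE; have [YA|YA] := leP `|Y x| A.
    rewrite memNset/=; last by move=> /=; rewrite ltNge YA.
    by rewrite mulr0 addr0 distrC fg.
  rewrite mem_set//= mulr1 (le_trans (ler_normB _ _))//.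
  by have := fM (Y x); have := gM (Y x); lra.
Qed.

(** The test function is replaced by a trigonometric polynomial under both laws; the error is small
    on [-A, A], and the tails carry little mass under either. *)
Lemma cvg_in_law_cos : cvg_in_law Q Z mu.
Proof.
move=> f cf bf.
have [M0 fM] : exists M0, forall x, `|f x| <= M0.
  have [M0 [_ hM0]] := bf; exists (M0 + 1) => x; apply: (hM0 (M0 + 1)) => //.
  by rewrite ltrDl.
have M00 : 0 <= M0 by rewrite (le_trans _ (fM 0)).
have hf : bmeas f by split; [exact: continuous_measurable_fun|exists M0].
apply/cvgrPdist_le => e e0.
pose M := M0 + 1; have M1 : 1 <= M by rewrite /M lerDr.
(* Each replacement costs [2 * e1] and the convergence of the polynomial costs [e1], five in all;
   the minimum with 1 gives [f] and its approximation the common bound [M]. Below, [e2] absorbs the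
   factor [2 * M] in front of the tails. *)
pose e1 := Num.min 1 (e / 5); have e10 : 0 < e1 by rewrite lt_min ltr01; lra.
have e15 : e1 <= e / 5 by rewrite ge_min lexx orbT.
have e1e : 5 * e1 <= e by lra.
have e11 : e1 <= 1 by rewrite ge_min lexx.
pose e2 := e1 / (2 * M); have e20 : 0 < e2 by rewrite divr_gt0//; lra.
have [A1 A10 hA1] := tightZ e20; have [A2 A20 hA2] := tight_mu e20.
pose A := Num.max A1 A2; have A0 : 0 < A by rewrite lt_max A10.
have [g [tg gM gf]] := trigpoly_approx cf fM A0 e10.
have hg := bmeas_trigpoly tg.
have {}gM x : `|g x| <= M by rewrite (le_trans (gM x))// lerD2l.
have {}fM x : `|f x| <= M by rewrite (le_trans (fM x))// lerDl.
have tailm d (T : measurableType d) (nu : probability T R) (Y : T -> R) A' :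
    measurable_fun setT Y -> A' <= A ->
    \int[nu]_x (\1_[set x : R | A' < `|x|] (Y x)) <= e2 ->
    2 * M * \int[nu]_x (\1_[set x : R | A < `|x|] (Y x)) <= e1.
  move=> mY A'A h.
  have : \int[nu]_x (\1_[set x : R | A < `|x|] (Y x)) <= e2.
    rewrite (le_trans _ h)//; apply: (le_Rintegral_bmeas (prob_lty nu)).
    - exact: bmeas_comp mY (bmeas_indic R (measurable_tail A)).
    - exact: bmeas_comp mY (bmeas_indic R (measurable_tail A')).
    - move=> x; rewrite !indicE ler_nat; case: (boolP (_ \in _)) => //.
      by rewrite inE /= => AY; rewrite mem_set//=; exact: le_lt_trans AY.
  have M20 : 0 <= 2 * M by lra.
  have Me : 2 * M * e2 = e1 by rewrite /e2; field; apply/eqP; lra.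
  by move=> /(ler_wpM2l M20); rewrite Me.
have Mge0 : 0 <= M by lra.
have hmu := approx_integral mu (@measurable_id _ (measurableTypeR R) setT)
   hf hg Mge0 fM gM gf (ltW e10).
have tmu := tailm _ _ mu id A2 (@measurable_id _ (measurableTypeR R) setT) _ hA2.
have /cvgrPdist_le /(_ _ e10) cvg_g := cvg_trigpoly tg.
near=> N.
have hN := approx_integral (Q N) (@mZ N) hf hg Mge0 fM gM gf (ltW e10).
have tN : 2 * M * \int[Q N]_x (\1_[set x : R | A < `|x|] (@Z N x)) <= e1.
  apply: (tailm _ _ _ _ A1) => //; first by rewrite /A le_max lexx.
  by near: N.
have gN : `|\int[mu]_x g x - \int[Q N]_w g (@Z N w)| <= e1 by near: N.
have {}tmu : 2 * M * \int[mu]_x (\1_[set x : R | A < `|x|] x) <= e1.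
  by apply: tmu; rewrite /A le_max lexx orbT.
set F := \int[mu]_x f x in hmu *; set FN := \int[Q N]_x f (@Z N x) in hN *.
set H := \int[mu]_x g x in hmu gN; set HN := \int[Q N]_x g (@Z N x) in hN gN.
have -> : F - FN = (F - H) + (H - HN) - (FN - HN) by ring.
rewrite (le_trans (ler_normB _ _))//.
have := ler_normD (F - H) (H - HN).
have hmu' : `|F - H| <= 2 * e1 by rewrite (le_trans hmu)//; lra.
have hN' : `|FN - HN| <= 2 * e1 by rewrite (le_trans hN)//; lra.
lra.
Unshelve. all: by end_near. Qed.

End convergence_criterion.

Lemma prob_segment_cvg (R : realType) (mu : probability (measurableTypeR R) R) :
  fine (mu `[- n.+1%:R, n.+1%:R]%classic) @[n --> \oo] --> (1 : R).
Proof.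
pose I n : set (measurableTypeR R) := `[- n.+1%:R, n.+1%:R]%classic.
have mI n : measurable (I n) by exact: measurable_itv.
have := @nondecreasing_cvg_mu _ _ R mu I mI.
have -> : \bigcup_n I n = setT.
  apply/seteqP; split => // x _; exists (Num.truncn `|x|) => //=.
  by rewrite /I /= in_itv/= -ler_norml ltW// truncnS_gt.
move=> /(_ measurableT) h; apply: fine_cvg.
rewrite -(probability_setT mu); apply: h => m n mn.
by apply/subsetPset; apply: subset_itv; rewrite bnd_simp ?lerN2 ler_nat ltnS.
Qed.

(** * The characteristic function of the Gaussian law *)

Section gaussian_characteristic_function.
Context (R : realType) (sigma : R).
Hypothesis sigma0 : 0 < sigma.
Notation mu := (@lebesgue_measure R).
Let p := normal_pdf 0 sigma.
Let q x : R := - (x / sigma ^+ 2) * p x.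

Let is_derive_congr (f g : R -> R) (x a b : R) :
  is_derive x 1 f a -> f =1 g -> a = b -> is_derive x 1 g b.
Proof. by move=> fa /funext <- <-. Qed.

Let is_derive_p (x : R) : is_derive x 1 p (q x).
Proof.
have sigma_neq0 : sigma != 0 by rewrite gt_eqF.
have pE : p = (fun x => normal_peak sigma * expR (- (2 * sigma ^+ 2)^-1 * (x * x))).
  apply/funext => y; rewrite /p normal_pdfE//; congr (_ * expR _).
  by field.
have h1 : is_derive x 1 (fun x : R => - (2 * sigma ^+ 2)^-1 * (x * x)) (- (x / sigma ^+ 2)).
  have := @is_deriveZ _ _ _ _ (- (2 * sigma ^+ 2)^-1) _ _ _ (is_deriveM (is_derive_id x (1 : R)) (is_derive_id x (1 : R))).
  move=> /is_derive_congr; apply => //; rewrite /GRing.scale/=; field.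
  exact: sigma_neq0.
have h2 := @is_derive1_comp R expR _ _ _ _ (is_derive_expR _) h1.
have := @is_deriveZ _ _ _ _ (normal_peak sigma) _ _ _ h2.
by move=> /is_derive_congr; apply => [y|]; rewrite /q pE /GRing.scale//=; ring.
Qed.

Let cp : continuous p.
Proof. by apply: continuous_normal_pdf; rewrite gt_eqF. Qed.

Let cid : continuous (fun x : R => x).
Proof. by move=> x; exact: cvg_id. Qed.

Let caff (s t : R) : continuous (fun x : R => s + t * x).
Proof.
move=> x; apply: continuousD; first exact: cst_continuous.
by apply: continuousM; [exact: cst_continuous|exact: cid].
Qed.

Let ccos s t : continuous (fun x : R => cos (s + t * x)).
Proof.
by move=> x; apply: continuous_comp; [exact: caff|exact: continuous_cos].
Qed.

Let csin s t : continuous (fun x : R => sin (s + t * x)).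
Proof.
by move=> x; apply: continuous_comp; [exact: caff|exact: continuous_sin].
Qed.

Let cont_int A (f : R -> R) : continuous f -> mu.-integrable `[- A, A] (EFin \o f).
Proof.
move=> cf; apply: continuous_compact_integrable; first exact: segment_compact.
exact: continuous_subspaceT.
Qed.

Lemma continuous_FTC2_Rintegral (F f : R -> R) (a b : R) : a < b ->
  (forall x : R, is_derive x 1 F (f x)) -> continuous f ->
  \int[mu]_(x in `[a, b]) f x = F b - F a.
Proof.
move=> ab Ff cf; rewrite /Rintegral (@continuous_FTC2 R f F a b ab)//.
- exact: continuous_subspaceT.
- have cF : continuous F.
    move=> x; apply: differentiable_continuous; apply/derivable1_diffP.
    exact: (@ex_derive _ _ _ _ _ _ _ (Ff x)).
  split; first by move=> x _; exact: (@ex_derive _ _ _ _ _ _ _ (Ff x)).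
  + by apply: cvg_at_right_filter; exact: cF.
  + by apply: cvg_at_left_filter; exact: cF.
- by move=> x _; rewrite derive1E; exact: (@derive_val _ _ _ _ _ _ _ (Ff x)).
Qed.

Let is_derive_aff (s t x : R) : is_derive x 1 (fun x : R => s + t * x) t.
Proof.
have := is_deriveD (is_derive_cst s x (1 : R)) (@is_deriveZ _ _ _ _ t _ _ _ (is_derive_id x (1 : R))).
by rewrite add0r /GRing.scale/= mulr1.
Qed.

Let is_derive_cos_aff (s t x : R) :
  is_derive x 1 (fun x : R => cos (s + t * x)) (- sin (s + t * x) * t).
Proof. exact: (@is_derive1_comp R cos _ _ _ _ (is_derive_cos _) (is_derive_aff s t x)). Qed.

Let is_derive_sin_aff (s t x : R) :
  is_derive x 1 (fun x : R => sin (s + t * x)) (cos (s + t * x) * t).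
Proof. exact: (@is_derive1_comp R sin _ _ _ _ (is_derive_sin _) (is_derive_aff s t x)). Qed.

(** Truncation keeps integration by parts and differentiation in [t] on a compact interval; the
    resulting boundary terms vanish as [A] grows. *)
Let phi s A t : R := \int[mu]_(x in `[- A, A]) (cos (s + t * x) * p x).

(* Integration by parts over [- A, A], using [p' = - x p / sigma^2]. *)
Let phi_ibp (s A t : R) : 0 < A ->
  \int[mu]_(x in `[- A, A]) (x * sin (s + t * x) * p x) =
  sigma ^+ 2 * (t * phi s A t - (sin (s + t * A) * p A - sin (s + t * - A) * p (- A))).
Proof.
move=> A0; have AA : - A < A by lra.
have s0 : sigma != 0 by rewrite gt_eqF.
have dF (x : R) : is_derive x 1 (fun x => sin (s + t * x) * p x)
    (t * (cos (s + t * x) * p x) - (sigma ^+ 2)^-1 * (x * sin (s + t * x) * p x)).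
  have := is_deriveM (is_derive_sin_aff s t x) (is_derive_p x).
  by move=> /is_derive_congr; apply => //; rewrite /GRing.scale/= /q; ring.
have c1 : continuous (fun x : R => cos (s + t * x) * p x).
  by move=> x; apply: continuousM; [exact: ccos|exact: cp].
have c2 : continuous (fun x : R => x * sin (s + t * x) * p x).
  by move=> x; apply: cvgM; [apply: cvgM; [exact: cvg_id|exact: csin]|exact: cp].
have c1t : continuous (fun x : R => t * (cos (s + t * x) * p x)).
  by move=> x; apply: cvgM; [exact: cvg_cst|exact: c1].
have c2t : continuous (fun x : R => (sigma ^+ 2)^-1 * (x * sin (s + t * x) * p x)).
  by move=> x; apply: cvgM; [exact: cvg_cst|exact: c2].
have := continuous_FTC2_Rintegral AA dF; rewrite RintegralB//; last 2 first.
- exact: cont_int.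
- exact: cont_int.
rewrite (@RintegralZl _ _ _ mu `[- A, A] (fun x => cos (s + t * x) * p x))//; last exact: cont_int.
rewrite (@RintegralZl _ _ _ mu `[- A, A] (fun x => x * sin (s + t * x) * p x))//; last exact: cont_int.
rewrite -/(phi s A t) => <-; first by field.
by move=> x; apply: cvgB; [exact: c1t|exact: c2t].
Qed.

(** Differentiation under the integral; on [-A, A] the derivative of the integrand is dominated by a
    constant, [A] times the peak of the density. *)
Let is_derive_phi (s A t : R) : 0 < A ->
  is_derive t 1 (phi s A) (- \int[mu]_(x in `[- A, A]) (x * sin (s + t * x) * p x)).
Proof.
move=> A0.
pose f (t x : R) := cos (s + t * x) * p x.
have df (u y : R) : is_derive u 1 (f ^~ y) (- (y * sin (s + u * y) * p y)).
  have h : is_derive u 1 (fun u : R => cos (s + u * y)) (- sin (s + u * y) * y).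
    by under eq_fun do rewrite mulrC; rewrite mulrC (mulrC u) mulrC; exact: is_derive_cos_aff.
  have := @is_deriveZ _ _ _ _ (p y) _ _ _ h.
  by move=> /is_derive_congr; apply => [v|]; rewrite /f /= /GRing.scale/=; ring.
have d1 u y : partial1of2 f u y = - (y * sin (s + u * y) * p y).
  by rewrite /partial1of2 derive1E; exact: (@derive_val _ _ _ _ _ _ _ (df u y)).
have intf u : mu.-integrable `[- A, A] (EFin \o f u).
  by apply: cont_int => x; apply: continuousM; [exact: ccos|exact: cp].
have tI : (t - 1 < t < t + 1) by apply/andP; split; lra.
have It : `]t - 1, t + 1[%classic t by rewrite /= in_itv.
have G0 : forall y : R, 0 <= (fun=> A * normal_peak sigma) y.
  by move=> y; rewrite mulr_ge0 ?normal_peak_ge0// ltW.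
have intG : mu.-integrable `[- A, A] (EFin \o (fun=> A * normal_peak sigma)).
  by apply: cont_int; exact: cst_continuous.
have Gub x y : `]t - 1, t + 1[%classic x -> `[- A, A]%classic y ->
    `|partial1of2 f x y| <= (fun=> A * normal_peak sigma) y.
  move=> _; rewrite /= in_itv/= -ler_norml => yA; rewrite d1 normrN !normrM.
  rewrite ler_pM// ?mulr_ge0//; last first.
    by rewrite ger0_norm ?normal_pdf_ge0// normal_pdf_ub// gt_eqF.
  by rewrite -[leRHS]mulr1 ler_pM// sin_max.
have mI : measurable (`[- A, A]%classic : set R) by exact: measurable_itv.
have dera (x y : R) : `]t - 1, t + 1[%classic x -> `[- A, A]%classic y -> derivable (f ^~ y) x 1.
  by move=> _ _; exact: (@ex_derive _ _ _ _ _ _ _ (df x y)).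
have D1 := @derivable_under_integral R _ _ mu f `[- A, A] mI t (t - 1) (t + 1) It
  (fun x _ => intf x) dera _ G0 intG Gub.
have D2 := @differentiation_under_integral R _ _ mu f `[- A, A] mI t (t - 1) (t + 1) It
  (fun x _ => intf x) dera _ G0 intG Gub.
apply: DeriveDef => //.
rewrite -derive1E [LHS]D2.
under eq_Rintegral do rewrite d1.
have cx : continuous (fun x : R => x * sin (s + t * x) * p x).
  by move=> x; apply: cvgM; [apply: cvgM; [exact: cvg_id|exact: csin]|exact: cp].
rewrite -[RHS]mulN1r -RintegralZl//; last exact: cont_int.
by apply: eq_Rintegral => x _; rewrite mulN1r.
Qed.

(** Integrating factor of the equation [phi' = - sigma^2 t phi] that the characteristic function
    satisfies up to boundary terms. *)
Let e t : R := expR (sigma ^+ 2 * t ^+ 2 / 2).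

Let is_derive_e (t : R) : is_derive t 1 e (sigma ^+ 2 * t * e t).
Proof.
have h1 : is_derive t 1 (fun x : R => sigma ^+ 2 / 2 * (x * x)) (sigma ^+ 2 * t).
  have := @is_deriveZ _ _ _ _ (sigma ^+ 2 / 2) _ _ _ (is_deriveM (is_derive_id t (1 : R)) (is_derive_id t (1 : R))).
  by move=> /is_derive_congr; apply => //; rewrite /GRing.scale/=; field.
have := @is_derive1_comp R expR _ _ _ _ (is_derive_expR _) h1.
move=> /is_derive_congr; apply => [x|]; rewrite /e/=; first by congr expR; ring.
by rewrite mulrC; congr (_ * expR _); ring.
Qed.

(** After integration by parts the derivative of [phi * e] consists of the boundary terms alone, so
    the product moves little between 0 and [t]. *)
Let phi_bound (s A t : R) : 0 < A ->
  `|phi s A t * e t - phi s A 0| <= sigma ^+ 2 * (p A + p (- A)) * e t * `|t|.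
Proof.
move=> A0.
have -> : phi s A 0 = phi s A 0 * e 0 by rewrite /e expr0n/= mulr0 mul0r expR0 mulr1.
rewrite -[X in `|X|]subr0.
have := @mvt_bound R (fun t => phi s A t * e t)
   (fun t => sigma ^+ 2 * (sin (s + t * A) * p A - sin (s + t * - A) * p (- A)) * e t)
   (sigma ^+ 2 * (p A + p (- A)) * e t) t 0.
rewrite !subr0; apply.
  move=> u; have := is_deriveM (is_derive_phi s u A0) (is_derive_e u).
  by move=> /is_derive_congr; apply => //; rewrite /GRing.scale/= phi_ibp//; ring.
move=> u ut; have p0 x : 0 <= p x by exact: normal_pdf_ge0.
rewrite normrM (ger0_norm (expR_ge0 _)) ler_pM ?expR_ge0//.
  rewrite normrM ger0_norm ?sqr_ge0// ler_wpM2l ?sqr_ge0// (le_trans (ler_normB _ _))//.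
  by rewrite lerD// normrM (ger0_norm (p0 _)) ler_piMl// sin_max.
rewrite ler_expR ler_wpM2r// ler_wpM2l ?sqr_ge0//.
rewrite -[leLHS]real_normK ?num_real// -[leRHS]real_normK ?num_real//.
rewrite lerXn2r ?nnegrE//; move: ut.
have [t0|t0] := leP t 0.
  by move=> /andP[xz z0]; rewrite !ler0_norm// lerN2.
by move=> /andP[z0 zx]; rewrite !ger0_norm// ltW.
Qed.

Lemma Rintegral_normal_prob (f : R -> R) : bmeas f ->
  \int[normal_prob 0 sigma]_x f x = \int[mu]_x (f x * p x).
Proof.
have ip := integrable_normal_pdf 0 sigma.
have intfp g : bmeas g -> mu.-integrable setT (fun x => (g x * p x)%:E).
  move=> [mg [M gM]].
  have := integrableMr (h := g) (measurableT) _ _ ip.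
  apply => //; exists M; split; first exact: num_real.
  by move=> x Mx y _; exact: le_trans (gM y) (ltW Mx).
apply: (blinear_ext (L := fun f => \int[normal_prob 0 sigma]_x f x)
   (L' := fun f => \int[mu]_x (f x * p x))).
- exact: blinear_Rintegral (prob_lty _).
- split.
  + move=> g h hg hh; rewrite -RintegralD//; try exact: intfp.
    by apply: eq_Rintegral => x _; rewrite mulrDl.
  + move=> c g hg; rewrite -RintegralZl//; last exact: intfp.
    by apply: eq_Rintegral => x _; rewrite mulrA.
  + exists 1 => g M hg gM; rewrite mul1r.
    rewrite (le_trans (le_normr_Rintegral _ _))//; first exact: intfp.
    have -> : M = \int[mu]_x (M * p x).
      by rewrite RintegralZl// /Rintegral integral_normal_pdf mulr1.
    apply: le_Rintegral => //.
    * have := intfp _ (bmeas_norm hg); apply: eq_integrable => // x _ /=.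
      by rewrite normrM (ger0_norm (normal_pdf_ge0 _ _ _)).
    * exact: (intfp (fun=> M) (bmeas_cst _ M)).
    * by move=> x _; rewrite normrM (ger0_norm (normal_pdf_ge0 _ _ _)) ler_wpM2r// normal_pdf_ge0.
- move=> A mA; rewrite Rintegral_indic// /normal_prob.
  rewrite /Rintegral; congr fine; rewrite [LHS]integral_mkcond; apply: eq_integral => x _.
  by rewrite patchE indicE; case: ifP => _; rewrite ?mul1r ?mul0r.
Qed.

Let I n : set R := `[- n.+1%:R, n.+1%:R].

Let mI n : measurable (I n).
Proof. exact: measurable_itv. Qed.

Let Rintegral_I (f : R -> R) n : bmeas f ->
  \int[mu]_(x in I n) (f x * p x) = \int[normal_prob 0 sigma]_x (f x * \1_(I n) x).
Proof.
move=> hf; rewrite Rintegral_normal_prob; last first.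
  by apply: bmeasM => //; exact: bmeas_indic.
rewrite Rintegral_mkcond; apply: eq_Rintegral => x _.
by rewrite patchE indicE; case: ifP => _; rewrite ?mulr1 ?mulr0 ?mul0r.
Qed.

Let Rintegral_I_cvg (f : R -> R) : bmeas f ->
  \int[mu]_(x in I n) (f x * p x) @[n --> \oo] --> \int[normal_prob 0 sigma]_x f x.
Proof.
move=> hf; have [_ [M fM]] := hf.
have M0 : 0 <= M by rewrite (le_trans _ (fM 0)).
apply/cvgrPdist_le => eps eps0.
have M10 : 0 < M + 1 by rewrite ltr_wpDl.
have e1 : 0 < eps / (M + 1) by rewrite divr_gt0.
have /cvgrPdist_le /(_ _ e1) := prob_segment_cvg (normal_prob 0 sigma).
apply: filterS => n; set a := fine _ => ha.
rewrite Rintegral_I//.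
have hI := bmeas_indic R (mI n).
have : `|\int[normal_prob 0 sigma]_x f x - \int[normal_prob 0 sigma]_x (f x * \1_(I n) x)| <=
   \int[normal_prob 0 sigma]_x (M * (1 - \1_(I n) x)).
  apply: le_dist_Rintegral_prob => //.
  - exact: bmeasM.
  - by apply/bmeasZ/bmeasB => //; exact: bmeas_cst.
  move=> x; have -> : f x - f x * \1_(I n) x = f x * (1 - \1_(I n) x) by ring.
  have i1 : 0 <= 1 - \1_(I n) x :> R.
    by rewrite indicE subr_ge0 lern1 leq_b1.
  by rewrite normrM (ger0_norm i1) ler_wpM2r.
rewrite RintegralZ_bmeas; [|exact: prob_lty|by apply: bmeasB => //; exact: bmeas_cst].
rewrite RintegralB_bmeas; [|exact: prob_lty|exact: bmeas_cst|exact: hI].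
have -> : \int[normal_prob 0 sigma]_x (1 : R) = 1 by exact: Rintegral_cst_prob.
have -> : \int[normal_prob 0 sigma]_x \1_(I n) x = a.
  by rewrite (Rintegral_indic (normal_prob 0 sigma))//; exact: mI.
move=> /le_trans; apply.
apply: (@le_trans _ _ (M * (eps / (M + 1)))).
  by rewrite ler_wpM2l// (le_trans (ler_norm _)).
rewrite mulrCA ler_piMr ?(ltW eps0)// ler_pdivrMr// mul1r lerDl//.
Qed.

Lemma normal_prob_cos s t :
  \int[normal_prob 0 sigma]_x cos (s + t * x) = cos s * expR (- (sigma ^+ 2 * t ^+ 2 / 2)).
Proof.
have bc u : bmeas (fun x : R => cos (s + u * x)) by apply: bmeas_cos; exact: measurable_affine.
have c1 : phi s n.+1%:R t @[n --> \oo] --> \int[normal_prob 0 sigma]_x cos (s + t * x).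
  exact: Rintegral_I_cvg.
have c0 : phi s n.+1%:R 0 @[n --> \oo] --> cos s.
  have := Rintegral_I_cvg (bc 0).
  have -> : \int[normal_prob 0 sigma]_x cos (s + 0 * x) = cos s.
    by under eq_Rintegral do rewrite mul0r addr0; rewrite Rintegral_cst_prob.
  exact.
(* With [y = (n+1)^2 / (2 sigma^2)], which is at least [(n+1) / (2 sigma^2)], the inequality
   [e^(-y) <= 1 / y] compares the density with the harmonic sequence. *)
have cpn : p n.+1%:R @[n --> \oo] --> (0 : R).
  have h : normal_peak sigma * (2 * sigma ^+ 2) * n.+1%:R^-1 @[n --> \oo] --> (0 : R).
    rewrite -[X in _ --> X](mulr0 (normal_peak sigma * (2 * sigma ^+ 2))).
    by apply: cvgM; [exact: cvg_cst|exact: cvg_harmonic].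
  apply: (squeeze_cvgr _ (cvg_cst 0) h); apply: nearW => n.
  rewrite normal_pdf_ge0/= /p normal_pdfE ?gt_eqF// -mulrA ler_wpM2l ?normal_peak_ge0//.
  rewrite /normal_fun subr0 mulNr expRN; set y := n.+1%:R ^+ 2 / _.
  have s2 : 0 < 2 * sigma ^+ 2 by rewrite mulr_gt0// exprn_gt0.
  have yn : (2 * sigma ^+ 2)^-1 * n.+1%:R <= y.
    rewrite /y mulrC (_ : sigma ^+ 2 *+ 2 = 2 * sigma ^+ 2); last by rewrite mulr_natl.
    rewrite ler_pM2r ?invr_gt0// expr2 -[leLHS]mul1r ler_pM2r ?ltr0n// ler1n//.
  have y0 : 0 < (2 * sigma ^+ 2)^-1 * n.+1%:R by rewrite mulr_gt0 ?invr_gt0// ltr0n.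
  rewrite (_ : _ * _^-1 = ((2 * sigma ^+ 2)^-1 * n.+1%:R)^-1); last by rewrite invfM invrK.
  rewrite lef_pV2 ?posrE ?expR_gt0// (le_trans yn)//.
  by have := expR_ge1Dx y; lra.
have pN x : p (- x) = p x.
  by rewrite /p !normal_pdfE ?gt_eqF// /normal_fun !subr0 sqrrN.
set v := \int[_]_x _ in c1 *.
(* Both sides of [phi_bound] pass to the limit, where the right one is 0. *)
have ve : v * e t = cos s.
  apply/eqP; rewrite -subr_eq0 -normr_eq0 eq_le normr_ge0 andbT.
  have L : `|phi s n.+1%:R t * e t - phi s n.+1%:R 0| @[n --> \oo] --> `|v * e t - cos s|.
    by apply: cvg_norm; apply: cvgB => //; apply: cvgM => //; exact: cvg_cst.
  have U : sigma ^+ 2 * (p n.+1%:R + p n.+1%:R) * e t * `|t| @[n --> \oo] --> (0 : R).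
    rewrite [X in _ --> X](_ : 0 = sigma ^+ 2 * (0 + 0) * e t * `|t|); last by ring.
    apply: cvgM; last exact: cvg_cst.
    apply: cvgM; last exact: cvg_cst.
    by apply: cvgM; [exact: cvg_cst|exact: cvgD].
  apply: (ler_cvg_to L U); apply: nearW => n.
  have := @phi_bound s n.+1%:R t; rewrite pN; apply; exact: ltr0Sn.
by rewrite -ve expRN -/(e t) mulfK// gt_eqF// expR_gt0.
Qed.

End gaussian_characteristic_function.

Section gaussian_limit.
Context (R : realType).

Lemma probability_tight (mu : probability (measurableTypeR R) R) (e : R) : 0 < e ->
  exists2 A : R, 0 < A & \int[mu]_x (\1_[set x : R | A < `|x|] x) <= e.
Proof.
move=> e0; pose I n : set (measurableTypeR R) := `[- n.+1%:R, n.+1%:R]%classic.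
have mI n : measurable (I n) by exact: measurable_itv.
have /cvgrPdist_le /(_ _ e0) [n _ /(_ n (leqnn n)) /= he] := prob_segment_cvg mu.
exists n.+1%:R => //.
have hI := bmeas_indic R (mI n).
have -> : \int[mu]_x (\1_[set x : R | n.+1%:R < `|x|] x) = \int[mu]_x (1 - \1_(I n) x).
  apply: eq_Rintegral => x _; rewrite !indicE /I.
  have -> : (x \in [set x : R | n.+1%:R < `|x|]) = ~~ (x \in `[- n.+1%:R, n.+1%:R]%classic).
    by apply/idP/idP; rewrite notin_setE inE/= in_itv/= -ler_norml; [rewrite ltNge => /negP|move/negP; rewrite -ltNge].
  by case: (_ \in _); rewrite ?subrr ?subr0.
rewrite (RintegralB_bmeas (prob_lty mu) (bmeas_cst _ 1) hI) Rintegral_cst_prob.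
have -> : \int[mu]_x \1_(I n) x = fine (mu (I n)) by rewrite Rintegral_indic.
exact: le_trans (ler_norm _) he.
Qed.

(** A zero variance is treated apart because the limit is then a Dirac mass; its characteristic
    function obeys the same formula with exponent 0. *)
Lemma cvg_in_law_gaussian (dS : nat -> measure_display) (S : forall N, measurableType (dS N))
    (Q : forall N, probability (S N) R) (Z : forall N, S N -> R) (v : R) :
  0 <= v -> (forall N, measurable_fun setT (@Z N)) ->
  (forall s t : R, (fun N => \int[Q N]_w cos (s + t * Z N w)) @ \oo -->
     cos s * expR (- (v * t ^+ 2 / 2))) ->
  (forall e : R, 0 < e -> exists2 A : R, 0 < A &
    \forall N \near \oo, \int[Q N]_w (\1_[set x : R | A < `|x|] (Z N w)) <= e) ->
  cvg_in_law Q Z (centered_gaussian v).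
Proof.
move=> v0 mZ cZ tZ; rewrite /centered_gaussian; case: eqVneq => [vE|vn0].
  pose mu : probability (measurableTypeR R) R := \d_(0 : measurableTypeR R).
  apply: (@cvg_in_law_cos R dS S Q Z mu mZ _ tZ (@probability_tight mu)) => s t.
  have -> : \int[mu]_x cos (s + t * x) = cos s * expR (- (v * t ^+ 2 / 2)).
    rewrite vE mul0r mul0r oppr0 expR0 mulr1 /Rintegral integral_dirac//=.
      by rewrite indicE in_setT mul1r mulr0 addr0.
    by apply/measurable_EFinP; exact: (bmeas_cos (measurable_affine s t)).1.
  exact: cZ.
have v_gt0 : 0 < v by rewrite lt_neqAle eq_sym vn0.
have s0 : 0 < Num.sqrt v by rewrite sqrtr_gt0.
apply: (@cvg_in_law_cos R dS S Q Z (normal_prob 0 (Num.sqrt v)) mZ _ tZ (@probability_tight _)) => s t.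
by rewrite normal_prob_cos// sqr_sqrtr.
Qed.

End gaussian_limit.

(** * The Feynman-Kac semigroup *)

Section kernel_operator.
Context (R : realType) d d' (T : measurableType d) (T' : measurableType d').
Context (L : R.-pker T ~> T').

Definition kernel_op (f : T' -> R) (x : T) : R := \int[L x]_y f y.

Let Lfin x : (L x setT < +oo)%E.
Proof. by rewrite prob_kernel ltry. Qed.

Lemma pker_fin_num x A : measurable A -> L x A \is a fin_num.
Proof.
by move=> mA; rewrite ge0_fin_numE// (le_lt_trans _ (Lfin x))// le_measure ?inE.
Qed.

Lemma pker_setC x A : measurable A -> L x (~` A) = (1 - L x A)%E.
Proof.
move=> mA; rewrite -setTD -[X in (X - _)%E](prob_kernel (s := L) x).
by have := measureD measurableT mA (Lfin x); rewrite setTI.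
Qed.

Lemma mean_fun_kernel_op x : mean_fun (kernel_op ^~ x).
Proof.
split.
- exact: RintegralD_bmeas.
- exact: RintegralZ_bmeas.
- by move=> f _ f0; exact: Rintegral_ge0.
- by rewrite /kernel_op Rintegral_cst// prob_kernel mulr1.
Qed.

Lemma bmeas_kernel_op f : bmeas f -> bmeas (kernel_op f).
Proof.
move=> hf; have [mf [M fM]] := hf; split; last first.
  by exists M => x; exact: (mean_fun_norm (mean_fun_kernel_op x)).
(* Adding [M] makes the integrand nonnegative, the case in which measurability in the starting point
   is available. *)
have -> : kernel_op f = (fun x => kernel_op (fun y => f y + M) x - M).
  apply/funext => x; have hx := mean_fun_kernel_op x.
  by rewrite (mean_funD hx hf (bmeas_cst _ M)) (mean_fun_cst hx) addrK.
apply: measurable_funB; last exact: measurable_cst.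
apply: (@measurableT_comp _ _ _ _ _ _ (@fine R)) => //.
apply: measurable_fun_integral_kernel.
- by move=> U mU; exact: measurable_kernel.
- by move=> y; rewrite lee_fin; have := fM y; rewrite ler_norml => /andP[? ?]; lra.
- by apply/measurable_EFinP; apply: measurable_funD => //; exact: measurable_cst.
Qed.

Lemma kernel_op_indic A x : measurable A -> kernel_op (\1_A) x = fine (L x A).
Proof. exact: Rintegral_indic. Qed.

End kernel_operator.

Section path_functions.
Context (d : nat -> measure_display) (E : forall n, measurableType (d n)).
Context (R : realType).
Local Notation F := (path_space E).

Lemma last_pt_history (Omega : Type) (X : forall n, Omega -> E n) n w :
  last_pt (history X n w) = X n w.
Proof. by case: n. Qed.

Lemma measurable_history dO (Omega : measurableType dO) (X : forall n, Omega -> E n) n :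
  (forall n, measurable_fun setT (X n)) -> measurable_fun setT (history X n).
Proof.
move=> mX; elim: n => [|n IH] /=; first exact: mX.
exact: (measurable_fun_pair IH (mX n.+1)).
Qed.

Lemma along_last (A : nmodType) (h : forall p, F p -> A) n (y : F n) : along h y n = h n y.
Proof. by case: n y => [|n] y //=; rewrite eqxx. Qed.

Lemma along_pair (A : nmodType) (h : forall p, F p -> A) n (y : F n) (x : E n.+1) p :
  (p <= n)%N -> along h ((y, x) : F n.+1) p = along h y p.
Proof. by move=> pn; rewrite /= ltn_eqF. Qed.

Lemma bmeas_along (h : forall p, F p -> R) n p :
  (forall q, (1 <= q)%N -> bmeas (h q)) -> (1 <= p)%N ->
  bmeas (fun y : F n => along h y p).
Proof.
move=> bh p1; elim: n => [|n IH].
  by rewrite /= gtn_eqF//; exact: bmeas_cst.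
have [e|pn] := eqVneq p n.+1.
  rewrite (_ : (fun y => _) = @h n.+1); first exact: bh.
  by apply/funext => y; rewrite e along_last.
rewrite (_ : (fun y => _) = fun y : F n.+1 => along h y.1 p).
  exact: (bmeas_comp measurable_fst IH).
by apply/funext => y; rewrite /= (negbTE pn).
Qed.

Definition prod_along (h : forall p, F p -> R) n (y : F n) : R :=
  \prod_(1 <= p < n) along h y p.

Lemma bmeas_prod_along (h : forall p, F p -> R) n :
  (forall q, (1 <= q)%N -> bmeas (h q)) -> bmeas (@prod_along h n).
Proof. by move=> bh; apply: bmeas_prod_nat => p p1; exact: bmeas_along. Qed.

Lemma prod_along_history (h : forall p, F p -> R) (Omega : Type)
    (X : forall n, Omega -> E n) n w :
  prod_along h (history X n w) = \prod_(1 <= k < n) h k (history X k w).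
Proof.
rewrite /prod_along big_nat_cond [RHS]big_nat_cond.
by apply: eq_bigr => i /andP[/andP[_ ni] _]; rewrite along_history// ltnW.
Qed.

Lemma prod_along_pair (h : forall p, F p -> R) n (y : F n) (x : E n.+1) : (1 <= n)%N ->
  prod_along h ((y, x) : F n.+1) = prod_along h y * h n y.
Proof.
move=> n1; rewrite /prod_along big_nat_recr// along_pair// along_last; congr (_ * _).
rewrite big_nat_cond [RHS]big_nat_cond.
by apply: eq_bigr => i /andP[/andP[_ ni] _]; rewrite along_pair// ltnW.
Qed.

Lemma prod_along_inv (h : forall p, F p -> R) n (y : F n) :
  (forall p, (1 <= p)%N -> forall y, h p y != 0) ->
  prod_along h y * prod_along (inv_pot h) y = 1.
Proof.
move=> h0; elim: n y => [|n IH]; first by move=> y; rewrite /prod_along !big_geq// mulr1.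
case: n IH => [_ y|n IH [y x]]; first by rewrite /prod_along !big_geq// mulr1.
rewrite !prod_along_pair// mulrACA IH mul1r /inv_pot mulfV//.
exact: h0.
Qed.

(** A bound [U] on all quotients pins the values between [G(y0) / U] and [U G(y0)] for any base
    point [y0]; equal arguments show that [U] is at least 1. *)
Lemma potential_bounds (G : forall n, F n -> R) n : potentials G -> (1 <= n)%N ->
  exists2 c, 0 < c & exists C, forall y, c <= G n y <= C.
Proof.
move=> hG n1; have [mG G0 [U hU]] := hG n n1.
pose y0 : F n := point.
have U0 : 0 < U.
  rewrite (@lt_le_trans _ _ 1)//; apply: hU; exists y0, y0.
  by rewrite divff// gt_eqF.
exists (G n y0 / U); first by rewrite divr_gt0.
exists (U * G n y0) => y; apply/andP; split.
  rewrite ler_pdivrMr// mulrC -ler_pdivrMr//.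
  by apply: hU; exists y0, y.
by rewrite -ler_pdivrMr//; apply: hU; exists y, y0.
Qed.

Lemma potential_lbound (G : forall n, F n -> R) n : potentials G -> (1 <= n)%N ->
  exists2 c, 0 < c & forall y, c <= G n y.
Proof.
move=> hG n1; have [c c0 [C hC]] := potential_bounds hG n1.
by exists c => // y; have /andP[] := hC y.
Qed.

Lemma potentials_inv_pot (G : forall n, F n -> R) : potentials G -> potentials (inv_pot G).
Proof.
move=> hG n n1; have [mG G0 [U hU]] := hG n n1; split.
- by apply: measurable_funV => // y; exact: ltW.
- by move=> y; rewrite invr_gt0.
- by exists U => _ [y [y' ->]]; apply: hU; exists y', y; rewrite /inv_pot invrK mulrC.
Qed.

Lemma bmeas_potential (G : forall n, F n -> R) n : potentials G -> (1 <= n)%N ->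
  bmeas (G n).
Proof.
move=> hG n1; have [mG G0 _] := hG n n1; split => //.
have [c c0 [C hC]] := potential_bounds hG n1.
by exists C => y; rewrite gtr0_norm//; have /andP[] := hC y.
Qed.

End path_functions.

Section feynman_kac_recursion.
Context (d : nat -> measure_display) (E : forall n, measurableType (d n)).
Context (R : realType) (K : forall n, R.-pker (E n) ~> (E n.+1)) (x0 : E 0%N).
Context (dO : measure_display) (Omega : measurableType dO).
Context (P : probability Omega R) (X : forall n, Omega -> E n).
Local Notation F := (path_space E).
Hypothesis hX : markov_chain K x0 P X.

Definition step n : (F n.+1 -> R) -> F n -> R := kernel_op (hist_pker K n).

Lemma stepE n (f : F n.+1 -> R) y : bmeas f ->
  step f y = \int[K n (last_pt y)]_x f (y, x).
Proof.
have Kfin : (K n (last_pt y) setT < +oo)%E by rewrite prob_kernel ltry.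
have mpair : measurable_fun setT (pair y : E n.+1 -> F n.+1).
  exact: measurable_pair1.
have bp g : bmeas g -> bmeas (fun x => g ((y, x) : F n.+1)) by exact: bmeas_comp.
apply: (blinear_ext (L := fun f => step f y) (L' := fun f => \int[K n (last_pt y)]_x f (y, x))).
- exact: blinear_mean_fun (mean_fun_kernel_op _ _).
- split.
  + by move=> g h hg hh; rewrite RintegralD_bmeas//; exact: bp.
  + by move=> c g hg; rewrite RintegralZ_bmeas//; exact: bp.
  + have [_ _ [C hC]] := blinear_Rintegral Kfin.
    by exists C => g M hg gM; apply: hC => //; exact: bp.
- move=> A mA; rewrite /step kernel_op_indic//.
  rewrite (_ : (fun x => \1_A (y, x)) = \1_(pair y @^-1` A)) ?Rintegral_indic//.
  by rewrite -[X in measurable X]setTI; exact: mpair.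
Qed.

Let mhist n : measurable_fun setT (history X n).
Proof. by apply: measurable_history; case: hX. Qed.

(** [markov_chain] speaks of rectangles only. They are stable under intersection and generate the
    product sigma-algebra, so Dynkin's theorem extends the identity to all events. *)
Let markov_hist_set n (C : set (F n.+1)) : measurable C ->
  P (history X n.+1 @^-1` C) = (\int[P]_w hist_pker K n (history X n w) C)%E.
Proof.
have [mX _ mk] := hX.
have mker C' : measurable C' -> measurable_fun setT (fun w => hist_pker K n (history X n w) C').
  move=> mC'; apply: (@measurableT_comp _ _ _ _ _ _ (fun y => hist_pker K n y C') _ (history X n)).
    exact: measurable_kernel.
  exact: mhist.
have Lfin y : (hist_pker K n y setT < +oo)%E by rewrite prob_kernel ltry.
have mpre C' : measurable C' -> measurable (history X n.+1 @^-1` C').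
  by move=> mC'; rewrite -[X in measurable X]setTI; exact: mhist.
have gen : measurable = <<s [set A `*` B | A in @measurable _ (F n) & B in @measurable _ (E n.+1)] >>.
  exact: measurable_prod_measurableType.
move=> mC; have mC' : <<s [set A `*` B | A in @measurable _ (F n) & B in @measurable _ (E n.+1)] >> C.
  by rewrite -gen.
pose same C := P (history X n.+1 @^-1` C) = (\int[P]_w hist_pker K n (history X n w) C)%E.
apply: (@dynkin_induction _ (F n.+1) _ same gen _ _ _ _ _ C mC'); rewrite /same {C mC mC'}.
- move=> _ _ [A mA [B mB <-]] [A' mA' [B' mB' <-]].
  exists (A `&` A'); first exact: measurableI.
  exists (B `&` B'); first exact: measurableI.
  by rewrite setXI.
- rewrite preimage_setT; under eq_integral do rewrite prob_kernel.
  by rewrite integral_cst// mul1e.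
- move=> _ [A mA [B mB <-]].
  transitivity (P (history X n @^-1` A `&` X n.+1 @^-1` B)); first by [].
  rewrite mk// integral_mkcond; apply: eq_integral => w _.
  rewrite patchE /hist_pker /hist_kernel/= /hist_law /pushforward last_pt_history.
  case: ifPn => [|]; rewrite ?notin_setE ?inE/= => Aw.
    congr (K n _ _); apply/seteqP; split => x //=.
    by case.
  rewrite (_ : _ @^-1` _ = set0) ?measure0//.
  by apply/seteqP; split => x //= -[].
- move=> C mC hC.
  have bk C' : measurable C' -> bmeas (fun w => fine (hist_pker K n (history X n w) C')).
    move=> mC'; rewrite (_ : (fun _ => _) = fun w => kernel_op (hist_pker K n) (\1_C') (history X n w)).
      exact: (bmeas_comp (@mhist n) (bmeas_kernel_op (hist_pker K n) (bmeas_indic R mC'))).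
    by apply/funext => w; rewrite kernel_op_indic.
  (* The complement case needs a subtraction, hence the passage to real-valued integrals. *)
  have kE C' : measurable C' -> (\int[P]_w hist_pker K n (history X n w) C')%E =
      (\int[P]_w fine (hist_pker K n (history X n w) C'))%:E.
    move=> mC'; rewrite /Rintegral fineK.
      apply: eq_integral => w _; rewrite fineK//; exact: pker_fin_num.
    exact: integrable_fin_num (bmeas_integrable (prob_lty P) (bk _ mC')).
  rewrite preimage_setC probability_setC; last exact: mpre.
  rewrite [X in (1 - X)%E]hC !kE//; last exact: measurableC.
  rewrite -EFinB; congr EFin; rewrite -[X in X - _](Rintegral_cst_prob P).
  rewrite -(RintegralB_bmeas (prob_lty P)); [|exact: bmeas_cst|exact: bk].
  apply: eq_Rintegral => w _; rewrite pker_setC// fineB//.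
  exact: pker_fin_num.
- move=> C mC tC hC.
  have tpre : trivIset setT (fun k => history X n.+1 @^-1` C k).
    apply/trivIsetP => i k _ _ ik; rewrite -preimage_setI.
    by move/trivIsetP : tC => /(_ _ _ _ _ ik) ->//; rewrite preimage_set0.
  rewrite preimage_bigcup measure_semi_bigcup//; last 2 first.
  + by move=> k; exact: mpre.
  + by apply: bigcup_measurable => k _; exact: mpre.
  transitivity (\int[P]_w (\sum_(0 <= k <oo) hist_pker K n (history X n w) (C k)))%E.
    rewrite integral_nneseries//; last by move=> k; exact: mker.
    by apply: eq_eseriesr => k _; exact: hC.
  apply: eq_integral => w _; rewrite measure_semi_bigcup//.
  exact: bigcup_measurable.
Qed.

Lemma markov_hist n (f : F n.+1 -> R) : bmeas f ->
  \int[P]_w f (history X n.+1 w) = \int[P]_w step f (history X n w).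
Proof.
have bstep g : bmeas g -> bmeas (@step n g) by exact: bmeas_kernel_op.
apply: (blinear_ext (L := fun f => \int[P]_w f (history X n.+1 w))
  (L' := fun f => \int[P]_w step f (history X n w))).
- split.
  + by move=> g h hg hh; rewrite (RintegralD_bmeas (prob_lty P))//; exact: bmeas_comp.
  + by move=> c g hg; rewrite (RintegralZ_bmeas (prob_lty P))//; exact: bmeas_comp.
  + by exists 1 => g M hg gM; rewrite mul1r; apply: le_norm_Rintegral_prob => //; exact: bmeas_comp.
- split.
  + move=> g h hg hh; rewrite -(RintegralD_bmeas (prob_lty P)); last 2 first.
    * by apply: bmeas_comp => //; exact: bstep.
    * by apply: bmeas_comp => //; exact: bstep.
    by apply: eq_Rintegral => w _; rewrite /step (mean_funD (mean_fun_kernel_op _ _)).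
  + move=> c g hg; rewrite -(RintegralZ_bmeas (prob_lty P)); last first.
      by apply: bmeas_comp => //; exact: bstep.
    by apply: eq_Rintegral => w _; rewrite /step (mean_funZ (mean_fun_kernel_op _ _)).
  + exists 1 => g M hg gM; rewrite mul1r; apply: le_norm_Rintegral_prob.
      by apply: bmeas_comp => //; exact: bstep.
    by move=> w; exact: (mean_fun_norm (mean_fun_kernel_op _ _)).
- move=> C mC.
  transitivity (\int[P]_w (\1_(history X n.+1 @^-1` C) w)); first by [].
  rewrite Rintegral_indic; last by rewrite -[X in measurable X]setTI; exact: mhist.
  rewrite [X in fine X]markov_hist_set//.
  rewrite /Rintegral; congr fine; apply: eq_integral => w _.
  by rewrite /step kernel_op_indic// fineK//; exact: pker_fin_num.
Qed.

(** A function of the path up to [n] is constant for the transition out of that path, so it passes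
    through [step]. *)
Lemma markov_hist_weight n (f : F n.+1 -> R) (g : F n -> R) : bmeas f -> bmeas g ->
  \int[P]_w (f (history X n.+1 w) * g (history X n w)) =
  \int[P]_w (step f (history X n w) * g (history X n w)).
Proof.
move=> hf hg; have hgf : bmeas (fun z : F n.+1 => f z * g z.1).
  by apply: bmeasM => //; exact: (bmeas_comp measurable_fst hg).
rewrite (markov_hist hgf); apply: eq_Rintegral => w _.
rewrite !stepE// mulrC -RintegralZ_bmeas.
- by apply: eq_Rintegral => x _; rewrite mulrC.
- by rewrite prob_kernel ltry.
- exact: (bmeas_comp (measurable_pair1 _) hf).
Qed.

Context (G : forall n, F n -> R) (hG : forall n, (1 <= n)%N -> bmeas (G n)).

Lemma gammaE n (f : F n -> R) :
  gamma P X G f = \int[P]_w (f (history X n w) * prod_along G (history X n w)).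
Proof. by rewrite /gamma; apply: eq_Rintegral => w _; rewrite prod_along_history. Qed.

Lemma gamma1 (f : F 1%N -> R) : gamma P X G f = \int[P]_w f (history X 1 w).
Proof. by rewrite /gamma; apply: eq_Rintegral => w _; rewrite big_geq// mulr1. Qed.

Definition Qop n (f : F n.+1 -> R) (y : F n) : R := G y * step f y.

Lemma bmeas_Qop n (f : F n.+1 -> R) : (1 <= n)%N -> bmeas f -> bmeas (Qop f).
Proof. by move=> n1 hf; apply: bmeasM; [exact: hG|exact: bmeas_kernel_op]. Qed.

Lemma gammaS n (f : F n.+1 -> R) : (1 <= n)%N -> bmeas f ->
  gamma P X G f = gamma P X G (Qop f).
Proof.
move=> n1 hf; rewrite !gammaE.
transitivity (\int[P]_w (f (history X n.+1 w) *
  (fun y => prod_along G y * G y) (history X n w))).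
  apply: eq_Rintegral => w _; congr (_ * _).
  exact: (prod_along_pair G (history X n w) (X n.+1 w) n1).
rewrite (@markov_hist_weight n f (fun y => prod_along G y * G y))//; last by apply: bmeasM; [exact: bmeas_prod_along|exact: hG].
by apply: eq_Rintegral => w _; rewrite /Qop; ring.
Qed.

Lemma gammaD n (f g : F n -> R) : bmeas f -> bmeas g ->
  gamma P X G (fun y => f y + g y) = gamma P X G f + gamma P X G g.
Proof.
move=> hf hg; have hp := bmeas_prod_along n hG.
rewrite !gammaE -(RintegralD_bmeas (prob_lty P)).
- by apply: eq_Rintegral => w _; rewrite mulrDl.
- exact: (bmeas_comp (@mhist n) (bmeasM hf hp)).
- exact: (bmeas_comp (@mhist n) (bmeasM hg hp)).
Qed.

Lemma gammaZ n c (f : F n -> R) : bmeas f ->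
  gamma P X G (fun y => c * f y) = c * gamma P X G f.
Proof.
move=> hf; have hp := bmeas_prod_along n hG.
rewrite !gammaE -(RintegralZ_bmeas (prob_lty P)).
- by apply: eq_Rintegral => w _; rewrite mulrA.
- exact: (bmeas_comp (@mhist n) (bmeasM hf hp)).
Qed.

Hypothesis G0 : forall n, (1 <= n)%N -> exists2 c, 0 < c & forall y, c <= @G n y.

Lemma prod_along_gt0 n : exists2 c, 0 < c & forall y, c <= @prod_along _ _ _ G n y.
Proof.
elim: n => [|n [c c0 hc]]; first by exists 1 => // y; rewrite /prod_along big_geq.
case: n c c0 hc => [|n] c c0 hc; first by exists 1 => // y; rewrite /prod_along big_geq.
have [c' c'0 hc'] := G0 (ltn0Sn n).
exists (c * c') => [|[y x]]; first exact: mulr_gt0.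
by rewrite prod_along_pair// ler_pM// ltW.
Qed.

Lemma gamma_ge0 n (f : F n -> R) : (forall y, 0 <= f y) -> 0 <= gamma P X G f.
Proof.
move=> f0; rewrite gammaE; apply: Rintegral_ge0 => w _; rewrite mulr_ge0//.
have [c c0 hc] := prod_along_gt0 n.
by rewrite (le_trans (ltW c0)).
Qed.

Lemma gamma_gt0 n : 0 < gamma P X G (cst 1 : F n -> R).
Proof.
have [c c0 hc] := prod_along_gt0 n; rewrite (lt_le_trans c0)// gammaE.
rewrite -(Rintegral_cst_prob P c); apply: (le_Rintegral_bmeas (prob_lty P)).
- exact: bmeas_cst.
- exact: (bmeas_comp (@mhist n) (bmeasM (bmeas_cst _ 1) (bmeas_prod_along n hG))).
- by move=> w; rewrite mul1r.
Qed.

Lemma mean_fun_eta n : mean_fun (fun f : F n -> R => Defs.eta P X G f).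
Proof.
have g0 := gamma_gt0 n; split.
- by move=> f g hf hg; rewrite /Defs.eta gammaD// mulrDl.
- by move=> c f hf; rewrite /Defs.eta gammaZ// mulrA.
- by move=> f hf f0; rewrite /Defs.eta divr_ge0 ?gamma_ge0// ltW.
- by rewrite /Defs.eta divff// gt_eqF.
Qed.

(** This is [eta_(n+1) = Phi_(n+1)(eta_n)]: transitions preserve constants, so [gamma_(n+1)] has
    mass [gamma_n(G_n)], and the mass of [gamma_n] cancels. *)
Lemma etaS n (f : F n.+1 -> R) : (1 <= n)%N -> bmeas f ->
  Defs.eta P X G f = Defs.eta P X G (Qop f) / Defs.eta P X G (@G n).
Proof.
move=> n1 hf; rewrite /Defs.eta gammaS//.
have -> : gamma P X G (cst 1 : F n.+1 -> R) = gamma P X G (@G n).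
  rewrite gammaS//; last exact: bmeas_cst.
  rewrite /gamma; apply: eq_Rintegral => w _; congr (_ * _).
  by rewrite /Qop (_ : step _ _ = 1) ?mulr1//; exact: (mean_fun_cst (mean_fun_kernel_op _ _)).
have /lt0r_neq0 g0 := gamma_gt0 n.
by rewrite invfM invrK mulrACA mulVf// mulr1.
Qed.

End feynman_kac_recursion.

(** * The particle system *)

Section empirical_mean.
Context (R : realType) d (T : measurableType d) (N : nat).

Lemma Rintegral_empirical (x : 'I_N -> T) (f : T -> R) : (0 < N)%N -> bmeas f ->
  \int[empirical R x]_y f y = N%:R^-1 * \sum_(i < N) f (x i).
Proof.
move=> N0.
have eT : (empirical R x setT < +oo)%E.
  rewrite /empirical; under eq_bigr do rewrite diracT.
  by rewrite sumEFin -EFinM ltry.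
apply: (blinear_ext (L := fun f => \int[empirical R x]_y f y)
   (L' := fun f => N%:R^-1 * \sum_(i < N) f (x i))).
- exact: blinear_Rintegral.
- split.
  + by move=> f' g _ _; rewrite big_split mulrDr.
  + by move=> c f' _; rewrite -mulr_sumr mulrCA.
  + exists 1 => f' M _ fM; rewrite mul1r.
    exact: (sample_mean_norm (fun i (_ : T) => x i) N0 point fM).
- move=> A mA; rewrite Rintegral_indic//.
  transitivity (fine ((N%:R^-1)%:E * \sum_(i < N) (\d_(x i) A : \bar R))%E); first by [].
  rewrite (eq_bigr (fun i => (\1_A (x i))%:E)) => [|i _]; last by rewrite diracE indicE.
  by rewrite sumEFin -EFinM.
Qed.

End empirical_mean.

Section particle_generations.
Context (d : nat -> measure_display) (E : forall n, measurableType (d n)).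
Context (R : realType) (K : forall n, R.-pker (E n) ~> (E n.+1)) (x0 : E 0%N).
Context (dO : measure_display) (Omega : measurableType dO).
Context (P : probability Omega R) (X : forall n, Omega -> E n).
Local Notation F := (path_space E).
Hypothesis hX : markov_chain K x0 P X.
Context (G : forall n, F n -> R).
Hypothesis hG : potentials G.
Context (dS : measure_display) (S : measurableType dS) (Q : probability S R).
Context (N : nat) (N0 : (0 < N)%N) (xi : forall n, 'I_N -> S -> F n).
Hypothesis hxi : particle_system K G P X Q xi.

Let bG n : (1 <= n)%N -> bmeas (@G n).
Proof. exact: bmeas_potential. Qed.

Let Gpos n : (1 <= n)%N -> exists2 c, 0 < c & forall y, c <= @G n y.
Proof. exact: potential_lbound. Qed.

Definition past n : set (set S) := [set C | exists p i (A : set (F p)),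
  [/\ (1 <= p <= n)%N, measurable A & C = @xi p i @^-1` A]].
(** Giving [S] a second, coarser measurable structure turns measurability with respect to the past
    into plain measurability, so the closure lemmas for [bmeas] apply to [adapted] variables. *)
Definition pastType n := g_sigma_algebraType (past n).

Let mxi n i : (1 <= n)%N -> measurable_fun setT (@xi n i).
Proof. by case: hxi => + _ _; apply. Qed.

Lemma measurable_past n : @measurable_fun _ _ S (pastType n) setT id.
Proof.
apply: (@measurability _ _ S (pastType n) setT id (past n)) => //.
move=> _ [_ [p [i [A [/andP[p1 pn] mA ->]]]] <-].
exact: mxi.
Qed.

Lemma measurable_xi_past n p i : (1 <= p <= n)%N ->
  @measurable_fun _ _ (pastType n) (F p) setT (@xi p i).
Proof.
move=> pn _ A mA; rewrite setTI; apply: sub_sigma_algebra.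
by exists p, i, A.
Qed.

Definition smean n (f : F n -> R) (w : S) : R := sample_mean (@xi n) f w.

Definition adapted n (Z : S -> R) := @bmeas _ (pastType n) R Z.

Lemma smean_past n p (f : F p -> R) : (1 <= p <= n)%N -> bmeas f -> adapted n (smean f).
Proof.
move=> pn hf; apply/bmeasZ/bmeas_sum => i.
exact: (bmeas_comp (measurable_xi_past i pn) hf).
Qed.

Lemma bmeas_past n (Z : S -> R) : adapted n Z -> bmeas Z.
Proof. exact: (@bmeas_comp _ _ S (pastType n) R id Z (@measurable_past n)). Qed.

Lemma bmeas_smean n (f : F n -> R) : (1 <= n)%N -> bmeas f -> bmeas (smean f).
Proof. by move=> n1 hf; apply: bmeas_sample_mean => // i; exact: mxi. Qed.

Lemma etaN_smean n (f : F n -> R) w : bmeas f -> etaN xi f w = smean f w.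
Proof. exact: Rintegral_empirical. Qed.

Lemma smean_ge n (f : F n -> R) c w : (forall y, c <= f y) -> c <= smean f w.
Proof.
move=> cf; rewrite -[leLHS](@mean_const R N N0) ler_wpM2l ?invr_ge0//.
exact: ler_sum.
Qed.

(* [Phi_(n+1)(eta_n^N)] as a functional. *)
Definition next_mean n (w : S) (f : F n.+1 -> R) : R :=
  smean (Qop K G f) w / smean (@G n) w.

Let smeanG_gt0 n w : (1 <= n)%N -> 0 < smean (@G n) w.
Proof.
move=> n1; have [c c0 hc] := Gpos n1.
exact: lt_le_trans c0 (smean_ge w hc).
Qed.

Lemma mean_fun_next_mean n w : (1 <= n)%N -> mean_fun (@next_mean n w).
Proof.
move=> n1; have g0 := smeanG_gt0 w n1; split.
- move=> f g hf hg; rewrite /next_mean -mulrDl; congr (_ / _).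
  rewrite /smean /sample_mean -mulrDr -big_split; congr (_ * _).
  by apply: eq_bigr => i _; rewrite /Qop /step (mean_funD (mean_fun_kernel_op _ _))// mulrDr.
- move=> c f hf; rewrite /next_mean mulrA; congr (_ / _).
  rewrite /smean /sample_mean [RHS]mulrCA [in RHS]mulr_sumr; congr (_ * _).
  by apply: eq_bigr => i _; rewrite /Qop /step (mean_funZ (mean_fun_kernel_op _ _))// mulrCA.
- move=> f hf f0; rewrite /next_mean divr_ge0 ?(ltW g0)//; apply: smean_ge => y.
  rewrite /Qop mulr_ge0//; first by have [c c0 hc] := Gpos n1; rewrite (le_trans (ltW c0)).
  exact: (mean_fun_ge0 (mean_fun_kernel_op _ _)).
- rewrite /next_mean (_ : Qop _ _ _ = @G n) ?divff ?gt_eqF//.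
  apply/funext => y; rewrite /Qop (_ : step _ _ _ = 1) ?mulr1//.
  exact: (mean_fun_cst (mean_fun_kernel_op _ _)).
Qed.

Lemma next_mean_past n (f : F n.+1 -> R) : (1 <= n)%N -> bmeas f ->
  adapted n (fun w => next_mean w f).
Proof.
move=> n1 hf; apply: bmeasM.
  by apply: smean_past; [rewrite n1 leqnn|exact: bmeas_Qop].
have [c c0 hc] := Gpos n1.
apply: (bmeasV c0) => [w|]; first exact: smean_ge.
by apply: (smean_past _ _).1; [rewrite n1 leqnn|exact: bG].
Qed.

Lemma Phi_next_mean n w (A : set (F n.+1)) : (1 <= n)%N -> measurable A ->
  Phi K G (empirical R (@xi n ^~ w)) A = next_mean w (\1_A).
Proof.
move=> n1 mA; rewrite /Phi (Rintegral_empirical _ N0 (bG n1)).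
rewrite (_ : (fun y => _) = Qop K G (\1_A)); last first.
  by apply/funext => y; rewrite /Qop /step kernel_op_indic.
by rewrite Rintegral_empirical//; apply: bmeas_Qop => //; exact: bmeas_indic.
Qed.

Let Rintegral_indic_prod n (B : set S) (C : 'I_N -> set (F n)) :
  (1 <= n)%N -> measurable B -> (forall i, measurable (C i)) ->
  \int[Q]_w (\1_B w * \prod_(i < N) \1_(C i) (@xi n i w)) =
  fine (Q (B `&` \bigcap_(i in setT) @xi n i @^-1` C i)).
Proof.
move=> n1 mB mC.
have mI : measurable (B `&` \bigcap_(i in setT) @xi n i @^-1` C i).
  apply: measurableI => //; apply: fin_bigcap_measurable => //.
  by move=> i _; rewrite -[X in measurable X]setTI; exact: mxi.
rewrite -Rintegral_indic//; apply: eq_Rintegral => w _.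
rewrite !indicE in_setI -mulnb natrM; congr (_ * _).
have [/set_mem h|h] := boolP (w \in _).
  by rewrite big1// => i _; rewrite indicE mem_set//; exact: (h i I).
apply/eqP; rewrite prodf_seq_eq0; apply/hasP.
move: h; rewrite notin_setE /bigcap /= => /existsNP[i /not_implyP[_ h]].
by exists i; rewrite ?mem_index_enum//= indicE memNset.
Qed.

Lemma iid_next n (B : set (pastType n)) (C : 'I_N -> set (F n.+1)) : (1 <= n)%N ->
  measurable B -> (forall i, measurable (C i)) ->
  \int[Q]_w (\1_B w * \prod_(i < N) \1_(C i) (@xi n.+1 i w)) =
  \int[Q]_w (\1_B w * \prod_(i < N) next_mean w (\1_(C i))).
Proof.
move=> n1 mB mC; have mBS : measurable (B : set S).
  by rewrite -[X in measurable X]setTI; exact: (measurable_past (n := n)).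
rewrite Rintegral_indic_prod//.
have [_ _ /(_ n n1 B mB C mC) ->] := hxi.
rewrite integral_mkcond /Rintegral; congr fine; apply: eq_integral => w _.
rewrite patchE indicE; case: ifP => _; rewrite ?mul1r ?mul0r//.
by congr EFin; apply: eq_bigr => i _; rewrite Phi_next_mean.
Qed.

(** The first generation has a trivial past, modelled by [unit]; its law then has the same
    conditional form as that of later generations. *)
Lemma iid_first (B : set unit) (C : 'I_N -> set (F 1%N)) :
  measurable B -> (forall i, measurable (C i)) ->
  \int[Q]_w (\1_B tt * \prod_(i < N) \1_(C i) (@xi 1%N i w)) =
  \int[Q]_w (\1_B tt * \prod_(i < N) Defs.eta P X G (\1_(C i))).
Proof.
move=> mB mC; rewrite !RintegralZ_bmeas; [|exact: prob_lty|exact: bmeas_cst|exact: prob_lty|].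
  congr (_ * _); rewrite Rintegral_cst_prob.
  have := @Rintegral_indic_prod 1 setT C (ltnSn 0) measurableT mC.
  under eq_Rintegral do rewrite indicT mul1r.
  move=> ->; rewrite setTI; have [_ /(_ C mC) -> _] := hxi.
  by [].
apply: bmeas_prod => i _; apply: bmeas_comp; last exact: bmeas_indic.
exact: mxi.
Qed.

End particle_generations.

(** * Rates in L2 and rates for characteristic functions *)

Section L2_rates.
Context (R : realType) (dS : nat -> measure_display) (S : forall N, measurableType (dS N)).
Context (Q : forall N, probability (S N) R).

(* Convergence of uniformly bounded variables in L2 at rate [N^(-1/2)]; the index [N]
   stands for [N.+1] particles. *)
Definition tame (Y : forall N, S N -> R) (y : R) :=
  [/\ exists M : R, forall N w, `|Y N w| <= M,
      forall N, measurable_fun setT (Y N) &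
      exists C : R, forall N, \int[Q N]_w ((Y N w - y) ^+ 2) <= C / N.+1%:R].

Lemma tame_bmeas Y y N : tame Y y -> bmeas (Y N).
Proof. by move=> [[M YM] mY _]; split => //; exists M. Qed.

Lemma tame_cst c : tame (fun _ _ => c) c.
Proof.
split.
- by exists (`|c|).
- by move=> N; exact: measurable_cst.
exists 0 => N.
by rewrite mul0r; under eq_Rintegral do rewrite subrr expr0n; rewrite Rintegral_cst_prob.
Qed.

Lemma Rintegral_le2 N (f g h : S N -> R) a b : bmeas f -> bmeas g -> bmeas h ->
  (forall w, f w <= a * g w + b * h w) ->
  \int[Q N]_w f w <= a * \int[Q N]_w g w + b * \int[Q N]_w h w.
Proof.
move=> hf hg hh fgh; have Qfin := prob_lty (Q N).
rewrite -(RintegralZ_bmeas Qfin a hg) -(RintegralZ_bmeas Qfin b hh).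
rewrite -(RintegralD_bmeas Qfin (bmeasZ a hg) (bmeasZ b hh)).
apply: (le_Rintegral_bmeas Qfin) => //.
by apply: bmeasD; exact: bmeasZ.
Qed.

Let sqdist (Y : forall N, S N -> R) y N : tame Y y -> bmeas (fun w => (Y N w - y) ^+ 2).
Proof.
by move=> /(tame_bmeas N) hY; apply/bmeasX/bmeasB => //; exact: bmeas_cst.
Qed.

(** Closure of [tame] under algebraic operations is reduced to a pointwise estimate of squared
    deviations. *)
Lemma tame_le2 (W Y Z : forall N, S N -> R) w y z a b : tame Y y -> tame Z z ->
  0 <= a -> 0 <= b ->
  (exists M : R, forall N x, `|W N x| <= M) -> (forall N, measurable_fun setT (W N)) ->
  (forall N x, (W N x - w) ^+ 2 <= a * (Y N x - y) ^+ 2 + b * (Z N x - z) ^+ 2) ->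
  tame W w.
Proof.
move=> tY tZ a0 b0 [M WM] mW le2; split => //; first by exists M.
have [_ _ [C YC]] := tY; have [_ _ [D ZD]] := tZ.
exists (a * C + b * D) => N.
have hW : bmeas (W N) by split => //; exists M.
rewrite (le_trans (Rintegral_le2 _ (sqdist N tY) (sqdist N tZ) (le2 N)))//.
  by apply/bmeasX/bmeasB => //; exact: bmeas_cst.
by rewrite mulrDl -(mulrA a) -(mulrA b) lerD// ler_wpM2l.
Qed.

Let sqrD_le (x y : R) : (x + y) ^+ 2 <= 2 * x ^+ 2 + 2 * y ^+ 2.
Proof. by have := sqr_ge0 (x - y); rewrite !expr2; lra. Qed.

Lemma tameM (Y Z : forall N, S N -> R) y z : tame Y y -> tame Z z ->
  tame (fun N w => Y N w * Z N w) (y * z).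
Proof.
move=> tY tZ; have [[M YM] mY _] := tY; have [[M' ZM] mZ _] := tZ.
apply: (tame_le2 (a := 2 * M' ^+ 2) (b := 2 * y ^+ 2) tY tZ).
- by rewrite mulr_ge0// sqr_ge0.
- by rewrite mulr_ge0// sqr_ge0.
- by exists (M * M') => N x; rewrite normrM ler_pM.
- by move=> N; exact: measurable_funM.
(* Each deviation is multiplied by something bounded: [Z] by [M'], and the constant [y] itself. *)
- move=> N x; have -> : Y N x * Z N x - y * z = Z N x * (Y N x - y) + y * (Z N x - z) by ring.
  apply: (le_trans (sqrD_le _ _)); rewrite !exprMn.
  have Z2 : Z N x ^+ 2 <= M' ^+ 2.
    rewrite -real_normK ?num_real// lerXn2r ?nnegrE//.
    by rewrite (le_trans _ (ZM N x)).
  by have := ler_wpM2r (sqr_ge0 (Y N x - y)) Z2; lra.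
Qed.

Lemma tameD (Y Z : forall N, S N -> R) y z : tame Y y -> tame Z z ->
  tame (fun N w => Y N w + Z N w) (y + z).
Proof.
move=> tY tZ; have [[M YM] mY _] := tY; have [[M' ZM] mZ _] := tZ.
apply: (tame_le2 (a := 2) (b := 2) tY tZ) => //.
- by exists (M + M') => N x; rewrite (le_trans (ler_normD _ _))// lerD.
- by move=> N; exact: measurable_funD.
- move=> N x; have -> : Y N x + Z N x - (y + z) = (Y N x - y) + (Z N x - z) by ring.
  exact: sqrD_le.
Qed.

Lemma tameN (Y : forall N, S N -> R) y : tame Y y -> tame (fun N w => - Y N w) (- y).
Proof.
move=> tY; have [[M YM] mY _] := tY.
apply: (tame_le2 (a := 1) (b := 0) tY tY) => //.
- by exists M => N x; rewrite normrN.
- by move=> N; exact: measurable_funN.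
- by move=> N x; rewrite -opprD sqrrN mul1r mul0r addr0.
Qed.

Lemma tame_shift (Y Z : forall N, S N -> R) y (C : R) : tame Y y ->
  (exists M : R, forall N w, `|Z N w| <= M) -> (forall N, measurable_fun setT (Z N)) ->
  (forall N, \int[Q N]_w ((Z N w - Y N w) ^+ 2) <= C / N.+1%:R) -> tame Z y.
Proof.
move=> tY [M ZM] mZ ZY; split => //; first by exists M.
have [_ _ [D YD]] := tY; exists (2 * C + 2 * D) => N.
have hZ : bmeas (Z N) by split => //; exists M.
have hY := tame_bmeas N tY.
rewrite (le_trans (@Rintegral_le2 N _ (fun w => (Z N w - Y N w) ^+ 2) (fun w => (Y N w - y) ^+ 2) 2 2 _ _ _ _))//.
- by apply/bmeasX/bmeasB => //; exact: bmeas_cst.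
- by apply/bmeasX/bmeasB.
- exact: sqdist.
- move=> w; have -> : Z N w - y = (Z N w - Y N w) + (Y N w - y) by ring.
  exact: sqrD_le.
- by rewrite [leRHS]mulrDl -(mulrA 2 C) -(mulrA 2 D) lerD// ler_wpM2l.
Qed.

Lemma tame_div (Y Z : forall N, S N -> R) y z c : tame Y y -> tame Z z -> 0 < c ->
  c <= z -> (forall N w, c <= Z N w) -> tame (fun N w => Y N w / Z N w) (y / z).
Proof.
move=> tY tZ c0 cz cZ; have [[M YM] mY _] := tY; have [[M' ZM] mZ _] := tZ.
have Z0 N w : 0 < Z N w by exact: lt_le_trans (cZ N w).
have z0 : 0 < z by exact: lt_le_trans cz.
apply: (tame_le2 (a := 2 * c ^- 2) (b := 2 * c ^- 2 * (y / z) ^+ 2) tY tZ).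
- by rewrite mulr_ge0// invr_ge0 sqr_ge0.
- apply: mulr_ge0; last exact: sqr_ge0.
  by rewrite mulr_ge0// invr_ge0 sqr_ge0.
- exists (M * c^-1) => N x; rewrite normrM ler_pM//.
  by rewrite normfV gtr0_norm// lef_pV2 ?posrE.
- move=> N; apply: measurable_funM => //.
  exact: (bmeasV c0 (cZ N) (mZ N)).1.
(* The deviation of the quotient is linear in those of [Y] and [Z], up to a factor [1 / Z] bounded
   by [1 / c]. *)
- move=> N x; have -> : Y N x / Z N x - y / z =
    (Z N x)^-1 * ((Y N x - y) - (y / z) * (Z N x - z)).
    by field; rewrite !gt_eqF.
  rewrite exprMn (le_trans (_ : _ <= c ^- 2 * (2 * (Y N x - y) ^+ 2 + 2 * ((y / z) * (Z N x - z)) ^+ 2)))//.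
    rewrite ler_pM ?sqr_ge0//.
      rewrite exprVn lef_pV2 ?posrE ?exprn_gt0// lerXn2r ?nnegrE ?(ltW c0)//.
      exact: ltW.
    by rewrite (le_trans (sqrD_le _ _))// sqrrN.
  by rewrite exprMn le_eqVlt; apply/orP; left; apply/eqP; ring.
Qed.

(** Instead of Cauchy-Schwarz, [|u| <= 1 / (2 r) + r u^2 / 2] with [r] the root of the number of
    particles; the integrals of both terms are of order [1 / r]. *)
Lemma tame_L1 (Y : forall N, S N -> R) y : tame Y y -> exists C : R, forall N,
  \int[Q N]_w `|Y N w - y| <= C / Num.sqrt N.+1%:R.
Proof.
move=> tY; have [_ _ [C YC]] := tY; exists ((1 + C) / 2) => N.
set r := Num.sqrt _; have r0 : 0 < r by rewrite sqrtr_gt0 ltr0n.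
have r2 : r ^+ 2 = N.+1%:R by rewrite sqr_sqrtr.
have hY : bmeas (fun w => Y N w - y).
  by apply: bmeasB; [exact: tame_bmeas tY|exact: bmeas_cst].
apply: (@le_trans _ _ ((2 * r)^-1 * \int[Q N]_w 1 + r / 2 * \int[Q N]_w ((Y N w - y) ^+ 2))).
  apply: Rintegral_le2; [exact: bmeas_norm|exact: bmeas_cst|exact: bmeasX|].
  move=> w; rewrite -(real_normK (num_real (Y N w - y))) -subr_ge0.
  set u := `|_|; rewrite (_ : _ - _ = (2 * r)^-1 * (r * u - 1) ^+ 2).
    by rewrite mulr_ge0 ?sqr_ge0// invr_ge0 mulr_ge0// ltW.
  by field; rewrite gt_eqF.
rewrite Rintegral_cst_prob mulr1; have := YC N; rewrite -r2 => YCN.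
apply: (@le_trans _ _ ((2 * r)^-1 + r / 2 * (C / r ^+ 2))).
  by rewrite lerD2l ler_wpM2l// divr_ge0// ltW.
by rewrite le_eqVlt; apply/orP; left; apply/eqP; field; rewrite gt_eqF.
Qed.

(* [sqrt N * Z] converges in law to N(0, v), with a rate; testing with [cos (s + t x)] for
   all [s] amounts to using characteristic functions, without complex numbers. *)
Definition asymp_gauss (Z : forall N, S N -> R) v :=
  forall t : R, exists C : R, forall N s,
  `| \int[Q N]_w cos (s + t * (Num.sqrt N.+1%:R * Z N w)) -
     cos s * expR (- (v * t ^+ 2 / 2)) | <= C / Num.sqrt N.+1%:R.

Lemma asymp_gaussZ (c : R) (Z : forall N, S N -> R) v : asymp_gauss Z v ->
  asymp_gauss (fun N w => c * Z N w) (c ^+ 2 * v).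
Proof.
move=> hZ t; have [C hC] := hZ (t * c); exists C => N s.
have := hC N s; rewrite exprMn.
have -> : v * (t ^+ 2 * c ^+ 2) / 2 = c ^+ 2 * v * t ^+ 2 / 2 by ring.
congr (`|_ - _| <= _); apply: eq_Rintegral => w _.
by congr cos; ring.
Qed.

(** A quantitative Slutsky lemma: the cosine is 1-Lipschitz, and an L1 error of order [1 / N]
    multiplied by [sqrt N] is still of order [N^(-1/2)]. *)
Lemma asymp_gauss_close (Y Z : forall N, S N -> R) v :
  (forall N, bmeas (Y N)) -> (forall N, bmeas (Z N)) ->
  (exists C : R, forall N, \int[Q N]_w `|Z N w - Y N w| <= C / N.+1%:R) ->
  asymp_gauss Y v -> asymp_gauss Z v.
Proof.
move=> hY hZ [D YZ] aY t; have [C hC] := aY t; exists (`|t| * D + C) => N s.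
have /bmeas_norm hYZ := bmeasB (hZ N) (hY N).
set r := Num.sqrt _; have r0 : 0 < r by rewrite sqrtr_gt0 ltr0n.
have r2 : r ^+ 2 = N.+1%:R by rewrite sqr_sqrtr.
have hcos (W : S N -> R) : bmeas W -> bmeas (fun w => cos (s + t * (r * W w))).
  by move=> hW; apply: bmeas_cos; exact: (bmeasD (bmeas_cst _ s) (bmeasZ t (bmeasZ r hW))).1.
rewrite [leRHS]mulrDl; apply: (le_trans (ler_distD (\int[Q N]_w cos (s + t * (r * Y N w))) _ _)).
apply: lerD; last exact: hC.
apply: (@le_trans _ _ (\int[Q N]_w (`|t| * (r * `|Z N w - Y N w|)))).
  apply: (le_dist_Rintegral_prob (Q N)); [exact: hcos|exact: hcos|exact/bmeasZ/bmeasZ|].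
  move=> w; apply: (le_trans (cos_lip _ _)).
  have -> : s + t * (r * Z N w) - (s + t * (r * Y N w)) = t * (r * (Z N w - Y N w)) by ring.
  by rewrite !normrM (gtr0_norm r0).
rewrite !(RintegralZ_bmeas (prob_lty (Q N)))//; last exact: bmeasZ.
rewrite -[leRHS]mulrA ler_wpM2l//.
apply: (@le_trans _ _ (r * (D / N.+1%:R))); first by rewrite ler_wpM2l ?(ltW r0).
by rewrite -r2 le_eqVlt; apply/orP; left; apply/eqP; field; rewrite gt_eqF.
Qed.

Lemma asymp_gauss_cvg (Z : forall N, S N -> R) v : 0 <= v -> tame Z 0 ->
  asymp_gauss Z v ->
  cvg_in_law Q (fun N w => Num.sqrt N.+1%:R * Z N w) (centered_gaussian v).
Proof.
move=> v0 tZ aZ; have [_ mZ [C ZC]] := tZ.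
have rE N : Num.sqrt N.+1%:R ^+ 2 = N.+1%:R :> R by rewrite sqr_sqrtr.
apply: cvg_in_law_gaussian => //.
- by move=> N; apply: measurable_funM => //; exact: measurable_cst.
- move=> s t; have [D hD] := aZ t.
  apply/subr_cvg0; apply/norm_cvg0P.
  apply: (@squeeze_cvgr _ _ _ _ (fun=> 0) (fun N : nat => D / Num.sqrt N.+1%:R)).
  + by apply: nearW => N; rewrite normr_ge0 hD.
  + exact: cvg_cst.
  + rewrite -(mulr0 D); apply: cvgM; first exact: cvg_cst.
    rewrite (_ : (fun N => _) = (fun N => Num.sqrt (@harmonic R N))); last first.
      by apply/funext => N; rewrite sqrtrV.
    rewrite -sqrtr0; apply: continuous_cvg; first exact: sqrt_continuous.
    exact: cvg_harmonic.
(* Chebyshev's inequality: the scaled second moments are at most [C], and this [A] satisfies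
   [|C| <= e A <= e A^2] because it is at least 1. *)
- move=> e e0; exists (1 + `|C| / e); first by rewrite ltr_pwDl// divr_ge0// ltW.
  apply: nearW => N; set A := 1 + _.
  have A1 : 1 <= A by rewrite lerDl divr_ge0// ltW.
  have A0 : 0 < A by exact: lt_le_trans A1.
  have hZN : bmeas (fun w => (Num.sqrt N.+1%:R * Z N w) ^+ 2).
    by apply/bmeasX/bmeasZ; exact: tame_bmeas tZ.
  apply: (@le_trans _ _ (\int[Q N]_w (A ^- 2 * (Num.sqrt N.+1%:R * Z N w) ^+ 2))).
    apply: (le_Rintegral_bmeas (prob_lty (Q N))).
    + apply: (bmeas_comp _ (bmeas_indic R (measurable_tail A))).
      exact: (bmeasZ _ (tame_bmeas N tZ)).1.
    + exact: bmeasZ.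
    + move=> w; rewrite indicE; have [|_] := boolP (_ \in _); last first.
        by rewrite mulr_ge0 ?sqr_ge0// invr_ge0 sqr_ge0.
      rewrite inE /= => Ax; rewrite mulrC ler_pdivlMr ?exprn_gt0// mul1r.
      by rewrite -(real_normK (num_real (_ * _))) lerXn2r ?nnegrE ?(ltW A0) ?(ltW Ax).
  rewrite (RintegralZ_bmeas (prob_lty (Q N)))//.
  under eq_Rintegral do rewrite exprMn rE.
  rewrite (RintegralZ_bmeas (prob_lty (Q N))); last exact/bmeasX/(tame_bmeas N tZ).
  have ZCN : N.+1%:R * \int[Q N]_w (Z N w ^+ 2) <= C.
    rewrite mulrC -ler_pdivlMr//; have := ZC N.
    by under eq_Rintegral do rewrite subr0.
  apply: (@le_trans _ _ (A ^- 2 * `|C|)).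
    by rewrite ler_wpM2l ?invr_ge0 ?sqr_ge0// (le_trans ZCN)// ler_norm.
  rewrite mulrC ler_pdivrMr ?exprn_gt0//.
  apply: (@le_trans _ _ (e * A)).
    by rewrite /A mulrDr mulr1 mulrCA divff ?gt_eqF// mulr1 lerDr ltW.
  by rewrite ler_wpM2l ?(ltW e0)// expr2 ler_peMr// ltW.
Qed.

End L2_rates.

(** * Limit theorems for the particle approximation of [gamma] *)

Section particle_asymptotics.
Context (d : nat -> measure_display) (E : forall n, measurableType (d n)).
Context (R : realType) (K : forall n, R.-pker (E n) ~> (E n.+1)) (x0 : E 0%N).
Context (dO : measure_display) (Omega : measurableType dO).
Context (P : probability Omega R) (X : forall n, Omega -> E n).
Local Notation F := (path_space E).
Hypothesis hX : markov_chain K x0 P X.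
Context (G : forall n, F n -> R).
Hypothesis hG : potentials G.
Context (dS : nat -> measure_display) (S : forall N, measurableType (dS N)).
Context (Q : forall N, probability (S N) R).
Context (xi : forall N n, 'I_N.+1 -> S N -> F n).
Hypothesis hxi : forall N, particle_system K G P X (Q N) (@xi N).

Let bG n : (1 <= n)%N -> bmeas (@G n).
Proof. exact: bmeas_potential. Qed.

Let Gpos n : (1 <= n)%N -> exists2 c, 0 < c & forall y, c <= @G n y.
Proof. exact: potential_lbound. Qed.

Let mxi N n i : measurable_fun setT (@xi N n.+1 i).
Proof. by have [+ _ _] := hxi N; apply. Qed.

Let pastN N := pastType (@xi N).

(** The identity into the coarser measurable space plays the part of the observation on which the
    particles are conditionally i.i.d. *)
Let obs N n : S N -> pastN N n := id.

Let mobs N n : measurable_fun setT (@obs N n).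
Proof. exact: (measurable_past (hxi N)). Qed.

(* The conditional law of the particles of generation [n.+1] given the previous ones. *)
Definition pred_mean N n (w : S N) : (F n.+1 -> R) -> R :=
  match n return (F n.+1 -> R) -> R with
  | 0 => fun f => Defs.eta P X G f
  | n'.+1 => fun f => next_mean K G (@xi N) w f
  end.

Let mean_pred N n w : mean_fun (@pred_mean N n w).
Proof.
case: n => [|n]; first exact: (mean_fun_eta hX).
exact: (mean_fun_next_mean K hG).
Qed.

Let pred_past N n (f : F n.+1 -> R) : bmeas f -> adapted (@xi N) n (fun w => pred_mean w f).
Proof.
case: n f => [|n] f hf; first exact: bmeas_cst.
exact: next_mean_past.
Qed.

(** At [n = 0] there are no generators, and the empty and full sets already form a sigma-algebra.
    The first generation thus joins the general scheme, with the deterministic conditional law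
    [eta]. *)
Let past0 N (B : set (pastN N 0)) : measurable B -> B = set0 \/ B = setT.
Proof.
apply: (@smallest_sub _ (sigma_algebra setT) (past (@xi N) 0) [set B | B = set0 \/ B = setT]).
  split => /=; first by left.
  - by move=> A [->|->]; [right; rewrite setD0|left; rewrite setDv].
  - move=> A hA; have [[i Ai]|h] := pselect (exists i, A i = setT).
      by right; apply/seteqP; split => // x _; exists i => //; rewrite Ai.
    left; apply/seteqP; split => // x [i _].
    by have [->//|Ai] := hA i; case: h; exists i.
by move=> A [p [i [C [/andP[p1 p0] _ _]]]]; move: p1; rewrite ltnNge p0.
Qed.

Let iid_pred N n (B : set (pastN N n)) (C : 'I_N.+1 -> set (F n.+1)) :
  measurable B -> (forall i, measurable (C i)) ->
  \int[Q N]_w (\1_B (obs n w) * \prod_(i < N.+1) \1_(C i) (@xi N n.+1 i w)) =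
  \int[Q N]_w (\1_B (obs n w) * \prod_(i < N.+1) pred_mean w (\1_(C i))).
Proof.
case: n B C => [|n] B C mB mC; last exact: (iid_next hG _ (hxi N)).
have [->|->] := past0 mB.
  by apply: eq_Rintegral => w _; rewrite indic0 !mul0r.
have := iid_first (N := N.+1) (hxi N) (@measurableT _ unit) mC.
by under eq_Rintegral do rewrite indicT; under [in RHS]eq_Rintegral do rewrite indicT.
Qed.

Lemma pred_unbiased N n (Z : S N -> R) (f : F n.+1 -> R) : adapted (@xi N) n Z -> bmeas f ->
  \int[Q N]_w (Z w * smean (@xi N) f w) = \int[Q N]_w (Z w * pred_mean w f).
Proof.
apply: (cond_iid_unbiased (@mobs N n) (@mxi N n) (@mean_pred N n)) => //.
- by move=> g /(@pred_past N n)[].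
- exact: iid_pred.
Qed.

Let pred_L2 N n (f : F n.+1 -> R) M : bmeas f -> (forall y, `|f y| <= M) ->
  \int[Q N]_w ((smean (@xi N) f w - pred_mean w f) ^+ 2) <= M ^+ 2 / N.+1%:R.
Proof.
apply: (cond_iid_L2 (@mobs N n) (@mxi N n) (@mean_pred N n)) => //.
- by move=> g /(@pred_past N n)[].
- exact: iid_pred.
Qed.

Let pred_clt N n (U : S N -> R) (f : F n.+1 -> R) (M t c : R) :
  @measurable_fun _ _ (pastN N n) _ setT U -> bmeas f ->
  (forall x, `|f x| <= M) -> c = 2 * (`|t| * M / Num.sqrt N.+1%:R) ->
  `| \int[Q N]_w cos (U w + t * (Num.sqrt N.+1%:R * (smean (@xi N) f w - pred_mean w f))) -
     \int[Q N]_w (cos (U w) *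
       expR (- (t ^+ 2 * (pred_mean w (fun x => f x ^+ 2) - pred_mean w f ^+ 2) / 2))) |
  <= N.+1%:R * (c ^+ 3 + c ^+ 4 *+ 2).
Proof.
apply: (cond_iid_clt (@mobs N n) (@mxi N n) (@mean_pred N n)) => //.
- by move=> g /(@pred_past N n)[].
- exact: iid_pred.
Qed.

Definition weight N n (w : S N) := \prod_(1 <= p < n) smean (@xi N) (@G p) w.
Arguments weight : clear implicits.

Lemma weight1 N w : weight N 1 w = 1.
Proof. by rewrite /weight big_geq. Qed.

Lemma weightS N n w : weight N n.+2 w = weight N n.+1 w * smean (@xi N) (@G n.+1) w.
Proof. by rewrite /weight big_nat_recr. Qed.

Let smeanG_gt0 N n w : 0 < smean (@xi N) (@G n.+1) w.
Proof.
have [c c0 hc] := Gpos (ltn0Sn n).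
by apply: (lt_le_trans c0); exact: smean_ge.
Qed.

Lemma weight_past N m n : (n <= m)%N -> adapted (@xi N) m (weight N n.+1).
Proof.
elim: n => [_|n IH nm].
  rewrite (_ : weight _ _ = fun=> 1); first exact: bmeas_cst.
  by apply/funext => w; rewrite weight1.
rewrite (_ : weight _ _ = fun w => weight N n.+1 w * smean (@xi N) (@G n.+1) w).
  by apply: bmeasM; [exact/IH/ltnW|apply: smean_past => //; exact: bG].
by apply/funext => w; rewrite weightS.
Qed.

Let bweight N n : bmeas (weight N n.+1).
Proof. exact: (bmeas_past (hxi N) (weight_past _ (leqnn n))). Qed.

Definition pgamma N n (f : F n -> R) w := smean (@xi N) f w * weight N n w.

Let bsmean N n (f : F n.+1 -> R) : bmeas f -> bmeas (smean (@xi N) f).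
Proof. exact: (bmeas_smean (hxi N)). Qed.

Lemma bmeas_pgamma N n (f : F n.+1 -> R) : bmeas f -> bmeas (@pgamma N n.+1 f).
Proof. by move=> hf; apply: bmeasM; [exact: bsmean|exact: bweight]. Qed.

Lemma gammaN_pgamma N n (f : F n.+1 -> R) w : bmeas f -> gammaN G (@xi N) f w = pgamma f w.
Proof.
move=> hf; rewrite /gammaN etaN_smean//; congr (_ * _).
rewrite /weight big_nat_cond [RHS]big_nat_cond; apply: eq_bigr => p /andP[/andP[p1 _] _].
by rewrite etaN_smean//; exact: bG.
Qed.

Let bQ n (f : F n.+2 -> R) : bmeas f -> bmeas (Qop K G f).
Proof. by move=> hf; apply: bmeas_Qop => //; exact: bG. Qed.

(** The last factor of the weight is the denominator of [next_mean]. So the conditional expectation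
    of [gamma_(n+1)^N f] is [gamma_n^N (Q_n f)], the recursion behind both unbiasedness and the
    variance. *)
Let weight_pred N n (f : F n.+2 -> R) w :
  weight N n.+2 w * pred_mean w f = pgamma (Qop K G f) w.
Proof.
rewrite weightS /pgamma /= /next_mean; have := lt0r_neq0 (smeanG_gt0 n w).
by move=> ?; field.
Qed.

Lemma pgamma_unbiased N n (f : F n.+1 -> R) : bmeas f ->
  \int[Q N]_w pgamma f w = gamma P X G f.
Proof.
elim: n f => [|n IH] f hf.
  rewrite /pgamma; under eq_Rintegral do rewrite mulrC.
  rewrite (pred_unbiased (weight_past _ (leqnn 0)) hf).
  under eq_Rintegral do rewrite weight1 mul1r.
  rewrite Rintegral_cst_prob /pred_mean /Defs.eta.
  suff -> : gamma P X G (cst 1 : F 1 -> R) = 1 by rewrite divr1.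
  by rewrite gamma1 Rintegral_cst_prob.
rewrite (gammaS hX)// -IH; last exact: bQ.
rewrite /pgamma; under eq_Rintegral do rewrite mulrC.
rewrite (pred_unbiased (weight_past _ (leqnn n.+1)) hf).
by apply: eq_Rintegral => w _; rewrite weight_pred.
Qed.

Lemma tame_smean_pred n (f : F n.+1 -> R) e : bmeas f ->
  tame Q (fun N w => pred_mean w f) e -> tame Q (fun N => smean (@xi N) f) e.
Proof.
move=> hf tp; have [mf [M fM]] := hf.
apply: (tame_shift tp (C := M ^+ 2)).
- by exists M => N w; exact: sample_mean_norm.
- by move=> N; exact: (bsmean _ hf).1.
- by move=> N; exact: pred_L2.
Qed.

Let gg n := gamma P X G (cst 1 : F n -> R).

Let gg_gt0 n : 0 < gg n.
Proof. exact: (gamma_gt0 hX). Qed.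

Let gamma_eta n (f : F n -> R) : gamma P X G f = Defs.eta P X G f * gg n.
Proof. by rewrite /Defs.eta -mulrA mulVf ?mulr1// lt0r_neq0//; exact: gg_gt0. Qed.

Let gamma_step n (f : F n.+2 -> R) : bmeas f -> gamma P X G f = gamma P X G (Qop K G f).
Proof. exact: (gammaS hX). Qed.

(** The predicted mean is a quotient of sample means of the previous generation, as [etaS] is for
    [eta]; the lower bound of the potential keeps the denominator away from 0 uniformly in [N]. *)
Lemma tame_pred n (f : F n.+1 -> R) : bmeas f ->
  tame Q (fun N w => pred_mean w f) (Defs.eta P X G f).
Proof.
elim: n f => [|n IH] f hf; first exact: tame_cst.
have [c c0 hc] := Gpos (ltn0Sn n).
rewrite (etaS hX)//; apply: (tame_div (c := c)) => //.
- by apply: tame_smean_pred; [exact: bQ|exact/IH/bQ].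
- by apply: tame_smean_pred; [exact: bG|exact/IH/bG].
- rewrite -(mean_fun_cst (mean_fun_eta hX bG Gpos n.+1) c).
  apply: (mean_fun_le (mean_fun_eta hX bG Gpos n.+1)) => //; first exact: bmeas_cst.
  exact: bG.
- by move=> N w; exact: smean_ge.
Qed.

Lemma tame_smean n (f : F n.+1 -> R) : bmeas f ->
  tame Q (fun N => smean (@xi N) f) (Defs.eta P X G f).
Proof. by move=> hf; apply: tame_smean_pred => //; exact: tame_pred. Qed.

Lemma tame_weight n : tame Q (fun N => weight N n.+1) (gg n.+1).
Proof.
elim: n => [|n IH].
  rewrite (_ : gg 1 = 1); last by rewrite /gg gamma1 Rintegral_cst_prob.
  rewrite (_ : (fun N => _) = fun N w => 1); first exact: tame_cst.
  apply: functional_extensionality_dep => N; apply/funext => w.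
  exact: weight1.
have -> : gg n.+2 = gg n.+1 * Defs.eta P X G (@G n.+1).
  rewrite mulrC -gamma_eta /gg gamma_step; last exact: bmeas_cst.
  congr (gamma P X G _); apply/funext => y; rewrite /Qop (_ : step _ _ _ = 1) ?mulr1//.
  exact: (mean_fun_cst (mean_fun_kernel_op _ _)).
rewrite (_ : (fun N => _) = fun N w => weight N n.+1 w * smean (@xi N) (@G n.+1) w).
  by apply: tameM => //; exact/tame_smean/bG.
by apply: functional_extensionality_dep => N; apply/funext => w; exact: weightS.
Qed.

Lemma tame_pgamma n (f : F n.+1 -> R) : bmeas f ->
  tame Q (fun N => @pgamma N n.+1 f) (gamma P X G f).
Proof.
by move=> hf; rewrite gamma_eta; apply: tameM; [exact: tame_smean|exact: tame_weight].
Qed.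

Let sigma2 n (f : F n -> R) := Defs.eta P X G (fun y => f y ^+ 2) - Defs.eta P X G f ^+ 2.

Let sigma2_ge0 n (f : F n -> R) : bmeas f -> 0 <= sigma2 f.
Proof. by move=> hf; rewrite subr_ge0; exact: (mean_fun_sqr_le (mean_fun_eta hX bG Gpos n)). Qed.

Let tame_pred_var n (f : F n.+1 -> R) : bmeas f ->
  tame Q (fun N w => pred_mean w (fun y => f y ^+ 2) - pred_mean w f ^+ 2) (sigma2 f).
Proof.
move=> hf; apply: tameD; first exact/tame_pred/bmeasX.
by apply: tameN; apply: tameM; exact: tame_pred.
Qed.

(** The error is [B] plus the weight times [D], where [B] is known from the past and [D] is the
    fresh sampling error. [B] sits in the phase and is settled by the hypothesis, [D] contributes
    the new variance, and independence shows as a product of exponentials. *)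
Lemma asymp_gauss_step n (f : F n.+1 -> R) v : bmeas f -> 0 <= v ->
  asymp_gauss Q (fun N w => weight N n.+1 w * pred_mean w f - gamma P X G f) v ->
  asymp_gauss Q (fun N w => pgamma f w - gamma P X G f) (gg n.+1 ^+ 2 * sigma2 f + v).
Proof.
move=> hf v0 Bv t; have [CB hCB] := Bv t.
have [mf [M fM]] := hf; have [Mw0 mw [Cw hCw]] := tame_weight n.
have [Cv hCv] := tame_L1 (tame_pred_var hf).
(* The frequency after the weight is frozen at its limit; [a] over the root of the number of
   particles is the constant [c] of [cond_iid_clt]. The constant on the next line adds up the four
   errors bounded below. *)
pose tg := t * gg n.+1; pose a := 2 * (`|tg| * M).
exists (`|t| * (Cw + M ^+ 2) / 2 + (a ^+ 3 + a ^+ 4 *+ 2) + tg ^+ 2 / 2 * Cv + CB) => N s.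
set r := Num.sqrt _; have r1 : 1 <= r by rewrite -[leLHS]sqrtr1 ler_wsqrtr// ler1n.
have r0 : 0 < r by exact: lt_le_trans r1.
have r2 : r ^+ 2 = N.+1%:R by rewrite sqr_sqrtr.
have hW := bweight N n; have hp := bmeas_past (hxi N) (pred_past N hf).
have hp2 := bmeas_past (hxi N) (pred_past N (bmeasX 2 hf)).
pose B w := weight N n.+1 w * pred_mean w f - gamma P X G f.
pose D w := smean (@xi N) f w - pred_mean w f.
have hD : bmeas D by apply: bmeasB => //; exact: bsmean.
have hB : bmeas B by apply: bmeasB; [exact: bmeasM|exact: bmeas_cst].
pose U w := s + t * (r * B w).
have hU : bmeas U by apply: bmeasD; [exact: bmeas_cst|exact/bmeasZ/bmeasZ].
have mU : @measurable_fun _ _ (pastN N n) _ setT U.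
  have hWp : adapted (@xi N) n (weight N n.+1) by exact: weight_past.
  suff : adapted (@xi N) n U by case.
  apply: bmeasD; first exact: bmeas_cst.
  by apply/bmeasZ/bmeasZ/bmeasB; [exact: (bmeasM hWp (pred_past _ hf))|exact: bmeas_cst].
pose va (w : S N) := pred_mean w (fun y => f y ^+ 2) - pred_mean w f ^+ 2.
have hva : bmeas va by apply: bmeasB => //; exact: bmeasX.
have va0 w : 0 <= va w by rewrite subr_ge0 (mean_fun_sqr_le (@mean_pred N n w)).
pose I1 := \int[Q N]_w cos (s + t * (r * (pgamma f w - gamma P X G f))).
pose I2 := \int[Q N]_w cos (U w + tg * (r * D w)).
pose I3 := \int[Q N]_w (cos (U w) * expR (- (tg ^+ 2 * va w / 2))).
pose e := expR (- (tg ^+ 2 * sigma2 f / 2)).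
pose I4 := e * \int[Q N]_w cos (U w).
have e1 : 0 <= e <= 1.
  rewrite expR_ge0 -expR0 ler_expR oppr_le0 divr_ge0// mulr_ge0 ?sqr_ge0//.
  exact: sigma2_ge0.
(* Freezing the weight: its deviation and [D] are both of order [N^(-1/2)] in L2, so their product
   is of order [1 / N] in L1. *)
have d12 : `|I1 - I2| <= (`|t| * (Cw + M ^+ 2) / 2) / r.
  apply: (@le_trans _ _ (\int[Q N]_w (`|t| * (r * (`|weight N n.+1 w - gg n.+1| * `|D w|))))).
    apply: (le_dist_Rintegral_prob (Q N)).
    - apply: (bmeas_cos (bmeasD (bmeas_cst _ s) (bmeasZ t (bmeasZ r (bmeasB _ (bmeas_cst _ _))))).1).
      exact: bmeas_pgamma.
    - by apply: (bmeas_cos (bmeasD hU (bmeasZ tg (bmeasZ r hD))).1).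
    - apply/bmeasZ/bmeasZ/bmeasM; last exact: bmeas_norm.
      by apply/bmeas_norm/bmeasB => //; exact: bmeas_cst.
    - move=> w; apply: (le_trans (cos_lip _ _)).
      have -> : s + t * (r * (pgamma f w - gamma P X G f)) - (U w + tg * (r * D w)) =
        t * (r * ((weight N n.+1 w - gg n.+1) * D w)).
        by rewrite /U /tg /B /D /pgamma; ring.
      by rewrite !normrM (gtr0_norm r0).
  apply: (@le_trans _ _ (`|t| * r / 2 * \int[Q N]_w ((weight N n.+1 w - gg n.+1) ^+ 2) +
      `|t| * r / 2 * \int[Q N]_w (D w ^+ 2))).
    apply: Rintegral_le2.
    - apply/bmeasZ/bmeasZ/bmeasM; last exact: bmeas_norm.
      by apply/bmeas_norm/bmeasB => //; exact: bmeas_cst.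
    - by apply/bmeasX/bmeasB => //; exact: bmeas_cst.
    - exact: bmeasX.
    - move=> w; rewrite -(real_normK (num_real (D w))).
      rewrite -(real_normK (num_real (weight N n.+1 w - gg n.+1))).
      set x := `|_ - _|; set y := `|D w|.
      have -> : `|t| * r / 2 * x ^+ 2 + `|t| * r / 2 * y ^+ 2 =
        (`|t| * r) * ((x ^+ 2 + y ^+ 2) / 2) by ring.
      rewrite [leLHS]mulrA ler_wpM2l ?mulr_ge0 ?(ltW r0)//.
      by have := sqr_ge0 (x - y); rewrite !expr2; lra.
  rewrite -mulrDr; apply: (@le_trans _ _ (`|t| * r / 2 * (Cw / N.+1%:R + M ^+ 2 / N.+1%:R))).
    by rewrite ler_wpM2l ?mulr_ge0 ?(ltW r0)// lerD//; exact: pred_L2.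
  by rewrite -r2 le_eqVlt; apply/orP; left; apply/eqP; field; rewrite gt_eqF.
(* The error [r^2 ((a/r)^3 + 2 (a/r)^4)] of the conditional limit theorem is of order [1 / r], since
   [r >= 1]. *)
have d23 : `|I2 - I3| <= (a ^+ 3 + a ^+ 4 *+ 2) / r.
  apply: (le_trans (pred_clt mU hf fM (t := tg) (erefl _))).
  rewrite -/r mulrA -/a -r2.
  have a0 : 0 <= a by rewrite !mulr_ge0// (le_trans _ (fM point)).
  apply: (@le_trans _ _ (a ^+ 3 / r + (a ^+ 4 *+ 2) / r * r^-1)).
    by rewrite le_eqVlt; apply/orP; left; apply/eqP; field; rewrite gt_eqF.
  rewrite [leRHS]mulrDl lerD2l ler_piMr ?invf_le1// divr_ge0 ?(ltW r0)//.
  by rewrite mulrn_wge0// exprn_ge0.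
(* Freezing the conditional variance makes the Gaussian factor deterministic, so it leaves the
   integral. *)
have d34 : `|I3 - I4| <= (tg ^+ 2 / 2 * Cv) / r.
  rewrite /I4 -(RintegralZ_bmeas (prob_lty (Q N)) e (bmeas_cos hU.1)).
  apply: (@le_trans _ _ (\int[Q N]_w (tg ^+ 2 / 2 * `|va w - sigma2 f|))).
    have hvs : bmeas (fun w => `|va w - sigma2 f|).
      by apply/bmeas_norm/bmeasB => //; exact: bmeas_cst.
    apply: (le_dist_Rintegral_prob (Q N)).
    - apply: bmeasM; first exact: bmeas_cos hU.1.
      apply: bmeas_expRN; first exact: (bmeasM (bmeasZ _ hva) (bmeas_cst _ _)).1.
      by move=> w; rewrite divr_ge0// mulr_ge0// sqr_ge0.
    - exact/bmeasZ/(bmeas_cos hU.1).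
    - exact: bmeasZ.
    - move=> w; rewrite mulrC -mulrBl normrM.
      apply: (@le_trans _ _ (`|expR (- (tg ^+ 2 * va w / 2)) - e| * 1)).
        by rewrite ler_wpM2l// cos_max.
      rewrite mulr1; apply: (le_trans (expRN_lip _ _)).
      + by rewrite divr_ge0// mulr_ge0// sqr_ge0.
      + by rewrite divr_ge0// mulr_ge0 ?sqr_ge0//; exact: sigma2_ge0.
      have -> : tg ^+ 2 * va w / 2 - tg ^+ 2 * sigma2 f / 2 = (tg ^+ 2 / 2) * (va w - sigma2 f) by ring.
      by rewrite normrM ger0_norm// divr_ge0// sqr_ge0.
  rewrite (RintegralZ_bmeas (prob_lty (Q N))).
    by rewrite -[leRHS]mulrA ler_wpM2l ?divr_ge0 ?sqr_ge0//; exact: hCv.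
  by apply/bmeas_norm/bmeasB => //; exact: bmeas_cst.
have -> : cos s * expR (- ((gg n.+1 ^+ 2 * sigma2 f + v) * t ^+ 2 / 2)) =
    e * (cos s * expR (- (v * t ^+ 2 / 2))).
  by rewrite [RHS]mulrCA -expRD; congr (_ * expR _); rewrite /tg; field.
(* What remains is the hypothesis on [B], multiplied by a factor at most 1. *)
have d45 : `|I4 - e * (cos s * expR (- (v * t ^+ 2 / 2)))| <= CB / r.
  have /andP[e0 e1'] := e1.
  rewrite -mulrBr normrM (ger0_norm e0) (le_trans _ (hCB N s))//.
  by rewrite -[leRHS]mul1r ler_wpM2r.
rewrite [leRHS]mulrDl [X in _ <= X + _]mulrDl [X in _ <= X + _ + _]mulrDl -/I1.
have -> : I1 - e * (cos s * expR (- (v * t ^+ 2 / 2))) =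
  (I1 - I2) + (I2 - I3) + (I3 - I4) + (I4 - e * (cos s * expR (- (v * t ^+ 2 / 2)))) by ring.
do 3 (rewrite (le_trans (ler_normD _ _))// lerD//).
Qed.

Fixpoint asymp_var n : (F n.+1 -> R) -> R :=
  match n return (F n.+1 -> R) -> R with
  | 0 => fun f => gg 1 ^+ 2 * sigma2 f
  | n'.+1 => fun f => gg n'.+2 ^+ 2 * sigma2 f + asymp_var (Qop K G f)
  end.

Lemma asymp_var_ge0 n (f : F n.+1 -> R) : bmeas f -> 0 <= asymp_var f.
Proof.
elim: n f => [|n IH] f hf /=; last rewrite addr_ge0 ?IH//; last exact: bQ.
all: by rewrite mulr_ge0 ?sqr_ge0//; exact: sigma2_ge0.
Qed.

Lemma pgamma_asymp_gauss n (f : F n.+1 -> R) : bmeas f ->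
  asymp_gauss Q (fun N w => pgamma f w - gamma P X G f) (asymp_var f).
Proof.
elim: n f => [|n IH] f hf.
  (* For the first generation the predicted part is exactly its limit, so it contributes variance 0
     with error 0. *)
  rewrite -[asymp_var f]addr0; apply: asymp_gauss_step => // t; exists 0 => N s.
  rewrite [leRHS]mul0r normr_le0 subr_eq0; apply/eqP.
  rewrite !mul0r oppr0 expR0 mulr1 -[RHS](Rintegral_cst_prob (Q N)).
  apply: eq_Rintegral => w _; rewrite weight1 mul1r /pred_mean.
  have -> : gamma P X G f = Defs.eta P X G f.
    by rewrite gamma_eta /gg gamma1 Rintegral_cst_prob mulr1.
  by rewrite subrr !mulr0 addr0.
apply: asymp_gauss_step => //; first exact/asymp_var_ge0/bQ.
move=> t; have [C hC] := IH _ (bQ hf) t; exists C => N s.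
rewrite gamma_step//; under eq_Rintegral do rewrite weight_pred.
exact: hC.
Qed.

End particle_asymptotics.

(** * The limit law of a ratio *)

Section ratio.
Context (R : realType) (dS : nat -> measure_display) (S : forall N, measurableType (dS N)).
Context (Q : forall N, probability (S N) R).

(* Where [p / 2 <= D], [Z - U / p] is of order [U * (D - p)]; elsewhere it is bounded
   and [(D - p) ^ 2] is bounded below. *)
Lemma asymp_gauss_ratio (U D Z : forall N, S N -> R) p v : 0 < p ->
  tame Q U 0 -> tame Q D p ->
  (exists M : R, forall N w, `|Z N w| <= M) -> (forall N, measurable_fun setT (Z N)) ->
  (forall N w, D N w != 0 -> Z N w = U N w / D N w) -> asymp_gauss Q U v ->
  tame Q Z 0 /\ asymp_gauss Q Z (p ^- 2 * v).
Proof.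
move=> p0 tU tD [M ZM] mZ ZE aU.
have [[MU UM] mU [CU hCU]] := tU; have [_ mD [CD hCD]] := tD.
have hU N := tame_bmeas N tU; have hD N := tame_bmeas N tD.
have hZ N : bmeas (Z N) by split => //; exists M.
pose Y N w := p^-1 * U N w; have hY N : bmeas (Y N) by exact: bmeasZ.
pose B := M + p^-1 * MU.
have ZYB N w : `|Z N w - Y N w| <= B.
  rewrite (le_trans (ler_normB _ _))// lerD// normrM gtr0_norm ?invr_gt0//.
  by rewrite ler_wpM2l// invr_ge0 ltW.
have B0 : 0 <= B by rewrite (le_trans _ (ZYB 0%N point)).
have p20 : 0 < p ^- 2 by rewrite invr_gt0 exprn_gt0.
(* The first term comes from [2 |U| |D - p| <= U^2 + (D - p)^2] where [D >= p / 2]; the second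
   converts the bound [B] elsewhere, where [(D - p)^2 >= p^2 / 4]. *)
pose c2 := p ^- 2 + 4 * B * p ^- 2.
have c20 : 0 <= c2 by rewrite addr_ge0 ?(ltW p20)// mulr_ge0 ?(ltW p20)// mulr_ge0.
have near N w : `|Z N w - Y N w| <= p ^- 2 * U N w ^+ 2 + c2 * (D N w - p) ^+ 2.
  have U2 := sqr_ge0 (U N w); have D2 := sqr_ge0 (D N w - p).
  have [Dp|Dp] := leP (p / 2) (D N w).
    have D0 : 0 < D N w by apply: lt_le_trans Dp; rewrite divr_gt0.
    rewrite ZE ?gt_eqF// /Y.
    have -> : U N w / D N w - p^-1 * U N w = (D N w)^-1 * p^-1 * (U N w * (p - D N w)).
      by field; rewrite !gt_eqF.
    rewrite normrM gtr0_norm ?mulr_gt0 ?invr_gt0// normrM.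
    apply: (@le_trans _ _ (2 * p ^- 2 * (`|U N w| * `|p - D N w|))).
      rewrite ler_wpM2r ?mulr_ge0//.
      have -> : 2 * p ^- 2 = (p / 2)^-1 * p^-1 by field; rewrite gt_eqF.
      by rewrite ler_wpM2r ?invr_ge0 ?(ltW p0)// lef_pV2 ?posrE// divr_gt0.
    apply: (@le_trans _ _ (p ^- 2 * (U N w ^+ 2 + (D N w - p) ^+ 2))).
      rewrite [X in X * _ <= _]mulrC -mulrA ler_wpM2l ?(ltW p20)// distrC.
      have := sqr_ge0 (`|U N w| - `|D N w - p|).
      rewrite sqrrB !real_normK ?num_real//; lra.
    rewrite mulrDr lerD2l ler_wpM2r// lerDl mulr_ge0 ?(ltW p20)//.
    by rewrite mulr_ge0.
  apply: (le_trans (ZYB N w)).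
  (* The difference of the two sides is [(p/2 - D) (3p/2 - D)], and both factors are positive
     here. *)
  have : p ^+ 2 / 4 <= (D N w - p) ^+ 2.
    have : 0 <= (p / 2 - D N w) * (3 * p / 2 - D N w).
      by rewrite mulr_ge0// subr_ge0; lra.
    by rewrite !expr2; lra.
  move=> Dp2; apply: (@le_trans _ _ (4 * B * p ^- 2 * (D N w - p) ^+ 2)).
    rewrite [leLHS](_ : _ = 4 * B * p ^- 2 * (p ^+ 2 / 4)).
      by rewrite ler_wpM2l// mulr_ge0 ?(ltW p20)// mulr_ge0.
    by field; rewrite gt_eqF.
  have := mulr_ge0 (ltW p20) U2; have := mulr_ge0 (ltW p20) D2.
  by rewrite /c2 [X in _ <= _ + X]mulrDl; lra.
have L1 N : \int[Q N]_w `|Z N w - Y N w| <= (p ^- 2 * CU + c2 * CD) / N.+1%:R.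
  apply: (@le_trans _ _ (p ^- 2 * \int[Q N]_w (U N w ^+ 2) +
    c2 * \int[Q N]_w ((D N w - p) ^+ 2))).
    apply: Rintegral_le2 => //; [exact/bmeas_norm/bmeasB|exact: bmeasX|].
    by apply/bmeasX/bmeasB => //; exact: bmeas_cst.
  have := hCU N; under eq_Rintegral do rewrite subr0.
  move=> hCUN; rewrite [leRHS]mulrDl -[X in _ <= X + _]mulrA -[X in _ <= _ + X]mulrA.
  by rewrite lerD// ler_wpM2l// ltW.
split; last first.
  apply: (asymp_gauss_close hY hZ); first by exists (p ^- 2 * CU + c2 * CD).
  by have := asymp_gaussZ p^-1 aU; rewrite exprVn.
apply: (tame_le2 (a := 2 * p ^- 2 + 2 * B * p ^- 2) (b := 2 * B * c2) tU tD) => //.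
- by rewrite addr_ge0// ?mulr_ge0// ltW.
- by rewrite mulr_ge0// mulr_ge0.
- by exists M.
- move=> N w; rewrite !subr0.
  (* In the square of [Z - Y] one factor is bounded by [B] and the other by [near], leaving squares
     of [U] and of [D - p] only. *)
  have e1 : (Z N w) ^+ 2 <= 2 * Y N w ^+ 2 + 2 * `|Z N w - Y N w| ^+ 2.
    rewrite real_normK ?num_real//; have := sqr_ge0 (Z N w - 2 * Y N w).
    by rewrite !expr2; lra.
  have e2 : `|Z N w - Y N w| ^+ 2 <= B * (p ^- 2 * U N w ^+ 2 + c2 * (D N w - p) ^+ 2).
    by rewrite expr2 ler_pM.
  have e3 : Y N w ^+ 2 = p ^- 2 * U N w ^+ 2 by rewrite exprMn exprVn.
  rewrite (le_trans e1)// e3; lra.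
Qed.

End ratio.

(** * Rare events *)

(** [cond_exp] unfolds by one transition from [p] to [p.+1], so inductions on it start at the
    horizon [n]. *)
Lemma downward_ind (Pr : nat -> Prop) n : Pr n ->
  (forall p, (p < n)%N -> Pr p.+1 -> Pr p) -> forall p, (p <= n)%N -> Pr p.
Proof.
move=> Pn IH p /subnK; move: (n - p)%N => k; elim: k p => [|k IHk] p e.
  by rewrite -[p]add0n e.
by apply: IH; [rewrite -e addSn ltnS leq_addl|apply: IHk; rewrite addnS -addSn].
Qed.

Section cond_exp_theory.
Context (d : nat -> measure_display) (S : forall n, measurableType (d n)).
Context (R : realType) (L : forall n, R.-pker (S n) ~> (S n.+1)).

Lemma cond_exp_kernel_op p n (f : S n -> R) : (p < n)%N ->
  cond_exp L p n f = kernel_op (L p) (cond_exp L p.+1 n f).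
Proof. by move=> pn; apply/funext => x; rewrite cond_exp_step. Qed.

Lemma bmeas_cond_exp p n (f : S n -> R) : (p <= n)%N -> bmeas f ->
  bmeas (cond_exp L p n f).
Proof.
move=> pn hf; move: p pn; apply: downward_ind => [|p pn IH]; first by rewrite cond_expE.
by rewrite cond_exp_kernel_op//; exact: bmeas_kernel_op.
Qed.

(** [cond_exp_step] peels off the earliest kernel; here the latest one is absorbed, which is what
    the recursion of [asymp_var] on the horizon produces. *)
Lemma cond_exp_shift p n (f : S n.+1 -> R) : (p <= n)%N ->
  cond_exp L p n (kernel_op (L n) f) = cond_exp L p n.+1 f.
Proof.
move: p; apply: downward_ind => [|p pn IH].
  by rewrite cond_expE cond_exp_kernel_op// cond_expE.
by rewrite cond_exp_kernel_op// IH [RHS]cond_exp_kernel_op// ltnW.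
Qed.

End cond_exp_theory.

(** * Identification of the asymptotic variances *)

Section variances.
Context (d : nat -> measure_display) (E : forall n, measurableType (d n)).
Context (R : realType) (K : forall n, R.-pker (E n) ~> (E n.+1)) (x0 : E 0%N).
Context (dO : measure_display) (Omega : measurableType dO).
Context (P : probability Omega R) (X : forall n, Omega -> E n).
Local Notation F := (path_space E).
Hypothesis hX : markov_chain K x0 P X.
Context (G : forall n, F n -> R).
Hypothesis hG : potentials G.

(** The next point is drawn from the last coordinate alone, so a function of the endpoint stays one
    at each backward step. This connects [cond_prob] on [E p] with conditional expectations on
    paths. *)
Lemma cond_exp_last_pt p n (f : E n -> R) : (p <= n)%N -> bmeas f ->
  cond_exp (hist_pker K) p n (fun y => f (last_pt y)) =
  (fun y => cond_exp K p n f (last_pt y)).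
Proof.
move=> pn hf; have bc q : (q <= n)%N -> bmeas (cond_exp K q n f) by move=> qn; exact: bmeas_cond_exp.
move: p pn; apply: downward_ind => [|p pn IH]; first by rewrite !cond_expE.
rewrite cond_exp_kernel_op// IH; apply/funext => y.
rewrite [LHS]stepE; first by rewrite cond_exp_step.
exact: (bmeas_comp (@measurable_last_pt _ E p.+1) (bc _ pn)).
Qed.

Let bG n : (1 <= n)%N -> bmeas (@G n).
Proof. exact: bmeas_potential. Qed.

Let G_neq0 n : (1 <= n)%N -> forall y, @G n y != 0.
Proof. by move=> n1 y; have [_ G0 _] := hG n1; rewrite gt_eqF. Qed.

Let W n := @prod_along _ E R (inv_pot G) n.

Lemma bmeas_inv_weight n (f : F n -> R) : bmeas f -> bmeas (fun y => f y * W y).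
Proof.
move=> hf; apply: bmeasM => //; apply: bmeas_prod_along => q q1.
exact: (bmeas_potential (potentials_inv_pot hG)).
Qed.

(** The potential in [Qop] cancels the additional factor of the longer inverse weight, so the
    Feynman-Kac operator acts as the plain transition. *)
Lemma Qop_inv_weight n (f : F n.+2 -> R) : bmeas f ->
  Qop K G (fun y => f y * W y) = (fun y => step K f y * W y).
Proof.
move=> hf; apply/funext => y; rewrite /Qop !stepE//; last exact: bmeas_inv_weight.
have -> : \int[K n.+1 (last_pt y)]_x (f (y, x) * W ((y, x) : F n.+2)) =
    \int[K n.+1 (last_pt y)]_x ((W y / G y) * f (y, x)).
  by apply: eq_Rintegral => x _; rewrite /W prod_along_pair// mulrC.
rewrite RintegralZ_bmeas.
- by rewrite mulrA mulrCA divff ?mulr1 ?G_neq0// mulrC.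
- by rewrite prob_kernel ltry.
- exact: (bmeas_comp (measurable_pair1 _) hf).
Qed.

Lemma gamma_inv_weight n (f : F n -> R) :
  gamma P X G (fun y => f y * W y) = \int[P]_w f (history X n w).
Proof.
rewrite gammaE; apply: eq_Rintegral => w _.
by rewrite -mulrA [W _ * _]mulrC prod_along_inv ?mulr1//; exact: G_neq0.
Qed.

(** One of the two inverse weights cancels the product of potentials in [gamma]; the other is the
    density that defines the measure for [inv_pot G]. *)
Lemma gamma_inv_weight_sqr n (f : F n -> R) :
  gamma P X G (fun y => (f y * W y) ^+ 2) = gamma P X (inv_pot G) (fun y => f y ^+ 2).
Proof.
rewrite !gammaE; apply: eq_Rintegral => w _.
rewrite exprMn -mulrA expr2 -[X in _ * X]mulrA [W _ * prod_along _ _]mulrC.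
by rewrite prod_along_inv ?mulr1//; exact: G_neq0.
Qed.

(** In [gamma(1)^2] times a variance under [eta], the second moment keeps one factor [gamma(1)] and
    the squared mean keeps none, leaving the square of a plain expectation. *)
Let asymp_var_term n (f : F n -> R) : bmeas f ->
  gamma P X G (cst 1 : F n -> R) ^+ 2 *
    (Defs.eta P X G (fun y => (f y * W y) ^+ 2) - Defs.eta P X G (fun y => f y * W y) ^+ 2) =
  gamma P X G (cst 1 : F n -> R) * gamma P X (inv_pot G) (cst 1 : F n -> R) *
    Defs.eta P X (inv_pot G) (fun y => f y ^+ 2) - (\int[P]_w f (history X n w)) ^+ 2.
Proof.
move=> hf; rewrite /Defs.eta gamma_inv_weight gamma_inv_weight_sqr.
set g := gamma P X G _; set g' := gamma P X _ (cst 1 : F n -> R).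
have g0 : g != 0.
  apply/lt0r_neq0/(gamma_gt0 hX) => // q; exact: potential_lbound.
have g'0 : g' != 0.
  have hG' := potentials_inv_pot hG.
  by apply/lt0r_neq0/(gamma_gt0 hX) => q; [exact: bmeas_potential|exact: potential_lbound].
by field; rewrite g0 g'0.
Qed.

(** Each unrolling of [asymp_var] applies one transition to [f]. The expectation is unchanged by the
    Markov property, and the function reached at time [p] is the conditional expectation given the
    path up to [p]. *)
Lemma asymp_var_inv_weight n (f : F n.+1 -> R) : bmeas f ->
  asymp_var K P X G (fun y => f y * W y) =
  \sum_(1 <= p < n.+2)
    (gamma P X G (cst 1 : F p -> R) * gamma P X (inv_pot G) (cst 1 : F p -> R) *
     Defs.eta P X (inv_pot G) (fun y => cond_exp (hist_pker K) p n.+1 f y ^+ 2)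
     - (\int[P]_w f (history X n.+1 w)) ^+ 2).
Proof.
elim: n f => [|n IH] f hf.
  by rewrite big_nat1 cond_expE -asymp_var_term.
rewrite big_nat_recr//= Qop_inv_weight// IH; last exact: bmeas_kernel_op.
rewrite addrC asymp_var_term// cond_expE; congr (_ + _).
apply: eq_big_nat => p /andP[_ pn].
by rewrite (markov_hist hX hf) cond_exp_shift.
Qed.

Context (V : forall n, E n -> R).
Hypothesis mV : forall n, measurable_fun setT (@V n).

Let measurable_rare n a : measurable [set x | a <= @V n x].
Proof.
rewrite (_ : [set _ | _] = @V n @^-1` `[a, +oo[).
  by rewrite -[X in measurable X]setTI; exact: mV.
by apply/seteqP; split => x /=; rewrite in_itv/= andbT.
Qed.

Lemma bmeas_rare n a : bmeas (\1_[set x | a <= @V n x] : E n -> R).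
Proof. exact/bmeas_indic/measurable_rare. Qed.

Lemma bmeas_rare_weight n a (f : F n -> R) : bmeas f ->
  bmeas (fun y => f y * \1_[set x | a <= @V n x] (last_pt y)).
Proof.
by move=> hf; apply: bmeasM => //; exact: (bmeas_comp (@measurable_last_pt _ E n) (bmeas_rare n a)).
Qed.

Lemma bmeas_T_fun n a (f : F n -> R) : bmeas f -> bmeas (T_fun G V a f).
Proof. by move=> hf; apply: bmeas_inv_weight; exact: bmeas_rare_weight. Qed.

Lemma T_fun_ge0 n a (y : F n) : 0 <= T_fun G V a (cst 1 : F n -> R) y.
Proof.
have [c c0 hc] := prod_along_gt0 (fun q => potential_lbound (potentials_inv_pot hG) (n := q)) n.
by rewrite /T_fun mul1r mulr_ge0 ?indicE// (le_trans (ltW c0) (hc y)).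
Qed.

Lemma rare_probE n a :
  \int[P]_w (1 * \1_[set x | a <= @V n x] (last_pt (history X n w))) = rare_prob V P X n a.
Proof.
under eq_Rintegral do rewrite mul1r last_pt_history.
rewrite /rare_prob -Rintegral_indic//.
have [mX _ _] := hX.
by rewrite -[X in measurable X]setTI; exact: (mX n measurableT _ (measurable_rare n a)).
Qed.

Lemma gamma_T_fun n a (f : F n -> R) : gamma P X G (T_fun G V a f) =
  \int[P]_w (f (history X n w) * \1_[set x | a <= @V n x] (last_pt (history X n w))).
Proof. exact: gamma_inv_weight. Qed.

Lemma var_probE n a :
  asymp_var K P X G (T_fun G V a (cst 1 : F n.+1 -> R)) = var_prob K G V P X n.+1 a.
Proof.
rewrite asymp_var_inv_weight; last exact: (bmeas_rare_weight _ (bmeas_cst _ 1)).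
rewrite rare_probE /var_prob; apply: eq_big_nat => p /andP[_ pn]; rewrite /cond_prob.
have -> : (fun y : F n.+1 => (cst 1 y : R) * \1_[set x | a <= V x] (last_pt y)) =
    (fun y => \1_[set x | a <= V x] (last_pt y)) by apply/funext => y; rewrite mul1r.
by rewrite (@cond_exp_last_pt p n.+1 _ pn (bmeas_rare n.+1 a)).
Qed.

(** [rare_mean] is the quotient that makes this integral vanish. The numerator of the second
    estimator thus has limit 0, and the squares subtracted in the variance disappear. *)
Lemma rare_mean_centered n a (phi : F n -> R) : 0 < rare_prob V P X n a -> bmeas phi ->
  \int[P]_w ((phi (history X n w) - rare_mean V P X a phi) *
     \1_[set x | a <= @V n x] (last_pt (history X n w))) = 0.
Proof.
move=> p0 hphi; set m := rare_mean _ _ _ _ _.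
have hh (f : F n -> R) : bmeas f ->
    bmeas (fun w => f (history X n w) * \1_[set x | a <= @V n x] (last_pt (history X n w))).
  move=> hf; have [mX _ _] := hX.
  exact: (bmeas_comp (measurable_history mX (n := n)) (bmeas_rare_weight a hf)).
under eq_Rintegral do rewrite mulrBl.
rewrite (RintegralB_bmeas (prob_lty P) (hh _ hphi) (hh _ (bmeas_cst _ m))).
rewrite -[X in _ - X]/(\int[P]_w (m * \1_[set x | a <= @V n x] (last_pt (history X n w)))).
have -> : \int[P]_w (m * \1_[set x | a <= @V n x] (last_pt (history X n w))) =
    m * rare_prob V P X n a.
  rewrite -rare_probE -(RintegralZ_bmeas (prob_lty P)); last exact: (hh _ (bmeas_cst _ 1)).
  by apply: eq_Rintegral => w _; rewrite mul1r.
rewrite /m /rare_mean divfK ?gt_eqF//.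
apply/eqP; rewrite subr_eq0; apply/eqP; apply: eq_Rintegral => w _.
by rewrite last_pt_history.
Qed.

Lemma var_meanE n a (phi : F n.+1 -> R) : 0 < rare_prob V P X n.+1 a -> bmeas phi ->
  rare_prob V P X n.+1 a ^- 2 *
    asymp_var K P X G (T_fun G V a (fun y => phi y - rare_mean V P X a phi)) =
  var_mean K G V P X a phi.
Proof.
move=> p0 hphi; have hc := bmeasB hphi (bmeas_cst _ (rare_mean V P X a phi)).
rewrite asymp_var_inv_weight; last exact: bmeas_rare_weight.
rewrite rare_mean_centered// /var_mean; congr (_ * _).
by apply: eq_bigr => p _; rewrite expr0n subr0.
Qed.

End variances.

Theorem theorem2p3 (R : realType)
    (d : nat -> measure_display) (E : forall n, measurableType (d n))
    (K : forall n, R.-pker (E n) ~> (E n.+1)) (x0 : E 0%N)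
    (dO : measure_display) (Omega : measurableType dO)
    (P : probability Omega R) (X : forall n, Omega -> E n)
    (V : forall n, E n -> R)
    (G : forall n, path_space E n -> R)
    (dS : nat -> measure_display) (S : forall N, measurableType (dS N))
    (Q : forall N, probability (S N) R)
    (xi : forall N n, 'I_N -> S N -> path_space E n)
    (hX : markov_chain K x0 P X)
    (hV : forall n, measurable_fun setT (V n))
    (hG : potentials G)
    (hxi : forall N, (1 <= N)%N -> particle_system K G P X (Q N) (xi N))
    (n : nat) (hn : (1 <= n)%N) (a : R) (ha : 0 < rare_prob V P X n a) :
  (forall N, (1 <= N)%N ->
     ('E_(Q N)[rare_prob_est G V (xi N) n a])%E = (rare_prob V P X n a)%:E) /\
  (0 <= var_prob K G V P X n a /\
   cvg_in_law Q
     (fun N w => Num.sqrt N%:R *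
        (rare_prob_est G V (xi N) n a w - rare_prob V P X n a))
     (centered_gaussian (var_prob K G V P X n a))) /\
  (forall phi : path_space E n -> R, measurable_fun setT phi ->
     bounded_fun phi ->
     0 <= var_mean K G V P X a phi /\
     cvg_in_law Q
       (fun N w => Num.sqrt N%:R *
          (rare_mean_est G V (xi N) a phi w - rare_mean V P X a phi))
       (centered_gaussian (var_mean K G V P X a phi))).
Proof.
case: n hn ha => // n _ ha; set F := path_space E.
pose Q' N : probability (S N.+1) R := Q N.+1.
pose xi' N : forall m, 'I_N.+1 -> S N.+1 -> F m := xi N.+1.
have hxi' N : particle_system K G P X (Q' N) (xi' N) by exact: hxi.
(* Particle systems are given for [N >= 1] only, so all limits are taken along [N.+1]; dropping the
   index 0 does not change a limit. *)
have shift (Z : forall N, S N -> R) mu :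
    cvg_in_law Q' (fun N => Z N.+1) mu -> cvg_in_law Q Z mu.
  by move=> cZ f cf bf; have := cZ f cf bf; rewrite -(cvg_shiftS (fun N => \int[Q N]_w f (Z N w))).
pose T (f : F n.+1 -> R) := T_fun G V a f.
have bT f : bmeas f -> bmeas (T f) by exact: bmeas_T_fun.
have b1 : bmeas (cst 1 : F n.+1 -> R) by exact: bmeas_cst.
have estE N (w : S N.+1) : rare_prob_est G V (xi N.+1) n.+1 a w =
    pgamma G xi' (N := N) (T (cst 1)) w.
  exact: (gammaN_pgamma hG xi' w (bT _ b1)).
have gT1 : gamma P X G (T (cst 1)) = rare_prob V P X n.+1 a.
  by rewrite [LHS](gamma_T_fun P X hG); exact: (rare_probE hX hV).
split; [|split].
- case=> // N _; rewrite unlock.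
  transitivity (\int[Q' N]_w pgamma G xi' (T (cst 1)) w)%:E; last first.
    by rewrite (pgamma_unbiased hX hG hxi' N (bT _ b1)) gT1.
  have hp := bmeas_pgamma hG hxi' N (bT _ b1).
  rewrite /Rintegral fineK; last exact: integrable_fin_num (bmeas_integrable (prob_lty (Q' N)) hp).
  by apply: eq_integral => w _; rewrite estE.
- have v0 : 0 <= var_prob K G V P X n.+1 a.
    by rewrite -(var_probE hX hG hV); exact: (asymp_var_ge0 hX hG (bT _ b1)).
  split => //; apply: shift.
  rewrite (_ : (fun N => _) = (fun N w => Num.sqrt N.+1%:R *
      (pgamma G xi' (T (cst 1)) w - gamma P X G (T (cst 1))))); last first.
    apply: functional_extensionality_dep => N; apply/funext => w.
    by rewrite estE gT1.
  apply: asymp_gauss_cvg => //.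
  + have := tameD (tame_pgamma hX hG hxi' (bT _ b1)) (tame_cst Q' (- gamma P X G (T (cst 1)))).
    by rewrite subrr.
  + by rewrite -(var_probE hX hG hV); exact: (pgamma_asymp_gauss hX hG hxi' (bT _ b1)).
- move=> phi mphi bphi; have hphi : bmeas phi.
    split => //; have [M [_ hM]] := bphi.
    by exists (M + 1) => x; apply: hM => //; rewrite ltrDl.
  set m := rare_mean V P X a phi; set p := rare_prob V P X n.+1 a.
  (* With [phi] centered at [m], the error of the ratio estimator is [U / D] wherever [D] is
     nonzero. *)
  pose c y := phi y - m; have hc : bmeas c by apply: bmeasB => //; exact: bmeas_cst.
  pose U N (w : S N.+1) := pgamma G xi' (T c) w.
  pose D N (w : S N.+1) := pgamma G xi' (T (cst 1)) w.
  pose Z N (w : S N.+1) := rare_mean_est G V (xi' N) a phi w - m.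
  have gTc : gamma P X G (T c) = 0.
    by rewrite [LHS](gamma_T_fun P X hG); exact: (rare_mean_centered hX hV ha hphi).
  have tU : tame Q' U 0 by rewrite -gTc; exact: (tame_pgamma hX hG hxi' (bT _ hc)).
  have tD : tame Q' D p by rewrite /p -gT1; exact: (tame_pgamma hX hG hxi' (bT _ b1)).
  have aU : asymp_gauss Q' U (asymp_var K P X G (T c)).
    have := pgamma_asymp_gauss hX hG hxi' (bT _ hc); rewrite gTc => aU t; have [C hC] := aU t.
    by exists C => N s; have := hC N s; under eq_Rintegral do rewrite subr0.
  have ratioE N (w : S N.+1) : rare_mean_est G V (xi' N) a phi w =
      smean (xi' N) (T phi) w / smean (xi' N) (T (cst 1)) w.
    by rewrite /rare_mean_est !etaN_smean//; exact: bT.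
  have bsmean N f : bmeas f -> bmeas (smean (xi' N) (T f)).
    by move=> /bT; exact: (bmeas_smean (hxi' N)).
  have smean1_ge0 N (w : S N.+1) : 0 <= smean (xi' N) (T (cst 1)) w.
    by apply: smean_ge => // y; exact: T_fun_ge0.
  have smeanE N (w : S N.+1) : smean (xi' N) (T c) w =
      smean (xi' N) (T phi) w - m * smean (xi' N) (T (cst 1)) w.
    rewrite /smean /sample_mean [m * _]mulrCA -mulrBr [m * _]mulr_sumr -sumrB; congr (_ * _).
    by apply: eq_bigr => i _; rewrite /T /T_fun /c mul1r; ring.
  have [M phiM] := hphi.2.
  have [tZ aZ] : tame Q' Z 0 /\ asymp_gauss Q' Z (p ^- 2 * asymp_var K P X G (T c)).
    apply: (asymp_gauss_ratio ha tU tD) => //.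
    + exists (M + `|m|) => N w; rewrite (le_trans (ler_normB _ _))// lerD// ratioE.
      (* [T phi] is [phi] times the nonnegative [T (cst 1)], so the ratio is at most [M] however
         small the denominator. *)
      have le1 : `|smean (xi' N) (T phi) w| <= M * smean (xi' N) (T (cst 1)) w.
        rewrite /smean /sample_mean normrM ger0_norm ?invr_ge0// mulrCA ler_wpM2l ?invr_ge0//.
        rewrite (le_trans (ler_norm_sum _ _ _))// [M * _]mulr_sumr ler_sum// => i _.
        rewrite (_ : T phi _ = phi (xi' N n.+1 i w) * T (cst 1) (xi' N n.+1 i w)).
          by rewrite normrM (ger0_norm (T_fun_ge0 hG _ _ _)) ler_wpM2r// T_fun_ge0.
        by rewrite /T /T_fun mul1r mulrA.
      (* A zero denominator gives the ratio the value 0, which respects the bound. *)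
      have := smean1_ge0 N w; rewrite le_eqVlt => /orP[/eqP <-|w0].
        by rewrite invr0 mulr0 normr0 (le_trans _ (phiM point)).
      by rewrite normrM normfV (gtr0_norm w0) ler_pdivrMr.
    + move=> N; apply: measurable_funB => //.
      rewrite (_ : rare_mean_est _ _ _ _ _ = fun w : S N.+1 =>
        smean (xi' N) (T phi) w * (smean (xi' N) (T (cst 1)) w)^-1); last first.
        by apply/funext => w; rewrite ratioE.
      apply: measurable_funM; first exact: (bsmean N _ hphi).1.
      by apply: measurable_funV => //; exact: (bsmean N _ b1).1.
    (* Numerator and denominator carry the same weight, which is nonzero together with [D] and
       cancels. *)
    + move=> N w; rewrite /Z /U /D /pgamma smeanE ratioE mulf_eq0 negb_or => /andP[s0 w0].
      by field; rewrite s0 w0.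
  rewrite (var_meanE hX hG hV ha hphi) in aZ.
  have v0 : 0 <= var_mean K G V P X a phi.
    rewrite -(var_meanE hX hG hV ha hphi) mulr_ge0 ?invr_ge0 ?sqr_ge0//.
    exact: (asymp_var_ge0 hX hG (bT _ hc)).
  by split => //; apply: shift; exact: asymp_gauss_cvg.
Qed.
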